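(* Consider the multi-agent system $\dot{\mathbf{p}}_i=\mathbf{u}_i$, $i\in\mathbb{I}_N=\{1,\dots,N\}$, with partition dynamics $$\dot{\mathbf{s}}_i=-\kappa_s\,(m_i-m_{i-1})\,\nu_i$$ and control input $$\mathbf{u}_i=-\kappa_p\,\frac{\partial E}{\partial\mathbf{p}_i},\qquad E=\tfrac12\,d_g^2(\mathbf{p}_i,\mathbf{q}_i^* ).$$ Then every agent reaches the optimal configuration of its subregion without getting stuck by the boundaries of the coverage region or obstacles; that is, for every $i\in\mathbb{I}_N$, $\lim_{t\to+\infty}\mathbf{p}_i(t)=\mathbf{q}_i^*$, where $\mathbf{q}_i^*=\lim_{t\to+\infty}\mathbf{q}_i^*(t)$ is the limiting optimal position of the $i$-th subregion, and $\mathbf{p}_i(t)\notin\partial\Omega$ for all finite $t\ge 0$.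
   Context: $\Omega\subset\mathbb{R}^2$ is an annular region bounded by two closed smooth curves: an inner boundary curve $l_{\text{in}}$, which encloses a convex region, and an outer boundary curve $l_{\text{out}}$, which encloses a star-shaped region; the enclosed hole is regarded as an obstacle. It is described as $\Omega=\{\mathbf{q}\in\mathbb{R}^2:h(\mathbf{q})\ge 0\}$ with $h$ continuously differentiable and $h(\mathbf{q})=0$ if and only if $\mathbf{q}\in\partial\Omega$. There are $N$ agents with positions $\mathbf{p}_i\in\mathbb{R}^2$, starting off the boundary $\partial\Omega$, with indices taken cyclically modulo $N$ (index $0$ means $N$, index $N+1$ means $1$). Agent $i$ has a virtual partition bar with base point $\mathbf{s}_i$ on the inner boundary $l_{\text{in}}$: $\xi_i=\{\mathbf{q}\in\Omega:(\mathbf{q}-\mathbf{s}_i)^T\nu_i=0\}$, where $\nu_i$ is the unit tangent vector to the inner boundary at $\mathbf{s}_i$; of this set one takes the piece emanating from $\mathbf{s}_i$ and running to the outer boundary (the connected component containing $\mathbf{s}_i$). The bars divide $\Omega$ into $N$ subregions; $\Omega_i=\Omega_i(\mathbf{s})$, $\mathbf{s}=(\mathbf{s}_1,\dots,\mathbf{s}_N)$, is the subregion bounded by $l_{\text{in}}$, $l_{\text{out}}$, $\xi_i$ and $\xi_{i+1}$. The density $\rho:\Omega\to\mathbb{R}^+$ takes values in a bounded interval $[\underline{\rho},\bar{\rho}]$. The workload on $\Omega_i$ is $m_i=\int_{\Omega_i}\rho(\mathbf{q})\,d\mathbf{q}$. The orientation of $\nu_i$ is such that $m_i$ increases when $\mathbf{s}_i$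 moves in the direction $\nu_i$. $\kappa_s>0$ and $\kappa_p>0$ are constant gains. The coverage cost is $J(\mathbf{p},\mathbf{s})=\sum_{i=1}^N J_i$ with $J_i=\int_{\Omega_i(\mathbf{s})}f(\mathbf{p}_i,\mathbf{q})\rho(\mathbf{q})\,d\mathbf{q}$, where $\mathbf{p}=(\mathbf{p}_1,\dots,\mathbf{p}_N)$ and $f(\mathbf{p}_i,\mathbf{q})$ quantifies the cost of moving from $\mathbf{p}_i$ to $\mathbf{q}$; $J$ is assumed to be a smooth function. The optimal position $\mathbf{q}_i^*(t)$ is the minimizer of $J_i$ (as a function of $\mathbf{p}_i$) over the set of critical points $\Pi_i=\{\mathbf{p}_i\in\Omega_i:\nabla_{p_i}J=0\}$; it is an interior point of $\Omega_i$. It depends on time through $\mathbf{s}(t)$. The Riemannian metric is $g_{jk}(\mathbf{q})=\delta_{jk}/h^2(\mathbf{q})$, $j,k\in\{1,2\}$ ($\delta_{jk}$ the Kronecker delta). The length of a path $\gamma=(x^1,x^2):[0,1]\to\Omega$ is $L(\gamma)=\int_0^1\sqrt{\sum_{j,k=1}^2 g_{jk}\frac{dx^j}{dt}\frac{dx^k}{dt}}\,dt$, and $d_g(\mathbf{x},\mathbf{y})$ is the infimum of $L(\gamma)$ over all rectifiable paths in $\Omega$ from $\mathbf{x}$ to $\mathbf{y}$. $\frac{\partial E}{\partial\mathbf{p}_i}$ denotes the gradient, with respect to the metric $g$, of $E=\frac12 d_g^2(\mathbf{p}_i,\mathbf{q}_i^* )$ in the variable $\mathbf{p}_i$; $E$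 is treated as a smooth function of its arguments.
   Formalization: The optimal positions are additionally assumed to depend smoothly on the partition base points along the trajectory and up to its limiting partition, where they must still be interior optima; otherwise the limit of the optimal positions may fail to exist. *)

(* Defs.v *)
From HB Require Import structures.
From mathcomp Require Export all_boot all_order all_algebra.
From mathcomp Require Export all_classical all_reals all_analysis.
Export Order.TTheory GRing.Theory Num.Theory.
Export numFieldNormedType.Exports.
Set Implicit Arguments.
Unset Strict Implicit.
Unset Printing Implicit Defensive.
Local Open Scope classical_set_scope.
Local Open Scope ring_scope.

Definition boundary (T : topologicalType) (A : set T) : set T :=
  closure A `\` A°.

(* f is of class C^k on some neighbourhood of x. *)
Fixpoint Ck_at (R : realType) (V W : normedModType R) (k : nat)
    (f : V -> W) (x : V) : Prop :=
  match k with
  | 0%N => \forall y \near x, {for y, continuous f}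
  | k'.+1 => (\forall y \near x, differentiable f y) /\
             (forall v : V, Ck_at k' ('D_v f) x)
  end.

Definition smooth_at (R : realType) (V W : normedModType R)
    (f : V -> W) (x : V) : Prop := forall k, Ck_at k f x.

Section plane.
Variable R : realType.
Implicit Types (u v x y q : 'rV[R]_2) (c : R -> 'rV[R]_2).

(* The library norm on 'rV_2 is the sup norm; these are the Euclidean ones. *)
Definition dot u v : R := (u *m v^T) 0 0.
Definition enorm u : R := Num.sqrt (dot u u).

Definition grad (F : 'rV[R]_2 -> R) x : 'rV[R]_2 :=
  \row_j 'D_(delta_mx 0 j) F x.

(* The library has no Lebesgue measure on 'rV_2, hence the detour through
   R * R with the product measure. *)
Definition point (z : R * R) : 'rV[R]_2 :=
  \row_j (if j == 0 then z.1 else z.2).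

Definition area : set (R * R) -> \bar R :=
  (@lebesgue_measure R \x @lebesgue_measure R)%E.

Definition plane_integral (A : set 'rV[R]_2) (F : 'rV[R]_2 -> R) : R :=
  (\int[area]_(z in point @^-1` A) F (point z))%R.

Definition plane_integrable (A : set 'rV[R]_2) (F : 'rV[R]_2 -> R) : Prop :=
  area.-integrable (point @^-1` A) (fun z => (F (point z))%:E).

(* Regular parametrization, of period 1, of a simple closed curve. *)
Definition smooth_closed_curve c : Prop :=
  [/\ forall t : R, smooth_at c t,
      forall t : R, derive1 c t != 0,
      forall t : R, c (t + 1) = c t
    & {in `[0, 1[ &, injective c}].

(* By the Jordan curve theorem D is then the bounded component of the
   complement of the curve. *)
Definition encloses c (D : set 'rV[R]_2) : Prop :=
  [/\ open D, bounded_set D, connected D & boundary D = range c].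

Definition star_shaped (D : set 'rV[R]_2) : Prop :=
  exists2 z, D z &
    forall x, D x -> forall t : R, 0 <= t <= 1 -> D (z + t *: (x - z)).

Definition annular_region cin cout (Omega : set 'rV[R]_2) : Prop :=
  exists Din Dout : set 'rV[R]_2,
    [/\ encloses cin Din /\ convex_set Din,
        encloses cout Dout /\ star_shaped Dout,
        closure Din `<=` Dout
      & Omega = closure Dout `\` Din].

End plane.

Section metric.
Variables (R : realType) (Omega : set 'rV[R]_2) (h : 'rV[R]_2 -> R).

Definition metric (q : 'rV[R]_2) : 'M[R]_2 :=
  \matrix_(j, k) ((j == k)%:R / h q ^+ 2).

(* g is infinite where h vanishes, whereas metric is 0 there since 0^-1 = 0. *)
Definition path_length (gamma : R -> 'rV[R]_2) : \bar R :=
  (\int[@lebesgue_measure R]_(t in `[0%R, 1%R])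
    (if h (gamma t) == 0%R then +oo
     else (Num.sqrt (\sum_j \sum_k
             metric (gamma t) j k * derive1 gamma t 0 j * derive1 gamma t 0 k))%:E))%E.

(* The integral formula gives the length of a rectifiable path only if the
   path is absolutely continuous (a monotone Cantor-type parametrization of a
   segment would get length 0). Every rectifiable path can be reparametrized by
   arc length, which makes it Lipschitz; almost everywhere differentiability
   is then automatic. *)
Definition rectifiable_path (x y : 'rV[R]_2) (gamma : R -> 'rV[R]_2) : Prop :=
  [/\ gamma 0 = x /\ gamma 1 = y,
      forall t, 0 <= t <= 1 -> Omega (gamma t),
      [lipschitz gamma t | t in `[0, 1]]
    & {ae @lebesgue_measure R, forall t, t \in `[0, 1] -> derivable gamma t 1}].

Definition dist_g (x y : 'rV[R]_2) : \bar R :=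
  ereal_inf (path_length @` rectifiable_path x y).

Definition energy (x q : 'rV[R]_2) : R := fine (dist_g x q) ^+ 2 / 2.

(* Coordinates of the Riemannian gradient: (grad_g F)^j = g^{jk} d_k F. *)
Definition grad_g (F : 'rV[R]_2 -> R) (x : 'rV[R]_2) : 'rV[R]_2 :=
  grad F x *m invmx (metric x).

End metric.

(* A configuration of N points (agents, or base points of bars) is an N x 2
   matrix whose rows are the points; ordS and ord_pred are the cyclic successor
   and predecessor on 'I_N. *)
Section coverage.
Variables (R : realType) (N : nat).
Variables (cin : R -> 'rV[R]_2) (Omega : set 'rV[R]_2).
Implicit Types (s p : 'M[R]_(N, 2)) (i : 'I_N) (x y q : 'rV[R]_2).

Definition on_curve (theta : 'rV[R]_N) : 'M[R]_(N, 2) :=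
  \matrix_(i, j) cin (theta 0 i) 0 j.

(* Subregion i goes from bar i to bar i + 1 in the direction of the
   parametrization, so it grows when s_i moves backwards: hence the sign. *)
Definition nu x : 'rV[R]_2 :=
  let v := derive1 cin (xget 0 [set theta | cin theta = x]) in
  - ((enorm v)^-1 *: v).

Definition bar x : set 'rV[R]_2 :=
  connected_component [set q | Omega q /\ dot (q - x) (nu x) = 0] x.

(* Open arc of the inner boundary from x to y; the whole curve but one point
   if x = y, which happens when N = 1. *)
Definition arc x y : set 'rV[R]_2 :=
  [set z | exists a b u : R,
    [/\ cin a = x, cin b = y, a < u < b, b <= a + 1 & z = cin u]].

Definition off_bars s : set 'rV[R]_2 :=
  Omega `\` \bigcup_(j in [set: 'I_N]) bar (row j s).

(* The part of Omega cut out by the bars which is adjacent to the arc of the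
   inner boundary from s_i to s_(i+1). *)
Definition cell s i : set 'rV[R]_2 :=
  \bigcup_(x in arc (row i s) (row (ordS i) s))
    connected_component (off_bars s) x.

Definition subregion s i : set 'rV[R]_2 := closure (cell s i).

(* The base points are cyclically ordered along the inner boundary and the
   bars divide Omega into N subregions. *)
Definition partition_config s : Prop :=
  [/\ exists2 theta : 'rV[R]_N, s = on_curve theta &
        forall i j : 'I_N, (i < j)%N ->
          theta 0 i < theta 0 j /\ theta 0 j < theta 0 i + 1,
      trivIset [set: 'I_N] (cell s)
    & off_bars s = \bigcup_(i in [set: 'I_N]) cell s i].

Variable rho : 'rV[R]_2 -> R.

Definition workload s i : R := plane_integral (subregion s i) rho.

Variable f : 'rV[R]_2 -> 'rV[R]_2 -> R.

Definition local_cost s i x : R :=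
  plane_integral (subregion s i) (fun q => f x q * rho q).

Definition cost p s : R := \sum_i local_cost s i (row i p).

Definition set_row p i x : 'M[R]_(N, 2) :=
  \matrix_(k, j) (if k == i then x 0 j else p k j).

Definition grad_cost p s i : 'rV[R]_2 :=
  grad (fun x => cost (set_row p i x) s) (row i p).

(* grad_cost p s i depends on p only through its i-th row. *)
Definition critical s i : set 'rV[R]_2 :=
  [set x | subregion s i x /\
           forall p, row i p = x -> grad_cost p s i = 0].

Definition optimal_position s i q : Prop :=
  [/\ (subregion s i)° q, critical s i q
    & forall x, critical s i x -> local_cost s i q <= local_cost s i x].

End coverage.

(* Main.v *)
(* The motion of the partition is autonomous. Lift the base points to the line by
   the parametrization of the inner curve. A bar is the outward normal segment at
   its base point, and distinct bars are disjoint, so the workload of a cell changes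
   by the difference of the masses swept by its two bars, and by Fubini a sweep has
   mass comparable to the distance travelled by its base point. Comparing the
   configurations at times t and t + d gives a cyclic system with a
   quadratic Lyapunov function; letting d tend to 0, the base points have
   exponentially decaying velocities. Hence the optimal positions q have
   exponentially decaying velocities and converge inside the region.

   Along a trajectory the energy E = d_g(p, q)^2 / 2 satisfies
   E' <= - 2 kappa_p E + sqrt (2 E) |q'| / h(q): the first term comes from the
   eikonal inequality |grad d_g| >= 1 / h and the second one from the triangle
   inequality. So E decays exponentially. Since |grad h| is bounded,
   d_g(p, q) >= (ln h(q) - ln h(p)) / G, which keeps p off the boundary, and
   |p - q| <= max h * d_g(p, q) gives convergence. *)

(* The density is only measurable, so the workloads are not known to be differentiable in the base
   points and the partition dynamics cannot be differentiated in time. The comparison at a time lag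
   d replaces that derivative: it only asks that the mass swept by a bar grow at least linearly with
   the displacement of its foot. Likewise the integrand of a path length is not known to be
   measurable, so the estimates of d_g are one-sided inequalities between lower integrals.

   The optimal positions stay away from the boundary because the lifted base points travel a finite
   total distance: they remain in a compact box, over which the derivatives of the optimal positions
   are bounded and h is bounded below along them.

   The control law is assumed only while the agent is interior. That it stays interior is a
   continuation argument: as long as it has been interior, the decay of E bounds h(p) below by a
   constant independent of the elapsed time. The term with the square root is absorbed by half of
   the dissipation, which leaves a forcing of rate 2a if the velocities decay at rate a. *)
Require Import Defs.
From mathcomp Require Import measurable_realfun ring lra zify.
Set Implicit Arguments.
Unset Strict Implicit.
Unset Printing Implicit Defensive.
Local Open Scope classical_set_scope.
Local Open Scope ring_scope.

(** * Lower integrals *)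

(* The library integral of a nonnegative nonmeasurable function is the supremum
   of the integrals of the simple functions below it. The integrand of
   path_length is not known to be measurable, so these are lower integrals. *)
Section LowerIntegral.
Context d (T : measurableType d) (R : realType).
Variable mu : {measure set T -> \bar R}.
Local Open Scope ereal_scope.
Import HBNNSimple.

Lemma le_integral_nonmeas (D : set T) (f g : T -> \bar R) :
  (forall x, D x -> 0 <= f x) -> (forall x, D x -> f x <= g x) ->
  \int[mu]_(x in D) f x <= \int[mu]_(x in D) g x.
Proof.
move=> f0 fg; rewrite !ge0_integralE//; last first.
  by move=> x Dx; rewrite (le_trans (f0 _ Dx)) ?fg.
apply: le_ereal_sup => _ [h hf <-] /=; exists h => // x.
apply: le_trans (hf x) _; rewrite !patchE; case: ifPn => //.
by rewrite inE => /fg.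
Qed.

Lemma subset_integral_nonmeas (A B : set T) (f : T -> \bar R) :
  (forall x, B x -> 0 <= f x) -> A `<=` B ->
  \int[mu]_(x in A) f x <= \int[mu]_(x in B) f x.
Proof.
move=> f0 AB; rewrite (integral_mkcond A) (integral_mkcond B).
apply: le_integral_nonmeas => x _; rewrite !patchE.
  by case: ifPn => // /set_mem /AB /f0.
case: ifPn => [/set_mem /AB Bx|_]; first by rewrite mem_set.
by case: ifPn => // /set_mem /f0.
Qed.

(** The witness is one of the simple functions of the supremum. Being nonnegative and below the
    restriction of [f] to [D], it vanishes off [D], so its integral over [D] is its full
    integral. *)
Lemma integral_approx_below (D : set T) (f : T -> \bar R) (c : \bar R) :
  measurable D -> (forall x, D x -> 0 <= f x) -> c < \int[mu]_(x in D) f x ->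
  exists w : T -> R, [/\ measurable_fun setT w, forall x, (0 <= w x)%R,
    forall x, D x -> (w x)%:E <= f x & c < \int[mu]_(x in D) (w x)%:E].
Proof.
move=> mD f0; rewrite ge0_integralE// => /ereal_sup_gt[_ [h hf <-] ch].
exists h; split => //.
- by move=> x Dx; move: (hf x); rewrite patchE mem_set.
- rewrite integral_mkcond (_ : _ \_ D = fun x => (h x)%:E).
    by rewrite integralT_nnsfun.
  apply/funext => x; rewrite patchE; case: ifPn => // xD.
  apply/eqP; rewrite eq_sym eqe eq_le; apply/andP; split => //.
  by move: (hf x); rewrite patchE (negbTE xD) lee_fin.
Qed.

(** The reduction used for all upper bounds of lower integrals: once [f] is replaced by a measurable
    minorant [w], the usual theory (null sets, additivity, change of variable) applies. *)
Lemma integral_below_le (D : set T) (f : T -> \bar R) (b : \bar R) :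
  measurable D -> (forall x, D x -> 0 <= f x) ->
  (forall w : T -> R, measurable_fun setT w -> (forall x, (0 <= w x)%R) ->
    (forall x, D x -> (w x)%:E <= f x) -> \int[mu]_(x in D) (w x)%:E <= b) ->
  \int[mu]_(x in D) f x <= b.
Proof.
move=> mD f0 H; rewrite leNgt; apply/negP => /(integral_approx_below mD f0).
by move=> [w [mw w0 wf]]; rewrite ltNge H.
Qed.

Lemma ae_le_integral_nonmeas (D : set T) (f g : T -> \bar R) :
  measurable D -> (forall x, D x -> 0 <= f x) -> (forall x, D x -> 0 <= g x) ->
  {ae mu, forall x, D x -> f x <= g x} ->
  \int[mu]_(x in D) f x <= \int[mu]_(x in D) g x.
Proof.
move=> mD f0 g0 [N [mN N0 fgN]]; apply: integral_below_le => // w mw w0 wf.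
have mwD A : measurable_fun A (fun x => (w x)%:E).
  by apply/measurable_EFinP; apply: measurable_funTS.
rewrite (ge0_negligible_integral mN)//; last first.
  by move=> x _; rewrite lee_fin.
rewrite integral_mkcondr; apply: le_integral_nonmeas => x Dx.
  by rewrite patchE; case: ifPn => // _; rewrite lee_fin.
rewrite patchE; case: ifPn => [|_]; last exact: g0.
rewrite inE => xN; apply: le_trans (wf _ Dx) _; apply: contrapT => H.
by apply: xN; apply: fgN => /=; move=> /(_ Dx).
Qed.

(** A measurable minorant of [f] on the union is a minorant on each piece, and its own integral is
    additive. *)
Lemma integral_setU_le (A B : set T) (f : T -> \bar R) :
  measurable A -> measurable B -> (forall x, (A `|` B) x -> 0 <= f x) ->
  \int[mu]_(x in A `|` B) f x <= \int[mu]_(x in A) f x + \int[mu]_(x in B) f x.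
Proof.
move=> mA mB f0; apply: integral_below_le => //; first exact: measurableU.
move=> w mw w0 wf.
have mwD C : measurable_fun C (fun x => (w x)%:E).
  by apply/measurable_EFinP; apply: measurable_funTS.
have -> : A `|` B = A `|` (B `\` A).
  by apply/seteqP; split => x /=; case: (pselect (A x)); tauto.
rewrite ge0_integral_setU//; last 3 first.
- exact: measurableD.
- by move=> x _; rewrite lee_fin.
- by rewrite disj_set2E setDIK.
apply: leeD; apply: le_trans.
- by apply: le_integral_nonmeas (fun x Ax => wf x (or_introl Ax)) => x _; rewrite lee_fin.
- exact: lexx.
- apply: (@ge0_subset_integral _ _ _ mu _ B) => //.
  + exact: measurableD.
  + by move=> x _; rewrite lee_fin.
- by apply: le_integral_nonmeas (fun x Ax => wf x (or_intror Ax)) => x _; rewrite lee_fin.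
Qed.

(** Minorants on [A] and on [B] are glued into one on the union, the overlap being null. The two
    suprema are then taken one after the other; each passage moves the other integral across the
    inequality, so the case where the right-hand side is infinite is settled apart. *)
Lemma integral_setU_ge (A B : set T) (f : T -> \bar R) :
  measurable A -> measurable B -> mu (A `&` B) = 0 ->
  (forall x, (A `|` B) x -> 0 <= f x) ->
  \int[mu]_(x in A) f x + \int[mu]_(x in B) f x <= \int[mu]_(x in A `|` B) f x.
Proof.
move=> mA mB AB0 f0.
have f0A x : A x -> 0 <= f x by move=> Ax; apply: f0; left.
have f0B x : B x -> 0 <= f x by move=> Ax; apply: f0; right.
have IA := integral_ge0 mu f0A; have IB := integral_ge0 mu f0B.
have key (wA wB : T -> R) : measurable_fun setT wA -> measurable_fun setT wB ->
   (forall x, (0 <= wA x)%R) -> (forall x, (0 <= wB x)%R) ->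
   (forall x, A x -> (wA x)%:E <= f x) -> (forall x, B x -> (wB x)%:E <= f x) ->
   \int[mu]_(x in A) (wA x)%:E + \int[mu]_(x in B) (wB x)%:E <= \int[mu]_(x in A `|` B) f x.
  move=> mwA mwB wA0 wB0 wfA wfB.
  pose w x := if x \in A then (wA x)%:E else (wB x)%:E.
  have mw C : measurable_fun C (w : _ -> \bar R).
    apply: measurable_funTS; apply: measurable_fun_ifT.
    - apply: (measurable_fun_bool true); rewrite setTI (_ : _ @^-1` _ = A)//.
      by apply/seteqP; split => x /=; [move/set_mem|move/mem_set].
    - exact/measurable_EFinP.
    - exact/measurable_EFinP.
  have w0 x : 0 <= w x by rewrite /w; case: ifP; rewrite lee_fin.
  have -> : \int[mu]_(x in A) (wA x)%:E = \int[mu]_(x in A) w x.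
    by apply: eq_integral => x xA; rewrite /w xA.
  have -> : \int[mu]_(x in B) (wB x)%:E = \int[mu]_(x in B `\` A) w x.
    have mB' C : measurable_fun C (fun x => (wB x)%:E) by apply/measurable_EFinP/measurable_funTS.
    rewrite (@ge0_negligible_integral _ _ _ mu B (A `&` B))//; last 2 first.
    - exact: measurableI.
    - by move=> x _; rewrite lee_fin.
    rewrite (_ : B `\` (A `&` B) = B `\` A); last first.
      by apply/seteqP; split => x /=; tauto.
    by apply: eq_integral => x; rewrite inE => -[Bx nAx]; rewrite /w memNset.
  rewrite -ge0_integral_setU//; last 2 first.
  - exact: measurableD.
  - by rewrite disj_set2E setDIK.
  rewrite (_ : A `|` (B `\` A) = A `|` B); last first.
    by apply/seteqP; split => x /=; case: (pselect (A x)); tauto.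
  apply: le_integral_nonmeas => // x ABx; rewrite /w; case: ifPn => [xA|xA].
    by apply: wfA; exact: set_mem.
  by apply: wfB; case: ABx => // Ax; rewrite mem_set in xA.
have keyA (wB : T -> R) : measurable_fun setT wB -> (forall x, (0 <= wB x)%R) ->
    (forall x, B x -> (wB x)%:E <= f x) ->
    \int[mu]_(x in A) f x + \int[mu]_(x in B) (wB x)%:E <= \int[mu]_(x in A `|` B) f x.
  move=> mwB wB0 wfB.
  have [->|IBfin] := eqVneq (\int[mu]_(x in A `|` B) f x) +oo; first by rewrite leey.
  have wBfin : \int[mu]_(x in B) (wB x)%:E \is a fin_num.
    rewrite fin_numE; apply/andP; split.
      by rewrite gt_eqF// (lt_le_trans _ (integral_ge0 _ _))// => x _; rewrite lee_fin.
    apply: contra IBfin => /eqP E; rewrite -leye_eq -E.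
    have := key (fun=> 0%R) wB (measurable_cst _) mwB (fun=> lexx _) wB0 f0A wfB.
    by apply: le_trans; rewrite leeDr// integral_ge0.
  rewrite -leeBrDr//; apply: integral_below_le => // w mw w0 wf.
  by rewrite leeBrDr//; apply: key.
have [->|Ifin] := eqVneq (\int[mu]_(x in A `|` B) f x) +oo; first by rewrite leey.
have Afin : \int[mu]_(x in A) f x \is a fin_num.
  rewrite fin_numE; apply/andP; split; first by rewrite gt_eqF// (lt_le_trans _ IA).
  apply: contra Ifin => /eqP E; rewrite -leye_eq -E.
  have := keyA (fun=> 0%R) (measurable_cst _) (fun=> lexx _) f0B.
  by apply: le_trans; rewrite leeDl// integral_ge0.
rewrite addeC -leeBrDr//; apply: integral_below_le => // w mw w0 wf.
by rewrite leeBrDr// addeC; apply: keyA.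
Qed.
End LowerIntegral.

(** * Lipschitz functions as integrals of their derivatives *)

Lemma inv_succ_cvg_dnbhs (R : realType) :
  (fun n : nat => n.+1%:R^-1 : R) @ \oo --> (0 : R)^'.
Proof.
move=> A HA; have := @cvg_harmonic R _ HA.
apply: (@filterS _ \oo) => n /=; apply.
by rewrite invr_eq0 pnatr_eq0.
Qed.

Lemma diffquot_cvg (R : realType) (f : R -> R) (x l : R) :
  is_derive x 1 f l ->
  (fun n : nat => (f (x + n.+1%:R^-1) - f x) * n.+1%:R) @ \oo --> l.
Proof.
move=> [df <-].
have := cvg_comp _ _ (@inv_succ_cvg_dnbhs R) df.
apply: cvg_trans; apply: near_eq_cvg; apply: nearW => n /=.
by rewrite invrK /GRing.scale /= mulr1 mulrC [x + _]addrC.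
Qed.

Section Half.
Variable R : realType.
Let half (x : R) : measurableTypeR R := x / 2.

Let mhalf : measurable_fun [set: measurableTypeR R] half.
Proof.
by apply: continuous_measurable_fun => x; apply: cvgMl; exact: cvg_id.
Qed.

Let nu := mscale (2^-1 : R)%:nng
  (measure_function_pushforward__canonical__measure_function_Measure
     (@lebesgue_measure R) mhalf).

Let lebesgue_half (A : set (measurableTypeR R)) : measurable A ->
  lebesgue_measure A = nu A.
Proof.
move=> mA; apply: lebesgue_measure_unique => //= _ [[a b]] _ <-.
rewrite /nu /mscale /= /pushforward (_ : half @^-1` _ = `]2 * a, 2 * b]%classic).
  rewrite !lebesgue_measure_itv/= !lte_fin ltr_pM2l//.
  case: ifP => _; last by rewrite mule0.
  by rewrite -!EFinD -EFinM; congr EFin; lra.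
apply/seteqP; split => x /=; rewrite !in_itv/= /half => /andP[? ?]; lra.
Qed.

(** Lebesgue measure is half of its image under halving, by uniqueness from its values on half-open
    intervals. This rescales the first half of a concatenated path. *)
Lemma integral_half (w : R -> R) :
  measurable_fun [set: R] w -> (forall x, 0 <= w x) ->
  (\int[@lebesgue_measure R]_(x in `[0%R, (2^-1)%R]) (w x)%:E =
   2^-1%:E * \int[@lebesgue_measure R]_(x in `[0%R, 1%R]) (w (x / 2))%:E)%E.
Proof.
move=> mw w0.
have mwE (E : set R) : measurable_fun E (fun x => (w x)%:E).
  by apply/measurable_EFinP/measurable_funTS.
rewrite (eq_measure_integral nu); last first.
  by move=> A mA _; exact: lebesgue_half.
rewrite ge0_integral_mscale; last 3 first.
- exact: measurable_itv.
- exact: mwE.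
- by move=> x _; rewrite lee_fin.
congr (_ * _)%E; rewrite ge0_integral_pushforward; [|exact: mhalf| | |]; last first.
- by move=> x _; rewrite lee_fin.
- exact: mwE.
- exact: measurable_itv.
rewrite (_ : half @^-1` _ = `[0, 1]%classic)//.
by apply/seteqP; split => x /=; rewrite !in_itv/= /half => /andP[? ?]; lra.
Qed.

Lemma ae_double (P : R -> Prop) : {ae @lebesgue_measure R, forall t, P t} ->
  {ae @lebesgue_measure R, forall t, P (2 * t)}.
Proof.
move=> [N [mN N0 NP]].
have m2 : measurable_fun [set: R] (fun t : R => 2 * t).
  by apply: continuous_measurable_fun => x; apply: cvgMr; exact: cvg_id.
have mB : measurable [set t : R | N (2 * t)].
  by have := m2 measurableT N mN; rewrite setTI.
exists [set t | N (2 * t)]; split; [exact: mB| |by move=> t /= nP; apply: NP].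
rewrite (lebesgue_half mB) /nu /mscale /= /pushforward.
rewrite (_ : half @^-1` _ = N) ?N0 ?mule0//.
by apply/seteqP; split => x /=; rewrite /half mulrC divfK.
Qed.
End Half.

Section LipFTC.
Variable R : realType.
Notation mu := (@lebesgue_measure R).

Lemma continuous_antiderivative (f : R -> R) (a b : R) :
  continuous f -> exists F : R -> R, forall x, a < x < b -> is_derive x 1 F (f x).
Proof.
move=> cf; pose F (x : R) := \int[mu]_(t in `[a, x]) f t.
exists F => x /andP[ax xb].
have fi : mu.-integrable `[a, b] (EFin \o f).
  apply: continuous_compact_integrable; first exact: segment_compact.
  exact: continuous_subspaceT.
have [d E] := @continuous_FTC1_closed R f a x b xb fi ax (cf x).
by apply: DeriveDef; [exact: d|rewrite -derive1E].
Qed.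

(** A Lipschitz function is the integral of its almost everywhere derivative: its difference
    quotients are bounded by the Lipschitz constant, so dominated convergence applies, and their
    integrals are computed exactly from a primitive. All comparisons of path length with
    displacement or with [h] come from this lemma. *)
Lemma lipschitz_le_integral (phi : R -> R) (a b K C : R) (g : R -> \bar R) :
  a < b -> 0 < C ->
  (forall s t, a <= s <= b -> a <= t <= b -> `|phi s - phi t| <= K * `|s - t|) ->
  (forall t, 0 <= g t)%E ->
  {ae mu, forall t, a < t < b ->
     derivable phi t 1 /\ ((derive1 phi t)%:E <= C%:E * g t)%E} ->
  ((phi b - phi a)%:E <= C%:E * \int[mu]_(t in `[a, b]) g t)%E.
Proof.
move=> ab C0 lip g0 [N [mN N0 HN]].
(* Extending [phi] by constants makes the forward difference quotients available up to [b]. *)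
pose cl (t : R) := Num.max a (Num.min b t).
have cl_in t : a <= cl t <= b.
  by rewrite /cl le_max lexx/= ge_max (ltW ab)/= ge_min lexx.
have clE t : a <= t <= b -> cl t = t.
  by move=> /andP[a1 a2]; rewrite /cl min_r// max_r.
have cl_lip s t : `|cl s - cl t| <= `|s - t|.
  rewrite /cl; case: (leP b s) => bs; case: (leP b t) => bt;
    rewrite ?(max_r (ltW ab)) ?subrr ?normr0//.
  - case: (leP a t) => at_; rewrite !ger0_norm ?subr_ge0//; lra.
  - case: (leP a s) => as_; rewrite !ler0_norm ?subr_le0//; lra.
  - case: (leP a s) => as_; case: (leP a t) => at_; rewrite ?subrr ?normr0//.
    + rewrite !ger0_norm ?subr_ge0//; lra.
    + rewrite !ler0_norm ?subr_le0//; lra.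
pose psi t := phi (cl t).
have K0 : 0 <= K.
  have := lip a b; rewrite !lexx (ltW ab) => /(_ isT isT) /(le_trans (normr_ge0 _)).
  by rewrite pmulr_lge0// normr_gt0 subr_eq0 lt_eqF.
have psi_lip s t : `|psi s - psi t| <= K * `|s - t|.
  by apply: le_trans (lip _ _ (cl_in s) (cl_in t)) _; rewrite ler_wpM2l.
have psi_cont : continuous psi.
  move=> x; apply/cvgrPdist_le => /= e e0; near=> t.
  apply: le_trans (psi_lip _ _) _.
  apply: (@le_trans _ _ ((K + 1) * `|x - t|)); first by rewrite ler_wpM2r// lerDl.
  rewrite -ler_pdivlMl ?ltr_wpDl//; near: t.
  by apply: cvgr_dist_le => //; rewrite mulr_gt0// invr_gt0 ltr_wpDl.
have psiE t : a <= t <= b -> psi t = phi t by move=> /clE; rewrite /psi => ->.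
have [Psi dPsi] := @continuous_antiderivative psi (a - 1) (b + 2) psi_cont.
pose h n : R := n.+1%:R^-1.
have h0 n : 0 < h n by rewrite invr_gt0.
have h1 n : h n <= 1 by rewrite invf_le1// ler1n.
pose u n t := (psi (t + h n) - psi t) * n.+1%:R.
(* The difference quotient of the primitive [Psi] is a primitive of the difference quotient of
   [psi], and it tends to [psi] itself. *)
pose F n t := (Psi (t + h n) - Psi t) * n.+1%:R.
have dF n t : a <= t <= b -> is_derive t 1 (F n) (u n t).
  move=> /andP[a1 a2]; rewrite /F /u.
  have d1 : is_derive t 1 Psi (psi t) by apply: dPsi; lra.
  have d2 : is_derive (t + h n) 1 Psi (psi (t + h n)).
    by apply: dPsi; have := h0 n; have := h1 n; lra.
  have d3 : is_derive t (1:R) (fun t => t + h n) 1.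
    by have := is_deriveD (is_derive_id t 1) (is_derive_cst (h n) t 1); rewrite addr0.
  have d4 := @is_derive1_comp _ Psi (fun t => t + h n) t _ _ d2 d3.
  have d5 := is_deriveB d4 d1.
  have d6 := is_deriveM d5 (is_derive_cst (n.+1%:R : R) t 1).
  apply: (is_derive_eq d6) => /=.
  by rewrite scaler0 add0r /GRing.scale/= mulr1 mulrC.
have cu n : continuous (u n).
  move=> x; apply: cvgM; last exact: cvg_cst.
  apply: cvgB; last exact: psi_cont.
  apply: (@cvg_comp _ _ _ (fun t => t + h n) psi _ (nbhs (x + h n))).
    by apply: cvgD; [exact: cvg_id|exact: cvg_cst].
  exact: psi_cont.
have Iu n : (\int[mu]_(t in `[a, b]) (u n t)%:E = (F n b - F n a)%:E)%E.
  rewrite (@continuous_FTC2 _ (u n) (F n) a b ab)//.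
  - exact: continuous_subspaceT.
  - split.
    + by move=> x; rewrite in_itv/= => /andP[/ltW ? /ltW ?]; case: (dF n x); [lra|].
    + apply: cvg_at_right_filter; apply: differentiable_continuous.
      by apply/derivable1_diffP; case: (dF n a); [lra|].
    + apply: cvg_at_left_filter; apply: differentiable_continuous.
      by apply/derivable1_diffP; case: (dF n b); [lra|].
  - move=> x; rewrite in_itv/= => /andP[/ltW ? /ltW ?].
    by rewrite derive1E; case: (dF n x) => [|_ ->//]; lra.
have ubound n t : `|u n t| <= K.
  rewrite /u normrM normr_nat; apply: le_trans (ler_wpM2r _ (psi_lip _ _)) _ => //.
  by rewrite addrAC subrr add0r ger0_norm ?(ltW (h0 n))// -mulrA mulVf ?mulr1// pnatr_eq0.
have Fcvg : (F n b - F n a)%:E @[n --> \oo] --> (phi b - phi a)%:E.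
  apply: cvg_EFin; first exact: nearW.
  rewrite -(psiE a) ?lexx ?(ltW ab)// -(psiE b) ?lexx ?(ltW ab)//.
  by apply: cvgB; apply: diffquot_cvg; apply: dPsi; lra.
pose N' := N `|` [set a] `|` [set b].
have mN' : measurable N' by do 2 apply: measurableU => //.
have N'0 : mu N' = 0.
  have Z (x : R) : mu [set x] = 0 by exact: lebesgue_measure_set1.
  have mNa : measurable (N `|` [set a]) by apply: measurableU.
  have E1 : mu (N `|` [set a]) = 0.
    by rewrite measureU0//; exact: Z.
  by rewrite /N' measureU0//; exact: Z.
pose D := `[a, b] `\` N'.
have mD : measurable D by apply: measurableD.
have Dg t : D t -> [/\ a < t < b, derivable phi t 1 & ((derive1 phi t)%:E <= C%:E * g t)%E].
  rewrite /D /N' /= in_itv/= => -[/andP[a1 a2]] H.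
  have atb : a < t < b.
    rewrite !lt_neqAle a1 a2 !andbT; apply/andP; split; apply/eqP => E; apply: H.
      by left; right.
    by right.
  have [] : derivable phi t 1 /\ ((derive1 phi t)%:E <= C%:E * g t)%E; last by [].
  apply: contrapT => H2; apply: H; left; left; apply: HN => /= H3.
  exact: H2 (H3 atb).
have ucvg t : D t -> (u n t)%:E @[n --> \oo] --> (derive1 phi t)%:E.
  move=> /Dg[/andP[a1 a2] dphi _]; apply: cvg_EFin; first exact: nearW.
  apply: diffquot_cvg; apply: (@near_eq_is_derive _ _ _ phi).
    near=> s; rewrite psiE//; apply/andP; split; apply: ltW; near: s.
      exact: lt_nbhsr.
    exact: lt_nbhsl.
  by apply: DeriveDef; rewrite ?derive1E.
have mu_ n (E : set R) : measurable_fun E (fun t => (u n t)%:E).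
  apply/measurable_EFinP; apply: measurable_funTS.
  by apply: continuous_measurable_fun; exact: cu.
have mphi' : measurable_fun D (fun t => (derive1 phi t)%:E).
  apply: (emeasurable_fun_cvg (fun n t => (u n t)%:E)) => //.
have ui n : mu.-integrable `[a, b] (fun t => (u n t)%:E).
  apply: continuous_compact_integrable; first exact: segment_compact.
  exact: continuous_subspaceT (cu n).
have Di : mu.-integrable D (fun=> K%:E).
  apply: (@integrableS _ _ _ mu `[a, b]) => //; first by move=> ? [].
  apply: continuous_compact_integrable; first exact: segment_compact.
  by apply: continuous_subspaceT => x; exact: cvg_cst.
have IDcvg : (\int[mu]_(x in D) (u n x)%:E)%E @[n --> \oo] -->
    (\int[mu]_(x in D) (derive1 phi x)%:E)%E.
  have [] // := @dominated_convergence _ _ _ mu D mD (fun n t => (u n t)%:E)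
    (fun t => (derive1 phi t)%:E) (fun=> K%:E).
  - by move=> n; exact: mu_.
  - exact: aeW.
  - by apply: aeW => t n _; rewrite /= lee_fin.
have ID : (\int[mu]_(t in D) (derive1 phi t)%:E = (phi b - phi a)%:E)%E.
  apply: cvg_unique IDcvg _ => //; apply: cvg_trans Fcvg.
  apply: near_eq_cvg; apply: nearW => n /=.
  by rewrite -Iu (@negligible_integral _ _ _ mu `[a, b] N').
(* Only the positive part of the derivative is kept, and the constant is moved to its side, because
   it is the measurable one: [g] admits monotonicity but not linearity of the integral. *)
rewrite -ID integralE.
set A := (X in (X - _ <= _)%E).
apply: (@le_trans _ _ A); first by rewrite geeDl// oppe_le0 integral_ge0.
pose f1 := fun t : R => (derive1 phi t)%:E.
have mA : measurable_fun D (f1^\+)%E by exact: measurable_funepos.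
have A0 t : D t -> (0 <= (f1^\+ t))%E by [].
have E : (C^-1%:E * \int[mu]_(t in D) (f1^\+ t) =
    \int[mu]_(t in D) (C^-1%:E * f1^\+ t))%E.
  by rewrite ge0_integralZl_EFin// invr_ge0 ltW.
rewrite -lee_pdivrMl// /A E.
apply: (@le_trans _ _ (\int[mu]_(t in D) g t)%E).
  apply: (@le_integral_nonmeas _ _ _ mu) => t Dt.
    by rewrite mule_ge0// lee_fin invr_ge0 ltW.
  have [_ _ H] := Dg t Dt; rewrite lee_pdivrMl//.
  by rewrite funeposE ge_max H mule_ge0// lee_fin ltW.
by apply: (@subset_integral_nonmeas _ _ _ mu) => // t [].
Unshelve. all: end_near.
Qed.
End LipFTC.

(** * Plane vectors *)

Lemma coord_le_norm (R : realType) n (u : 'rV[R]_n) j : `|u 0 j| <= `|u|.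
Proof. by rewrite [leRHS]/Num.norm/= /mx_norm; apply: (le_bigmax _ (fun ij => `|u ij.1 ij.2|%:nng) (0, j)). Qed.

Lemma coord_cvg (R : realType) n (T : Type) (F : set_system T) (FF : Filter F)
    (f : T -> 'rV[R]_n) (l : 'rV[R]_n) j :
  f x @[x --> F] --> l -> f x 0 j @[x --> F] --> l 0 j.
Proof.
move=> fl; apply: (@continuous_cvg _ _ _ F FF f (fun v : 'rV[R]_n => v 0 j)) => //.
exact: coord_continuous.
Qed.

Lemma mx_cvg (R : realType) m n (T : Type) (F : set_system T) (FF : Filter F)
    (f : T -> 'M[R]_(m, n)) (l : 'M[R]_(m, n)) :
  (forall i j, f x i j @[x --> F] --> l i j) -> f x @[x --> F] --> l.
Proof.
move=> H; apply/cvgrPdist_le => e e0.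
have : \forall x \near F, forall i j, `|l i j - f x i j| <= e.
  apply: filter_forall => i; apply: filter_forall => j.
  by move/cvgrPdist_le: (H i j); apply.
apply: filterS => x Hx; rewrite [leLHS]/Num.norm/= mx_normrE; apply: bigmax_le => [|[i j] _].
  exact: ltW.
by rewrite !mxE.
Qed.

Lemma rV_cvg (R : realType) n (T : Type) (F : set_system T) (FF : Filter F)
    (f : T -> 'rV[R]_n) (l : 'rV[R]_n) :
  (forall j, f x 0 j @[x --> F] --> l 0 j) -> f x @[x --> F] --> l.
Proof. by move=> H; apply: mx_cvg => i j; rewrite ord1. Qed.

Lemma is_derive_mxP (R : realType) m n (c : R -> 'M[R]_(m, n)) (t : R) (l : 'M[R]_(m, n)) :
  is_derive t 1 c l <-> forall i j, is_derive t 1 (fun s => c s i j) (l i j).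
Proof.
split=> [[dc El] i j|H].
  apply: DeriveDef; first by move/derivable_mxP : dc => /(_ i j).
  by rewrite -El derive_mx// mxE.
have dc : derivable c t 1 by apply/derivable_mxP => i j; case: (H i j).
apply: DeriveDef => //; rewrite derive_mx//; apply/matrixP => i j; rewrite mxE.
by case: (H i j).
Qed.

Lemma is_derive_coordP (R : realType) n (c : R -> 'rV[R]_n) (t : R) (l : 'rV[R]_n) :
  is_derive t 1 c l <-> forall j, is_derive t 1 (fun s => c s 0 j) (l 0 j).
Proof.
split=> [/is_derive_mxP H j|H]; first exact: H.
by apply/is_derive_mxP => i j; rewrite ord1.
Qed.

Section PlaneBasics.
Variable R : realType.
Implicit Types (u v w : 'rV[R]_2).

Lemma ord2P (P : 'I_2 -> Prop) : P 0 -> P 1 -> forall j, P j.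
Proof.
by move=> P0 P1 [[|[|//]] i]; [move: P0|move: P1]; congr P; apply: val_inj.
Qed.

Lemma rV2P u v : u 0 0 = v 0 0 -> u 0 1 = v 0 1 -> u = v.
Proof. by move=> H0 H1; apply/rowP; apply: ord2P. Qed.

Lemma sum2 (V : nmodType) (F : 'I_2 -> V) : \sum_i F i = F 0 + F 1.
Proof.
by rewrite big_ord_recl big_ord1; congr (_ + F _); apply: val_inj.
Qed.

Lemma dotE u v : dot u v = u 0 0 * v 0 0 + u 0 1 * v 0 1.
Proof. by rewrite /dot mxE sum2 !mxE. Qed.

Lemma dotC u v : dot u v = dot v u.
Proof. by rewrite !dotE; ring. Qed.

Lemma dotDl u v w : dot (u + v) w = dot u w + dot v w.
Proof. by rewrite !dotE !mxE; ring. Qed.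

Lemma dotBl u v w : dot (u - v) w = dot u w - dot v w.
Proof. by rewrite !dotE !mxE; ring. Qed.

Lemma dotNl u v : dot (- u) v = - dot u v.
Proof. by rewrite !dotE !mxE; ring. Qed.

Lemma dotZl (a : R) u v : dot (a *: u) v = a * dot u v.
Proof. by rewrite !dotE !mxE; ring. Qed.

Lemma dotDr u v w : dot u (v + w) = dot u v + dot u w.
Proof. by rewrite !dotE !mxE; ring. Qed.

Lemma dotBr u v w : dot u (v - w) = dot u v - dot u w.
Proof. by rewrite !dotE !mxE; ring. Qed.

Lemma dotNr u v : dot u (- v) = - dot u v.
Proof. by rewrite !dotE !mxE; ring. Qed.

Lemma dotZr (a : R) u v : dot u (a *: v) = a * dot u v.
Proof. by rewrite !dotE !mxE; ring. Qed.

Lemma dot0l u : dot 0 u = 0.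
Proof. by rewrite !dotE !mxE; ring. Qed.

Lemma dot_ge0 u : 0 <= dot u u.
Proof. by rewrite dotE -!expr2 addr_ge0// sqr_ge0. Qed.

Lemma dot_eq0 u : (dot u u == 0) = (u == 0).
Proof.
apply/idP/eqP => [|->]; last by rewrite dot0l.
rewrite dotE -!expr2 paddr_eq0 ?sqr_ge0// !sqrf_eq0 => /andP[/eqP ? /eqP ?].
by apply: rV2P; rewrite !mxE.
Qed.

Lemma enorm_ge0 u : 0 <= enorm u.
Proof. exact: sqrtr_ge0. Qed.

Lemma sqr_enorm u : enorm u ^+ 2 = dot u u.
Proof. by rewrite sqr_sqrtr// dot_ge0. Qed.

Lemma enorm0 : enorm (0 : 'rV[R]_2) = 0.
Proof. by rewrite /enorm dot0l sqrtr0. Qed.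

Lemma enorm_eq0 u : (enorm u == 0) = (u == 0).
Proof. by rewrite -sqrf_eq0 sqr_enorm dot_eq0. Qed.

Lemma enorm_gt0 u : (0 < enorm u) = (u != 0).
Proof. by rewrite lt_neqAle enorm_ge0 andbT eq_sym enorm_eq0. Qed.

Lemma enormZ (a : R) u : enorm (a *: u) = `|a| * enorm u.
Proof.
by rewrite /enorm dotZl dotZr mulrA -expr2 sqrtrM ?sqr_ge0// sqrtr_sqr.
Qed.

Lemma enormN u : enorm (- u) = enorm u.
Proof. by rewrite /enorm dotNl dotNr opprK. Qed.

Lemma dot_le_enorm u v : dot u v <= enorm u * enorm v.
Proof.
apply: le_trans (ler_norm _) _.
rewrite -ler_sqr ?nnegrE ?mulr_ge0 ?enorm_ge0// real_normK ?num_real//.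
rewrite exprMn !sqr_enorm !dotE -subr_ge0.
(* Lagrange's identity in the plane. *)
have -> : (u 0 0 * u 0 0 + u 0 1 * u 0 1) * (v 0 0 * v 0 0 + v 0 1 * v 0 1) -
  (u 0 0 * v 0 0 + u 0 1 * v 0 1) ^+ 2 = (u 0 0 * v 0 1 - u 0 1 * v 0 0) ^+ 2 by ring.
exact: sqr_ge0.
Qed.

Lemma norm_dot_le u v : `|dot u v| <= enorm u * enorm v.
Proof.
by rewrite ler_norml dot_le_enorm andbT lerNl -dotNl -(enormN u) dot_le_enorm.
Qed.

Lemma enormD u v : enorm (u + v) <= enorm u + enorm v.
Proof.
rewrite -ler_sqr ?nnegrE ?addr_ge0 ?enorm_ge0// sqr_enorm sqrrD !sqr_enorm.
by rewrite dotDl !dotDr (dotC v u); have := dot_le_enorm u v; lra.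
Qed.

Lemma coord_le_enorm u j : `|u 0 j| <= enorm u.
Proof.
rewrite -ler_sqr ?nnegrE ?enorm_ge0// sqr_enorm dotE real_normK ?num_real// -!expr2.
by move: j; apply: ord2P; rewrite ?lerDl ?lerDr sqr_ge0.
Qed.

Lemma norm_le_enorm u : `|u| <= enorm u.
Proof.
rewrite [leLHS]/Num.norm/= mx_normrE; apply: bigmax_le => [|[i j] _].
  exact: enorm_ge0.
by rewrite (ord1 i) /= coord_le_enorm.
Qed.

Lemma enorm_le_norm u : enorm u <= 2 * `|u|.
Proof.
rewrite -ler_sqr ?nnegrE ?enorm_ge0 ?mulr_ge0// sqr_enorm dotE exprMn.
have H j : u 0 j * u 0 j <= `|u| ^+ 2.
  by rewrite -expr2 -real_normK ?num_real// ler_sqr ?nnegrE// coord_le_norm.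
by have := H 0; have := H 1; have := sqr_ge0 `|u|; lra.
Qed.

Lemma dot_cvg (T : Type) (F : set_system T) (FF : Filter F) (f g : T -> 'rV[R]_2) (l m : 'rV[R]_2) :
  f x @[x --> F] --> l -> g x @[x --> F] --> m -> dot (f x) (g x) @[x --> F] --> dot l m.
Proof.
move=> fl gm; rewrite dotE; under eq_fun do rewrite dotE.
by apply: cvgD; apply: cvgM; exact: coord_cvg.
Qed.

Lemma enorm_cvg (T : Type) (F : set_system T) (FF : Filter F) (f : T -> 'rV[R]_2) (l : 'rV[R]_2) :
  f x @[x --> F] --> l -> enorm (f x) @[x --> F] --> enorm l.
Proof.
move=> fl; apply: (@continuous_cvg _ _ _ F FF (fun x => dot (f x) (f x)) (@Num.sqrt R)).
  exact: sqrt_continuous.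
exact: dot_cvg.
Qed.

Lemma is_derive_line (a b : R) (y w : 'rV[R]_2) (t : R) :
  is_derive t 1 (fun s : R => y + (a * s + b) *: w) (a *: w).
Proof.
apply/is_derive_coordP => j.
have -> : (fun s : R => (y + (a * s + b) *: w) 0 j) =
    cst (y 0 j + b * w 0 j) + (fun s => (a * w 0 j) *: s).
  apply/funext => s; transitivity (y 0 j + b * w 0 j + a * w 0 j * s) => //.
  by rewrite !mxE; ring.
apply: (is_derive_eq (is_deriveD (is_derive_cst _ _ _) (is_deriveZ _ (is_derive_id _ _)))).
by rewrite !mxE add0r /GRing.scale/= mulr1.
Qed.

Lemma is_derive_dot (c d : R -> 'rV[R]_2) (t : R) (c' d' : 'rV[R]_2) :
  is_derive t 1 c c' -> is_derive t 1 d d' ->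
  is_derive t 1 (fun s => dot (c s) (d s)) (dot c' (d t) + dot (c t) d').
Proof.
move=> /is_derive_coordP Hc /is_derive_coordP Hd.
rewrite (_ : (fun s => _) = (fun s => c s 0 0) * (fun s => d s 0 0)
    + (fun s => c s 0 1) * (fun s => d s 0 1)); last first.
  by apply/funext => s; rewrite dotE.
apply: (is_derive_eq (is_deriveD (is_deriveM (Hc 0) (Hd 0)) (is_deriveM (Hc 1) (Hd 1)))).
by rewrite !dotE /GRing.scale /=; ring.
Qed.

Lemma row2E v : v = v 0 0 *: delta_mx 0 0 + v 0 1 *: delta_mx 0 1.
Proof. by apply: rV2P; rewrite !mxE /=; ring. Qed.

Lemma diff_gradE (F : 'rV[R]_2 -> R) x v : differentiable F x ->
  'd F x v = dot (grad F x) v.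
Proof.
move=> dF; rewrite {1}(row2E v) linearD !linearZ/= dotE !mxE !deriveE//.
by rewrite /GRing.scale /= mulrC [v 0 1 * _]mulrC.
Qed.

Lemma is_derive_comp_grad (F : 'rV[R]_2 -> R) (c : R -> 'rV[R]_2) (t : R) v :
  differentiable F (c t) -> is_derive t 1 c v ->
  is_derive t 1 (fun s => F (c s)) (dot (grad F (c t)) v).
Proof.
move=> dF [dc Ev].
have dc' : differentiable c t by exact/derivable1_diffP.
have dFc : differentiable (F \o c) t by exact: differentiable_comp.
apply: DeriveDef; first exact/derivable1_diffP.
by rewrite deriveE// diff_comp//= -diff_gradE// -Ev deriveE.
Qed.

End PlaneBasics.

(** * The conformal distance *)

Section Length.
Variables (R : realType) (Omega : set 'rV[R]_2) (h : 'rV[R]_2 -> R).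
Notation mu := (@lebesgue_measure R).
Implicit Types (gamma : R -> 'rV[R]_2) (x y z : 'rV[R]_2).

Lemma ae_neq (a : R) : {ae mu, forall t, t != a}.
Proof.
exists [set a]; split => //; first exact: lebesgue_measure_set1.
by move=> t /= /negP; rewrite negbK => /eqP.
Qed.

Lemma ae_impl (P Q : R -> Prop) : (forall t, P t -> Q t) ->
  {ae mu, forall t, P t} -> {ae mu, forall t, Q t}.
Proof.
move=> PQ [N [mN N0 NP]]; exists N; split => // t nQ; apply: NP => Pt.
exact/nQ/PQ.
Qed.

Lemma ae_impl2 (P Q S : R -> Prop) : (forall t, P t -> Q t -> S t) ->
  {ae mu, forall t, P t} -> {ae mu, forall t, Q t} -> {ae mu, forall t, S t}.
Proof.
move=> PQ [N [mN N0 NP]] [M [mM M0 MQ]]; exists (N `|` M); split.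
- exact: measurableU.
- by rewrite measureU0.
move=> t nS; apply: contrapT => /not_orP[nN nM]; apply: nS; apply: PQ.
  by apply: contrapT => /NP.
by apply: contrapT => /MQ.
Qed.

Lemma lipschitz_itvP (a b : R) gamma :
  [lipschitz gamma t | t in `[a, b]] <->
  exists2 K, 0 < K &
    forall s t, a <= s <= b -> a <= t <= b -> `|gamma s - gamma t| <= K * `|s - t|.
Proof.
split=> [/pinfty_ex_gt0[K K0 HK]|[K K0 HK]].
  exists K => // s t sab tab.
  by have := HK (s, t); rewrite /= !in_itv/=; apply; split.
exists K; split; first exact: gtr0_real.
move=> M KM [s t] /= [] /=; rewrite !in_itv/= => sab tab.
by apply: le_trans (HK _ _ sab tab) _; rewrite ler_wpM2r// ltW.
Qed.

(** Closed form of the integrand of [path_length]: the metric is conformal, with length element |dq|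
    / |h|. *)
Definition speed gamma (t : R) : \bar R :=
  if h (gamma t) == 0%R then +oo%E
  else (enorm (derive1 gamma t) / `|h (gamma t)|)%:E.

Lemma speed_ge0 gamma t : (0 <= speed gamma t)%E.
Proof.
rewrite /speed; case: ifP => // _.
by rewrite lee_fin divr_ge0// enorm_ge0.
Qed.

Lemma path_lengthE gamma :
  path_length h gamma = (\int[mu]_(t in `[0%R, 1%R]) speed gamma t)%E.
Proof.
rewrite /path_length; apply: eq_integral => t _; rewrite /speed.
case: ifPn => // h0; congr EFin.
rewrite !sum2 !mxE/= !mul0r !addr0 !add0r.
set v := derive1 gamma t.
have -> : 1 / h (gamma t) ^+ 2 * v 0 0 * v 0 0 + 1 / h (gamma t) ^+ 2 * v 0 1 * v 0 1
    = dot v v * (h (gamma t))^-1 ^+ 2.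
  by rewrite dotE; field.
by rewrite sqrtrM ?dot_ge0// sqrtr_sqr normfV.
Qed.

Lemma path_ge0 gamma : (0 <= path_length h gamma)%E.
Proof. by rewrite path_lengthE integral_ge0// => t _; exact: speed_ge0. Qed.

Lemma dist_g_ge0 x y : (0 <= dist_g Omega h x y)%E.
Proof. by apply: le_ereal_inf_tmp => _ [g _ <-]; exact: path_ge0. Qed.

Lemma dist_g_le x y gamma : rectifiable_path Omega x y gamma ->
  (dist_g Omega h x y <= path_length h gamma)%E.
Proof. by move=> rg; apply: ereal_inf_lbound; exists gamma. Qed.

Lemma near_derive1 gamma gamma' (t : R) : (\near t, gamma t = gamma' t) ->
  derive1 gamma t = derive1 gamma' t.
Proof. by move=> H; rewrite !derive1E; exact: near_eq_derive. Qed.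

(** The path waits at [gamma tau] until time [tau] and then follows [gamma], so the tail keeps the
    parameter interval [0, 1] without any change of variable. *)
Lemma subpath_rectifiable x y gamma (tau : R) : rectifiable_path Omega x y gamma ->
  0 <= tau <= 1 -> rectifiable_path Omega (gamma tau) y (fun t => gamma (Num.max t tau)).
Proof.
move=> [[g0 g1] gO /lipschitz_itvP[K K0 gK] gd] /andP[t0 t1]; split.
- by rewrite (max_r t0) (max_l t1).
- by move=> t /andP[? ?]; apply: gO; rewrite le_max ge_max; lra.
- apply/lipschitz_itvP; exists K => // s t /andP[? ?] /andP[? ?].
  apply: le_trans (gK _ _ _ _) _; rewrite ?le_max ?ge_max; try lra.
  rewrite ler_pM2l//; case: (leP s tau) => ?; case: (leP t tau) => ?;
    rewrite ?subrr ?normr0//.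
  + by rewrite !ler0_norm; lra.
  + by rewrite !ger0_norm; lra.
- apply: ae_impl2 gd (ae_neq tau) => t gd tnt t01.
  have [ttau|ttau|E] := ltgtP t tau; last by rewrite E eqxx in tnt.
  + apply: (@near_eq_derivable _ _ _ (cst (gamma tau))); last exact: derivable_cst.
    by near=> s; rewrite /= max_r// ltW//; near: s; exact: lt_nbhsl.
  + apply: (@near_eq_derivable _ _ _ gamma); last exact: gd.
    by near=> s; rewrite max_l// ltW//; near: s; exact: lt_nbhsr.
Unshelve. all: by end_near. Qed.

(** While waiting, the path has velocity 0 and contributes nothing, provided [h] is nonzero there:
    where [h] vanishes the speed is infinite whatever the velocity. *)
Lemma dist_g_le_subpath x y gamma (tau : R) : rectifiable_path Omega x y gamma ->
  0 <= tau <= 1 -> h (gamma tau) != 0 ->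
  (dist_g Omega h (gamma tau) y <= \int[mu]_(t in `[tau, 1%R]) speed gamma t)%E.
Proof.
move=> rg t01 h0.
apply: le_trans (dist_g_le (subpath_rectifiable rg t01)) _.
rewrite path_lengthE (_ : `[tau, 1%R]%classic = `[0%R, 1%R] `&` `[tau, 1%R]); last first.
  by apply/seteqP; split => t /=; rewrite !in_itv/=; move: t01; lra.
rewrite integral_mkcondr; apply: ae_le_integral_nonmeas => //.
- by move=> t _; exact: speed_ge0.
- by move=> t _; rewrite patchE; case: ifP => // _; exact: speed_ge0.
apply: ae_impl (ae_neq tau) => t tnt; rewrite /= in_itv/= => /andP[t0 t1].
have [ttau|ttau|E] := ltgtP t tau; last by rewrite E eqxx in tnt.
- rewrite /speed (max_r (ltW ttau)) (negbTE h0) (@near_derive1 _ (cst (gamma tau))).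
    rewrite derive1_cst enorm0 mul0r patchE; case: ifP => // _; case: ifP => // _.
      by rewrite leey.
    by rewrite lee_fin divr_ge0// enorm_ge0.
  by near=> s; rewrite /= max_r// ltW//; near: s; exact: lt_nbhsl.
- rewrite patchE mem_set /= ?in_itv/= ?(ltW ttau)//.
  rewrite /speed (max_l (ltW ttau)) (@near_derive1 _ gamma)//.
  by near=> s; rewrite max_l// ltW//; near: s; exact: lt_nbhsr.
Unshelve. all: by end_near. Qed.

(** Project the path on its own chord [w]: the derivative of [dot w gamma] is at most |w| |gamma'|,
    hence at most |w| [H] times the speed. The factor |w| is then cancelled. *)
Lemma enorm_le_length x y gamma (a b H : R) : rectifiable_path Omega x y gamma ->
  0 <= a -> a < b -> b <= 1 -> 0 < H ->
  (forall t, a < t < b -> 0 <= h (gamma t) <= H) ->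
  ((enorm (gamma b - gamma a))%:E <= H%:E * \int[mu]_(t in `[a, b]) speed gamma t)%E.
Proof.
move=> [_ gO /lipschitz_itvP[K K0 gK] gd] a0 ab b1 H0 hH.
set w := gamma b - gamma a.
have [->|w0] := eqVneq w 0.
  by rewrite enorm0 mule_ge0 ?lee_fin ?(ltW H0)// integral_ge0// => t _; exact: speed_ge0.
have w0' : 0 < enorm w by rewrite enorm_gt0.
rewrite -(lee_pmul2l _ (_ : (0 < (enorm w)%:E)%E)) ?lte_fin// muleA -!EFinM.
rewrite -expr2 sqr_enorm {2}/w dotBr.
apply: (@lipschitz_le_integral _ (fun t => dot w (gamma t)) _ _ (enorm w * (2 * K))) => //.
- by rewrite mulr_gt0.
- move=> s t /andP[? ?] /andP[? ?]; rewrite -dotBr.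
  apply: le_trans (norm_dot_le _ _) _; rewrite -mulrA ler_pM2l// -mulrA.
  by apply: le_trans (enorm_le_norm _) _; rewrite ler_pM2l//; apply: gK; lra.
- by move=> t; exact: speed_ge0.
apply: ae_impl gd => t dg tab; have {}dg : derivable gamma t 1 by apply: dg; rewrite in_itv/=; move: tab; lra.
 have Dg : is_derive t 1 gamma (derive1 gamma t) by rewrite derive1E.
have [d1 d2] := is_derive_dot (is_derive_cst w t 1) Dg.
split => //; rewrite derive1E d2 dot0l add0r /speed.
have /andP[h0 hH'] := hH _ tab.
case: ifPn => hz; first by rewrite gt0_muley ?leey// lte_fin mulr_gt0.
rewrite -EFinM lee_fin; apply: le_trans (dot_le_enorm _ _) _.
rewrite -mulrA ler_pM2l// mulrA mulrAC -[leLHS]mul1r ler_wpM2r ?enorm_ge0//.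
by rewrite ger0_norm// ler_pdivlMr ?mul1r// lt_neqAle eq_sym hz.
Qed.

(** The logarithmic derivative of [h] along the path is (grad h . gamma') / h, at most [G] times the
    speed. The lower bound [m] of [h] on the arc is what makes ln (h o gamma) Lipschitz. *)
Lemma ln_le_length x y gamma (a b G : R) : rectifiable_path Omega x y gamma ->
  0 <= a -> a < b -> b <= 1 -> 0 < G ->
  (exists2 L, 0 < L & forall u v, Omega u -> Omega v -> `|h u - h v| <= L * `|u - v|) ->
  (forall u, Omega u -> differentiable h u /\ enorm (grad h u) <= G) ->
  (exists2 m, 0 < m & forall t, a <= t <= b -> m <= h (gamma t)) ->
  ((ln (h (gamma b)) - ln (h (gamma a)))%:E <=
    G%:E * \int[mu]_(t in `[a, b]) speed gamma t)%E.
Proof.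
move=> [_ gO /lipschitz_itvP[K K0 gK] gd] a0 ab b1 G0 [L L0 hL] hG [m m0 hm].
apply: (@lipschitz_le_integral _ (fun t => ln (h (gamma t))) _ _ (m^-1 * (L * K))) => //.
- move=> s t /[dup] sab /andP[? ?] /[dup] tab /andP[? ?].
  have lnle u v : m <= u -> m <= v -> ln u - ln v <= m^-1 * `|u - v|.
    move=> mu_ mv; have v0 := lt_le_trans m0 mv; have u0 := lt_le_trans m0 mu_.
    rewrite -ln_div ?posrE//.
    have -> : u / v = 1 + (u - v) / v by field; rewrite gt_eqF.
    apply: le_trans (le_ln1Dx _) _; first by rewrite mulrBl mulfV ?gt_eqF// ltrBrDl; rewrite subrr divr_gt0.
    apply: le_trans (ler_norm _) _; rewrite normrM mulrC ler_wpM2r//.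
    by rewrite gtr0_norm ?invr_gt0// lef_pV2.
  have hs := hm _ sab; have ht := hm _ tab.
  apply: (@le_trans _ _ (m^-1 * `|h (gamma s) - h (gamma t)|)).
    by rewrite ler_norml lerNl opprB lnle// distrC lnle.
  rewrite -!mulrA ler_pM2l ?invr_gt0//.
  apply: le_trans (hL _ _ _ _) _; [apply: gO; lra|apply: gO; lra|].
  by rewrite ler_pM2l//; apply: gK; lra.
- by move=> t; exact: speed_ge0.
apply: ae_impl gd => t dg tab; have {}dg : derivable gamma t 1 by apply: dg; rewrite in_itv/=; move: tab; lra.
 have Dg : is_derive t 1 gamma (derive1 gamma t) by rewrite derive1E.
have Ot : Omega (gamma t) by apply: gO; move: tab; lra.
have [dh gG] := hG _ Ot.
have mh : m <= h (gamma t) by apply: hm; move: tab; lra.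
have h0 : 0 < h (gamma t) by apply: lt_le_trans mh.
have D1 := is_derive_comp_grad dh Dg.
have D2 := is_derive1_ln h0.
have [d1 d2] := @is_derive1_comp _ (@ln R) (fun t => h (gamma t)) t _ _ D2 D1.
split => //; rewrite derive1E d2 /speed gt_eqF// -EFinM lee_fin gtr0_norm//.
rewrite mulrC mulrA ler_wpM2r ?invr_ge0 ?(ltW h0)//.
by apply: le_trans (dot_le_enorm _ _) _; rewrite ler_wpM2r ?enorm_ge0.
Qed.

Lemma append_rectifiable x y z gamma : rectifiable_path Omega x y gamma ->
  (forall t, 0 <= t <= 1 -> Omega (y + t *: (z - y))) ->
  rectifiable_path Omega x z (fun t => if t <= 2^-1 then gamma (2 * t)
     else y + (2 * t - 1) *: (z - y)).
Proof.
move=> [[g0 g1] gO /lipschitz_itvP[K K0 gK] gd] yz.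
set d := fun t => _.
have dl t : t <= 2^-1 -> d t = gamma (2 * t) by rewrite /d => ->.
have dr t : 2^-1 <= t -> d t = y + (2 * t - 1) *: (z - y).
  rewrite /d le_eqVlt => /predU1P[<-|]; last by rewrite ltNge => /negbTE ->.
  by rewrite lexx mulfV// subrr scale0r addr0 g1.
have dhalf : d 2^-1 = y by rewrite dl// mulfV// g1.
split.
- rewrite dl ?mulr0// ?invr_ge0// dr ?invf_le1// ?ler1n//; split => //.
  by rewrite (_ : 2 * 1 - 1 = 1 :> R); [rewrite scale1r addrC subrK|lra].
- move=> t /andP[? ?]; case: (leP t 2^-1) => t2.
    by rewrite dl//; apply: gO; lra.
  by rewrite dr ?ltW//; apply: yz; lra.
- pose M := 2 * K + 2 * (`|z - y| + 1).
  have M0 : 0 < M by rewrite /M addr_gt0// mulr_gt0// ltr_wpDl.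
  have Ml s t : 0 <= s -> s <= t -> t <= 2^-1 -> `|d t - d s| <= M * (t - s).
    move=> s0 st t2; rewrite !dl//; last lra.
    apply: le_trans (gK _ _ _ _) _; [lra|lra|].
    rewrite -mulrBr normrM ger0_norm// ger0_norm ?subr_ge0// mulrA ler_wpM2r ?subr_ge0//.
    by rewrite /M mulrC lerDl mulr_ge0// addr_ge0.
  have Mr s t : 2^-1 <= s -> s <= t -> `|d t - d s| <= M * (t - s).
    move=> s0 st; rewrite !dr//; last lra.
    have -> : y + (2 * t - 1) *: (z - y) - (y + (2 * s - 1) *: (z - y)) =
        (2 * (t - s)) *: (z - y).
      by apply: rV2P; rewrite !mxE; ring.
    rewrite normrZ ger0_norm ?mulr_ge0 ?subr_ge0// mulrAC ler_wpM2r ?subr_ge0//.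
    by rewrite /M; have := normr_ge0 (z - y); lra.
  have Mm s t : 0 <= s -> s <= t -> `|d t - d s| <= M * (t - s).
    move=> s0 st; case: (leP t 2^-1) => t2; first exact: Ml.
    case: (leP 2^-1 s) => s2; first exact: Mr.
    have -> : d t - d s = (d t - d 2^-1) + (d 2^-1 - d s) by rewrite addrA subrK.
    apply: le_trans (ler_normD _ _) _.
    have := Mr _ _ (lexx _) (ltW t2); have := Ml _ _ s0 (ltW s2) (lexx _); lra.
  apply/lipschitz_itvP; exists M => // s t /andP[s0 _] /andP[t0 _].
  have [st|ts] := leP s t.
    by rewrite distrC (distrC s) (ger0_norm (_ : 0 <= t - s)) ?subr_ge0// Mm.
  by rewrite (ger0_norm (_ : 0 <= s - t)) ?subr_ge0 ?Mm// ltW.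
- have Hd : {ae mu, forall t, t \in `[0, 2^-1] -> derivable gamma (2 * t) 1}.
    apply: ae_impl (ae_double gd) => t dg; rewrite in_itv/= => tab.
    by apply: dg; rewrite in_itv/=; move: tab; lra.
  apply: ae_impl2 Hd (ae_neq 2^-1) => t gd' tn; rewrite in_itv/= => /andP[t0 t1].
  have [t2|t2|E] := ltgtP t 2^-1; last by rewrite E eqxx in tn.
  + apply: (@near_eq_derivable _ _ _ (gamma \o (fun s => 2 * s))).
      by near=> s; rewrite /= dl// ltW//; near: s; exact: lt_nbhsl.
    apply/derivable1_diffP/differentiable_comp; apply/derivable1_diffP.
      by [].
    by apply: gd'; rewrite in_itv/= t0 ltW.
  + apply: (@near_eq_derivable _ _ _ (fun s : R => y + (2 * s - 1) *: (z - y))).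
      by near=> s; rewrite dr// ltW//; near: s; exact: lt_nbhsr.
    by case: (is_derive_line 2 (-1) y (z - y) t).
Unshelve. all: by end_near.
Qed.

(** Each half of the concatenation runs at double speed. The first half costs at most the length of
    [gamma] by the change of variable, and the segment costs at most its Euclidean length over
    [m]. *)
Lemma dist_g_append_le x y z m gamma : rectifiable_path Omega x y gamma -> 0 < m ->
  (forall t, 0 <= t <= 1 -> Omega (y + t *: (z - y)) /\ m <= h (y + t *: (z - y))) ->
  (dist_g Omega h x z <= path_length h gamma + (enorm (z - y) / m)%:E)%E.
Proof.
move=> rg m0 yz.
apply: le_trans (dist_g_le (append_rectifiable rg (fun t t01 => (yz t t01).1))) _.
set d := fun t : R => _.
rewrite path_lengthE (_ : `[0%R, 1%R]%classic = `[0%R, 2^-1%R] `|` `[2^-1%R, 1%R]); last first.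
  by apply/seteqP; split => t /=; rewrite !in_itv/=; case: (leP t 2^-1); lra.
apply: le_trans (@integral_setU_le _ _ _ mu `[0%R, 2^-1%R] `[2^-1%R, 1%R] (speed d) _ _ _) _ => //.
  by move=> t _; exact: speed_ge0.
apply: leeD.
  have : (\int[mu]_(t in `[0%R, 2^-1%R]) speed d t <=
      \int[mu]_(t in `[0%R, 2^-1%R]) (2%:E * speed gamma (2 * t)))%E.
    apply: (@ae_le_integral_nonmeas _ _ _ mu) => //.
    - by move=> t _; exact: speed_ge0.
    - by move=> t _; rewrite mule_ge0 ?lee_fin//; exact: speed_ge0.
    have [_ _ _ gd] := rg.
    apply: ae_impl2 (ae_double gd) (ae_neq 2^-1) => t dg tn; rewrite /= in_itv/= => /andP[t0 t1].
    have t2 : t < 2^-1 by rewrite lt_neqAle tn.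
    have {}dg : derivable gamma (2 * t) 1 by apply: dg; rewrite in_itv/=; lra.
    have dE : derive1 d t = 2 *: derive1 gamma (2 * t).
      rewrite (@near_derive1 _ (gamma \o (fun s : R => 2 * s))); last first.
        by near=> s; rewrite /d/= ltW//; near: s; exact: lt_nbhsl.
      have D2 : is_derive t (1:R) (fun s : R => 2 * s) 2.
        by apply: (is_derive_eq (is_deriveZ 2 (is_derive_id t 1))); rewrite /GRing.scale/= mulr1.
      have /is_derive_coordP Dg : is_derive (2 * t) 1 gamma (derive1 gamma (2 * t)).
        by rewrite derive1E.
      have [_] : is_derive t 1 (gamma \o (fun s : R => 2 * s)) (2 *: derive1 gamma (2 * t)).
        apply/is_derive_coordP => j.
        apply: (is_derive_eq (@is_derive1_comp _ (fun s => gamma s 0 j) (fun s => 2 * s) t _ _ (Dg j) D2)).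
        by rewrite mxE mulrC.
      by move=> <-; rewrite derive1E.
    rewrite /speed {1 3}/d (ltW t2) dE; case: ifPn => h0; first by rewrite mulry gtr0_sg// mul1e.
    by rewrite -EFinM lee_fin enormZ ger0_norm// mulrA.
  move=> /le_trans; apply; apply: integral_below_le => //.
    by move=> t _; rewrite mule_ge0 ?lee_fin//; exact: speed_ge0.
  move=> w mw w0 wle; rewrite integral_half// path_lengthE.
  rewrite -ge0_integralZl_EFin//; last first.
  - apply/measurable_EFinP; apply: measurable_funTS; apply: measurableT_comp mw _.
    by apply: continuous_measurable_fun => t; apply: cvgMl; exact: cvg_id.
  - by move=> t _; rewrite lee_fin.
  apply: (@le_integral_nonmeas _ _ _ mu) => t.
    by move=> _; rewrite mule_ge0// lee_fin.
  rewrite /= in_itv/= => t01; rewrite lee_pdivrMl//.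
  have := wle (t / 2); rewrite /= in_itv/= mulrCA mulfV// mulr1; apply.
  by move: t01; lra.
apply: (@le_trans _ _ (\int[mu]_(t in `[2^-1%R, 1%R]) (2 * enorm (z - y) / m)%:E)%E).
  apply: (@ae_le_integral_nonmeas _ _ _ mu) => //.
  - by move=> t _; exact: speed_ge0.
  - by move=> t _; rewrite lee_fin divr_ge0 ?mulr_ge0 ?enorm_ge0// ltW.
  apply: ae_impl (ae_neq 2^-1) => t tn; rewrite /= in_itv/= => /andP[t0 t1].
  have t2 : 2^-1 < t by rewrite lt_neqAle eq_sym tn.
  have [_ hm] : Omega (y + (2 * t - 1) *: (z - y)) /\ m <= h (y + (2 * t - 1) *: (z - y)).
    by apply: yz; lra.
  have dt : d t = y + (2 * t - 1) *: (z - y) by rewrite /d leNgt t2.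
  have h0 := lt_le_trans m0 hm.
  have dE : derive1 d t = 2 *: (z - y).
    rewrite (@near_derive1 _ (fun s : R => y + (2 * s + -1) *: (z - y))); last first.
      by near=> s; rewrite /d leNgt ifF//; apply/negbTE; rewrite negbK; near: s; exact: lt_nbhsr.
    by rewrite derive1E; case: (is_derive_line 2 (-1) y (z - y) t).
  rewrite /speed dt gt_eqF// lee_fin dE enormZ (ger0_norm (_ : 0 <= 2))// gtr0_norm//.
  by rewrite ler_wpM2l ?mulr_ge0 ?enorm_ge0// lef_pV2.
rewrite integral_cst//= lebesgue_measure_itv/= lte_fin ifT ?invf_lt1 ?ltr1n//.
by rewrite -EFinD -EFinM lee_fin; apply/eqP/eqP; rewrite le_eqVlt; apply/orP; left; apply/eqP; field; rewrite gt_eqF.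
Unshelve. all: by end_near.
Qed.

(** The triangle inequality with a straight last leg. It serves to propagate finiteness of the
    distance and to vary the target of the energy. *)
Lemma dist_g_triangle_seg x y z m : 0 < m ->
  (forall t, 0 <= t <= 1 -> Omega (y + t *: (z - y)) /\ m <= h (y + t *: (z - y))) ->
  (dist_g Omega h x z <= dist_g Omega h x y + (enorm (z - y) / m)%:E)%E.
Proof.
move=> m0 yz; rewrite -leeBlDr//; apply: le_ereal_inf_tmp => _ [g rg <-].
by rewrite leeBlDr//; exact: dist_g_append_le.
Qed.

Lemma dist_g_refl x : Omega x -> h x != 0 -> dist_g Omega h x x = 0%E.
Proof.
move=> Ox hx; apply/eqP; rewrite eq_le dist_g_ge0 andbT.
have rx : rectifiable_path Omega x x (cst x).
  split=> //.
    by apply/lipschitz_itvP; exists 1 => // s t _ _; rewrite subrr normr0 mul1r.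
  by apply: ae_impl (ae_neq 0) => t _ _; exact: derivable_cst.
apply: le_trans (dist_g_le rx) _; rewrite path_lengthE.
rewrite integral0_eq// => t _; rewrite /speed (negbTE hx) derive1_cst.
by rewrite enorm0 mul0r.
Qed.

Lemma enorm_le_dist_g x y H : 0 < H -> (forall u, Omega u -> 0 <= h u <= H) ->
  ((enorm (y - x))%:E <= H%:E * dist_g Omega h x y)%E.
Proof.
move=> H0 hH; rewrite -lee_pdivrMl//; apply: le_ereal_inf_tmp => _ [g rg <-].
rewrite lee_pdivrMl// path_lengthE.
have [[<- <-] gO _ _] := rg.
by apply: (enorm_le_length rg) => // t t01; apply/hH/gO; move: t01; lra.
Qed.

End Length.

(** * Eikonal inequality and blow-up at the boundary *)

(** [tau] is the supremum of the times up to which [f] stays at or below [c]. The Lipschitz constant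
    converts a strict inequality at [tau] into a definite step beyond it, which contradicts the
    supremum. *)
Lemma first_crossing (R : realType) (f : R -> R) (a b c K : R) : a <= b -> 0 < K ->
  (forall s t, a <= s <= b -> a <= t <= b -> `|f s - f t| <= K * `|s - t|) ->
  f a <= c <= f b ->
  exists tau, [/\ a <= tau <= b, f tau = c & forall t, a <= t <= tau -> f t <= c].
Proof.
move=> ab K0 lip /andP[fa fb].
pose S := [set t | a <= t <= b /\ forall s, a <= s <= t -> f s <= c].
have Sa : S a.
  by split=> [|s /andP[? ?]]; [lra|rewrite (_ : s = a)//; lra].
have Sub : ubound S b by move=> t [/andP[]].
have Ss : has_sup S by split; [exists a|exists b].
pose tau := sup S.
have taua : a <= tau by apply: sup_upper_bound.
have taub : tau <= b by apply: sup_le_ub => //; exists a.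
have below s : a <= s -> s < tau -> f s <= c.
  move=> sa st; have ts0 : 0 < tau - s by rewrite subr_gt0.
  have [t [tab tS] ts] := sup_adherent ts0 Ss.
  by apply: tS; rewrite sa/= ltW//; move: ts; rewrite -/tau; lra.
have ftau : f tau <= c.
  have [<-//|atau] := eqVneq a tau.
  have {}atau : a < tau by rewrite lt_neqAle atau.
  apply/ler_addgt0Pr => e e0.
  pose s := Num.max a (tau - e / K).
  have eK : 0 < e / K by rewrite divr_gt0.
  have sa : a <= s by rewrite le_max lexx.
  have st : s < tau by rewrite gt_max atau/=; lra.
  have sE : tau - s <= e / K.
    have : tau - e / K <= s by rewrite le_max lexx orbT.
    lra.
  have := below _ sa st; have := lip tau s; rewrite taua taub sa (ltW (lt_le_trans st taub)).
  move=> /(_ isT isT) /(le_trans (ler_norm _)).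
  rewrite ger0_norm ?subr_ge0 ?(ltW st)//.
  have : K * (tau - s) <= e by rewrite mulrC -ler_pdivlMr.
  lra.
exists tau; split; [by rewrite taua| |].
- apply/eqP; rewrite eq_le ftau/= leNgt; apply/negP => flt.
  have tb : tau < b.
    by rewrite lt_neqAle taub andbT; apply/negP => /eqP E; rewrite E in flt; lra.
  pose d := Num.min (b - tau) ((c - f tau) / K).
  have d0 : 0 < d by rewrite lt_min subr_gt0 tb divr_gt0// subr_gt0.
  have db : d <= b - tau by rewrite ge_min lexx.
  have dK : K * d <= c - f tau.
    by rewrite mulrC -ler_pdivlMr// ge_min lexx orbT.
  have : S (tau + d).
    split=> [|s /andP[sa sd]]; first lra.
    have [st|ts] := ltP s tau; first exact: below.
    have := lip s tau; rewrite taua taub sa/=.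
    have -> : s <= b by lra.
    move=> /(_ isT isT) /(le_trans (ler_norm _)).
    rewrite ger0_norm ?subr_ge0//.
    have : K * (s - tau) <= K * d by rewrite ler_pM2l//; lra.
    lra.
  by move=> /(sup_upper_bound Ss); rewrite -/tau; lra.
- move=> t /andP[ta]; rewrite le_eqVlt => /predU1P[->//|tt]; exact: below.
Qed.

Section MetricGeometry.
Variables (R : realType) (Omega : set 'rV[R]_2) (h : 'rV[R]_2 -> R).
Notation mu := (@lebesgue_measure R).
Implicit Types (gamma : R -> 'rV[R]_2) (x y z : 'rV[R]_2).

(* ln (h o gamma) grows at most G times as fast as the length of gamma. *)
Lemma dist_g_ge_ln x y G : 0 < G -> 0 < h x -> 0 < h y ->
  (exists2 L, 0 < L & forall u v, Omega u -> Omega v -> `|h u - h v| <= L * `|u - v|) ->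
  (forall u, Omega u -> differentiable h u /\ enorm (grad h u) <= G) ->
  ((ln (h y) - ln (h x))%:E <= G%:E * dist_g Omega h x y)%E.
Proof.
move=> G0 hx hy [L L0 hL] hG; rewrite -lee_pdivrMl//; apply: le_ereal_inf_tmp => _ [g rg <-].
rewrite lee_pdivrMl//.
have [yx|xy] := leP (h y) (h x).
  apply: (@le_trans _ _ 0%E); last by rewrite mule_ge0 ?lee_fin ?(ltW G0)// path_ge0.
  by rewrite lee_fin subr_le0 ler_ln.
have [[g0 g1] gO /lipschitz_itvP[K K0 gK] _] := rg.
(* The path may come close to the zero set of [h]. Run it backwards from [y] and stop when [h] first
   takes the value [h x]: on the remaining arc [h] is at least [h x], so its logarithm can be
   followed. *)
have [tau [taub ftau below]] : exists tau, [/\ 0 <= tau <= 1, - h (g (1 - tau)) = - h x &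
    forall t, 0 <= t <= tau -> - h (g (1 - t)) <= - h x].
  apply: (@first_crossing R (fun t => - h (g (1 - t))) 0 1 (- h x) (L * K));
    [exact: ler01|exact: mulr_gt0| |].
  move=> s t s01 t01; rewrite opprK addrC.
  apply: le_trans (hL _ _ _ _) _; [by apply: gO; lra|by apply: gO; lra|].
  rewrite -mulrA ler_pM2l//; apply: le_trans (gK _ _ _ _) _; [lra|lra|].
  by rewrite (_ : 1 - t - (1 - s) = s - t)//; lra.
  by rewrite subr0 subrr g0 g1 lexx lerN2 ltW.
have tau1 : tau != 0.
  apply/eqP => E; move: ftau; rewrite E subr0 g1; lra.
have tau0 : 0 < tau by rewrite lt_neqAle eq_sym tau1; case/andP: taub.
have E1 : h (g (1 - tau)) = h x by apply: oppr_inj.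
rewrite -E1 -g1; apply: le_trans.
  apply: (@ln_le_length _ _ _ _ _ _ (1 - tau) 1 G rg); try lra => //.
    by exists L.
    exact: hG.
  exists (h x) => // t t01; rewrite -lerN2 -[t](subKr 1); apply: below; lra.
rewrite lee_pmul2l// path_lengthE; apply: (@subset_integral_nonmeas _ _ _ mu) => [t _|t].
  exact: speed_ge0.
by rewrite /= !in_itv/=; lra.
Qed.

Lemma energy_ge0 x y : 0 <= energy Omega h x y.
Proof. by rewrite /energy divr_ge0// sqr_ge0. Qed.

Lemma diff_approx (F : 'rV[R]_2 -> R) x e : differentiable F x -> 0 < e ->
  exists2 d, 0 < d & forall y, enorm (y - x) < d ->
    `|F y - F x - dot (grad F x) (y - x)| <= e * enorm (y - x).
Proof.
move=> dF e0.
have /eqaddoP /(_ e e0) := diff_locally dF.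
move=> /nbhs_normP[d /= d0 H]; exists d => // y yd.
have {}H := H (y - x); move: H; rewrite /ball_/= sub0r normrN.
rewrite (le_lt_trans (norm_le_enorm _) yd) => /(_ isT).
rewrite !fctE /= subrK diff_gradE// opprD addrA => /le_trans; apply.
by rewrite ler_pM2l// norm_le_enorm.
Qed.

(** Take a path within r^2 of the infimum. When it first leaves the ball of radius [r] it has spent
    at least r / H of its length. The excess r^2 is of second order and disappears when [r] tends to
    0. *)
Lemma exit_point x q r H : Omega x -> 0 < r -> r <= enorm (q - x) -> 0 < H ->
  (dist_g Omega h x q < +oo)%E ->
  (forall u, Omega u -> enorm (u - x) <= r -> 0 < h u <= H) ->
  exists2 y, enorm (y - x) = r &
    (dist_g Omega h y q <= (fine (dist_g Omega h x q) + r ^+ 2 - r / H)%:E)%E.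
Proof.
move=> Ox r0 rq H0 fin hH.
have Dfin : dist_g Omega h x q \is a fin_num by rewrite ge0_fin_numE// dist_g_ge0.
have r20 : 0 < r ^+ 2 by rewrite exprn_gt0.
have [_ [g rg <-] gl] := lb_ereal_inf_adherent r20 Dfin.
have [[g0 g1] gO /lipschitz_itvP[K K0 gK] _] := rg.
have [tau [taub ftau below]] : exists tau, [/\ 0 <= tau <= 1, enorm (g tau - x) = r &
    forall t, 0 <= t <= tau -> enorm (g t - x) <= r].
  apply: (@first_crossing R (fun t => enorm (g t - x)) 0 1 r (2 * K));
    [exact: ler01|exact: mulr_gt0| |].
  move=> s t s01 t01.
  have tri (u v : 'rV[R]_2) : `|enorm u - enorm v| <= enorm (u - v).
    rewrite ler_norml lerNl opprB; apply/andP; split; rewrite lerBlDr.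
      rewrite -[enorm (u - v)]enormN opprB -{1}(subrK u v); exact: enormD.
    by rewrite -{1}(subrK v u); exact: enormD.
  apply: le_trans (tri _ _) _; rewrite opprB addrA subrK.
  apply: le_trans (enorm_le_norm _) _; rewrite -mulrA ler_pM2l//; exact: gK.
  by rewrite g0 g1 subrr enorm0 rq ltW.
have tau0 : 0 < tau.
  have /andP[] := taub; rewrite le_eqVlt => /predU1P[E|//].
  by move: ftau; rewrite -E g0 subrr enorm0; lra.
have hb t : 0 <= t <= tau -> 0 < h (g t) <= H.
  by move=> t0; apply: hH; [apply: gO; move: taub; lra|exact: below].
exists (g tau) => //.
have htau : h (g tau) != 0.
  have /andP[h1 _] : 0 < h (g tau) <= H by apply: hb; lra.
  by rewrite gt_eqF.
have L2 := dist_g_le_subpath rg taub htau.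
have L1 : ((r / H)%:E <= \int[mu]_(t in `[0%R, tau]) speed h g t)%E.
  have : ((enorm (g tau - g 0))%:E <= H%:E * \int[mu]_(t in `[0%R, tau]) speed h g t)%E.
    apply: (enorm_le_length rg) => //; first by case/andP: taub.
    by move=> t /andP[? ?]; have /andP[/ltW -> ->] : 0 < h (g t) <= H by apply: hb; lra.
  by rewrite g0 ftau -lee_pdivrMl// -EFinM mulrC.
have L3 : (\int[mu]_(t in `[0%R, tau]) speed h g t +
    \int[mu]_(t in `[tau, 1%R]) speed h g t <= path_length h g)%E.
  rewrite path_lengthE; apply: le_trans.
    apply: (@integral_setU_ge _ _ _ mu) => //.
      rewrite (_ : _ `&` _ = [set tau]); first exact: lebesgue_measure_set1.
      apply/seteqP; split => t /=; rewrite !in_itv/=; last by move=> ->; move: taub; lra.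
      by move=> [/andP[? ?] /andP[? ?]]; apply/eqP; rewrite eq_le; apply/andP.
    by move=> t _; exact: speed_ge0.
  apply: (@subset_integral_nonmeas _ _ _ mu) => [t _|t]; first exact: speed_ge0.
  by rewrite /= !in_itv/=; move: taub; lra.
apply: le_trans L2 _; rewrite EFinB leeBrDr// addeC.
apply: le_trans (leeD L1 (lexx _)) _; apply: le_trans L3 _.
apply: le_trans (ltW gl) _; rewrite EFinD fineK//.
Qed.

(* Along an almost minimal path from x the distance to q decreases at rate
   1 / h x; only this half of the eikonal equation is needed. *)
Lemma eikonal_energy x q : Omega x -> 0 < h x -> {for x, continuous h} ->
  (\forall u \near x, Omega u -> 0 < h u) ->
  (dist_g Omega h x q < +oo)%E -> differentiable (energy Omega h ^~ q) x ->
  2 * energy Omega h x q <=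
    h x ^+ 2 * enorm (grad (energy Omega h ^~ q) x) ^+ 2.
Proof.
move=> Ox hx ch hpos fin dF.
set F := energy Omega h ^~ q; set A := enorm (grad F x).
have A0 : 0 <= A by exact: enorm_ge0.
pose D := fine (dist_g Omega h x q).
have D0 : 0 <= D by rewrite fine_ge0// dist_g_ge0.
have FxE : F x = D ^+ 2 / 2 by [].
have Dfin : dist_g Omega h x q \is a fin_num by rewrite ge0_fin_numE// dist_g_ge0.
suff H : D <= h x * A.
  rewrite /energy -/D mulrC divfK// -exprMn ler_sqr ?nnegrE//.
  by rewrite mulr_ge0// ltW.
have [->|Dn0] := eqVneq D 0; first by rewrite mulr_ge0// ltW.
have {Dn0} Dpos : 0 < D by rewrite lt_neqAle eq_sym Dn0.
have xq : x != q.
  apply/eqP => E; move: Dpos; rewrite /D -E dist_g_refl ?ltxx//.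
  by rewrite gt_eqF.
have rq : 0 < enorm (q - x) by rewrite enorm_gt0 subr_eq0 eq_sym.
(* At the exit point [y] of a small ball, differentiability bounds the loss [F x - F y] by
   [(A + e) * r], whereas the distance to [q] has dropped by about r / (h x + e). Comparing
   first-order terms in [r] gives the estimate. *)
have key e : 0 < e -> e <= 1 -> D <= (A + 2 * e) * (h x + e).
  move=> e0 e1; have hxe : 0 < h x + e by lra.
  have [d1 d10 Hd1] := diff_approx dF e0.
  have [d2 /= d20 Hd2] : exists2 d, 0 < d & forall u, enorm (u - x) < d ->
      Omega u -> 0 < h u <= h x + e.
    have : \forall u \near x, `|h x - h u| < e by move/cvgrPdist_lt : ch; apply.
    move=> /(filterI hpos) /nbhs_normP[d /= d0 H]; exists d => // u ud Ou.
    have [|/(_ Ou) h1 h2] := H u.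
      by rewrite /= distrC; apply: le_lt_trans ud; exact: norm_le_enorm.
    by rewrite h1; move: h2; rewrite ltr_norml; lra.
  pose B := (h x + e)^-1.
  have B0 : 0 < B by rewrite invr_gt0.
  (* The radius must respect the differentiability estimate, the bound on [h] and the distance to
     [q]; the last entry makes the second-order terms of [main] at most [e]. *)
  pose r := Num.min (Num.min (d1 / 2) (d2 / 2)) (Num.min (enorm (q - x)) (Num.min (Num.min 1 B) (e / (D + B ^+ 2 + 1)))).
  have C0 : 0 < D + B ^+ 2 + 1 by rewrite addr_gt0// addr_gt0// exprn_gt0.
  have r0 : 0 < r by rewrite !lt_min !divr_gt0//= rq ltr01 B0.
  have rd1 : r < d1 by apply: (@le_lt_trans _ _ (d1 / 2)); [rewrite !ge_min lexx//|lra].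
  have rd2 : r < d2 by apply: (@le_lt_trans _ _ (d2 / 2)); [rewrite !ge_min lexx ?orbT//|lra].
  have rqx : r <= enorm (q - x) by rewrite !ge_min lexx ?orbT.
  have r1 : r <= 1 by rewrite !ge_min lexx ?orbT.
  have rB : r <= B by rewrite !ge_min lexx ?orbT.
  have re : r * (D + B ^+ 2 + 1) <= e.
    by rewrite -ler_pdivlMr// !ge_min lexx ?orbT.
  have [y yr yD] := exit_point Ox r0 rqx hxe fin
    (fun u Ou ur => Hd2 u (le_lt_trans ur rd2) Ou).
  have Hlow : - (e * r) <= F y - F x - dot (grad F x) (y - x).
    by have := Hd1 y; rewrite yr => /(_ rd1); rewrite ler_norml => /andP[].
  have Hgrad : - (A * r) <= dot (grad F x) (y - x).
    by rewrite lerNl -dotNl -yr -[A]enormN; exact: dot_le_enorm.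
  pose b := D + r ^+ 2 - r / (h x + e).
  have dy0 := dist_g_ge0 Omega h y q.
  have b0 : 0 <= b by rewrite -lee_fin; apply: le_trans dy0 yD.
  have yfin : dist_g Omega h y q \is a fin_num.
    by rewrite ge0_fin_numE//; apply: le_lt_trans yD _; rewrite ltry.
  have FyE : F y <= b ^+ 2 / 2.
    rewrite /F /energy ler_pM2r ?invr_gt0// ler_sqr ?nnegrE ?fine_ge0//.
    by rewrite -lee_fin fineK.
  have bE : b = D + r * (r - B) by rewrite /b /B; ring.
  have main : r * (D * (B - r) - r * (r - B) ^+ 2 / 2) <= r * (A + e).
    move: FyE; rewrite bE => FyE; move: Hlow Hgrad; rewrite FxE.
    have : (D + r * (r - B)) ^+ 2 / 2 = D ^+ 2 / 2 - r * (D * (B - r) - r * (r - B) ^+ 2 / 2).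
      by field.
    lra.
  move: main; rewrite ler_pM2l// => main.
  have rB2 : (r - B) ^+ 2 <= B ^+ 2.
    by rewrite -[leLHS]sqrrN opprB ler_sqr ?nnegrE; lra.
  have : D * B <= A + 2 * e.
    have : r * (r - B) ^+ 2 <= r * B ^+ 2 by rewrite ler_pM2l.
    have : 0 <= r * B ^+ 2 by rewrite mulr_ge0 ?sqr_ge0// ltW.
    lra.
  by rewrite ler_pdivrMr.
rewrite leNgt; apply/negP => HlD.
pose M := 2 * (A + 2 * h x + 2).
have M0 : 0 < M by rewrite /M; lra.
(* With this [e] the error terms of [key] amount to at most half of the supposed gap
   [D - h x * A]. *)
pose e := Num.min 1 ((D - h x * A) / M).
have e0 : 0 < e by rewrite lt_min ltr01 divr_gt0// subr_gt0.
have e1 : e <= 1 by rewrite ge_min lexx.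
have eM : e * M <= D - h x * A by rewrite -ler_pdivlMr// ge_min lexx orbT.
have := key e e0 e1.
have : e * e <= e by rewrite ler_piMl// ltW.
have : 0 < e * (A + 2 * h x + 2) by rewrite mulr_gt0//; lra.
move: eM; rewrite /M; nra.
Qed.

(** The points of [A] at finite distance from [x] form a relatively clopen set: near [u] the
    function [h] exceeds h(u) / 2, so short segments there have finite length. *)
Lemma dist_g_lt_pinfty (A : set 'rV[R]_2) x y : open A -> connected A ->
  A `<=` Omega -> (forall u, A u -> 0 < h u) -> (forall u, A u -> {for u, continuous h}) ->
  A x -> A y -> (dist_g Omega h x y < +oo)%E.
Proof.
move=> oA cA AO hpos hc Ax Ay.
pose B := A `&` [set u | (dist_g Omega h x u < +oo)%E].
have loc u : A u -> \forall v \near u, A v /\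
    ((dist_g Omega h x u < +oo)%E <-> (dist_g Omega h x v < +oo)%E).
  move=> Au.
  have h2 : 0 < h u / 2 by rewrite divr_gt0// hpos.
  have : \forall v \near u, `|h u - h v| < h u / 2 by move/cvgrPdist_lt : (hc u Au); apply.
  move=> /(filterI (open_nbhs_nbhs (conj oA Au))) /nbhs_normP[d /= d0 H].
  have good v w : `|u - v| < d -> `|u - w| < d ->
      (dist_g Omega h x v < +oo)%E -> (dist_g Omega h x w < +oo)%E.
    move=> uv uw fin; apply: le_lt_trans.
      apply: (@dist_g_triangle_seg _ _ _ x v w (h u / 2)) => // t /andP[t0 t1].
      have [|/AO Ot] := H (v + t *: (w - v)).
        rewrite /ball_/=; have -> : u - (v + t *: (w - v)) = (1 - t) *: (u - v) + t *: (u - w).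
          by apply: rV2P; rewrite !mxE; ring.
        apply: le_lt_trans (ler_normD _ _) _; rewrite !normrZ !ger0_norm ?subr_ge0//.
        have [->|tn] := eqVneq t 0; first by rewrite subr0 mul1r mul0r addr0.
        have tpos : 0 < t by rewrite lt_neqAle eq_sym tn.
        have : t * `|u - w| < t * d by rewrite ltr_pM2l.
        have : (1 - t) * `|u - v| <= (1 - t) * d by rewrite ler_wpM2l ?subr_ge0// ltW.
        lra.
      by rewrite ltr_norml => h3; split => //; lra.
    by rewrite lte_add_pinfty// ltry.
  apply/nbhs_normP; exists d => // v /= uv.
  have [Av _] := H _ uv; split => //.
  by split; apply: good; rewrite // subrr normr0.
suff : B = A by move=> BA; have [] : B y by rewrite BA.
apply: cA.
- exists x; split => //=; rewrite dist_g_refl ?ltry//; first exact: AO.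
  by rewrite gt_eqF// hpos.
- exists B; last by rewrite setIA setIid.
  rewrite openE => u [Au ufin]; have := loc u Au; apply: filterS => v [Av H].
  by split => //; apply/H.
- exists (~` (A `\` B)); last first.
    by apply/seteqP; split => u /=; rewrite /B /=; [tauto|move=> [Au /not_andP[//|/contrapT]]].
  rewrite closedC openE => u [Au nB]; have := loc u Au; apply: filterS => v [Av H].
  by split => // -[_ /H]; move=> ?; apply: nB.
Qed.

End MetricGeometry.

(** * Plane topology *)

Lemma nbhs_norm_lt (R : realType) (V : normedModType R) (x : V) (e : R) : 0 < e ->
  nbhs x [set y | `|x - y| < e].
Proof. by move=> e0; apply/nbhs_normP; exists e. Qed.

Lemma nbhs_norm_ex (R : realType) (V : normedModType R) (x : V) (A : set V) :
  nbhs x A -> exists2 e : R, 0 < e & forall y, `|x - y| < e -> A y.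
Proof. by move=> /nbhs_normP[e e0 H]; exists e. Qed.

Section PlaneTopology.
Variable R : realType.
Implicit Types (x y z u v : 'rV[R]_2) (A D O K S : set 'rV[R]_2) (c : R -> 'rV[R]_2).

Definition seg x y (t : R) := x + t *: (y - x).

Lemma seg0 x y : seg x y 0 = x.
Proof. by rewrite /seg scale0r addr0. Qed.

Lemma seg1 x y : seg x y 1 = y.
Proof. by rewrite /seg scale1r addrC subrK. Qed.

Lemma seg_continuous x y : continuous (seg x y).
Proof.
move=> t; apply: cvgD; first exact: cvg_cst.
by apply: (@cvgZ _ _ _ _ _ id (fun=> y - x)); [exact: cvg_id|exact: cvg_cst].
Qed.

Lemma homothety_continuous (a : R) x : continuous (fun y => x + a *: (y - x)).
Proof.
move=> y; apply: (@cvgD _ _ _ (nbhs y) _ (fun=> x) (fun y => a *: (y - x))); first exact: cvg_cst.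
apply: (@cvgZ _ _ _ _ _ (fun=> a) (fun y => y - x)); first exact: cvg_cst.
by apply: (@cvgB _ _ _ _ _ id (fun=> x)); [exact: cvg_id|exact: cvg_cst].
Qed.

Lemma image_connected c (I : interval R) : continuous c -> connected (c @` [set` I]).
Proof.
move=> cc; apply: connected_continuous_connected; last exact: continuous_subspaceT.
by apply/connected_intervalP; exact: interval_is_interval.
Qed.

Lemma seg_norm_lt x y z (e t : R) : `|z - x| < e -> `|z - y| < e -> 0 <= t <= 1 ->
  `|z - seg x y t| < e.
Proof.
move=> zx zy /andP[t0 t1].
have -> : z - seg x y t = (1 - t) *: (z - x) + t *: (z - y).
  by apply: rV2P; rewrite !mxE; ring.
apply: le_lt_trans (ler_normD _ _) _; rewrite !normrZ !ger0_norm ?subr_ge0//.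
have [->|tn] := eqVneq t 0; first by rewrite subr0 mul1r mul0r addr0.
have tpos : 0 < t by rewrite lt_neqAle eq_sym tn.
have : t * `|z - y| < t * e by rewrite ltr_pM2l.
have : (1 - t) * `|z - x| <= (1 - t) * e by rewrite ler_wpM2l ?subr_ge0// ltW.
lra.
Qed.

Lemma convex_segP D : convex_set D <->
  forall x y t, D x -> D y -> 0 <= t <= 1 -> D (seg x y t).
Proof.
split=> [cD x y t Dx Dy t01|H x y l /set_mem Dx /set_mem Dy].
  have := cD y x (Itv01 (andP t01).1 (andP t01).2) (mem_set Dy) (mem_set Dx).
  move=> /set_mem; congr D; rewrite /seg /conv /=.
  by apply: rV2P; rewrite !mxE /= /unstable.onem; ring.
apply/mem_set; have := H y x l%:num Dy Dx _; rewrite /seg /conv /=.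
have -> : 0 <= l%:num <= 1 by apply/andP; split.
move=> /(_ isT); congr D; by apply: rV2P; rewrite !mxE /= /unstable.onem; ring.
Qed.

Lemma first_hit c S (a b : R) : continuous c -> closed S -> a <= b ->
  (exists2 t, a <= t <= b & S (c t)) ->
  exists tau, [/\ a <= tau <= b, S (c tau) & forall t, a <= t < tau -> ~ S (c t)].
Proof.
move=> cc cS ab [t0 t0ab St0].
pose B := [set t | a <= t <= b /\ S (c t)].
have hB : has_inf B.
  by split; [exists t0|exists a => t [/andP[]]].
pose tau := inf B.
have atau : a <= tau.
  apply: lb_le_inf => [|t [/andP[]]//]; by exists t0.
have taut0 : tau <= t0 by apply: inf_lbound; [exact: hB.2|].
exists tau; split; first by rewrite atau/=; move: t0ab; lra.
- apply: contrapT => nS.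
  have : \forall t \near tau, ~ S (c t).
    have oS : open (~` S) by rewrite openC.
    by have := cc tau (~` S); apply; apply: open_nbhs_nbhs.
  move=> /nbhs_normP[e /= e0 He].
  have [t [tab St] te] := inf_adherent e0 hB.
  have Bt : B t by [].
  apply: (He t) St; rewrite /ball_/= distrC ger0_norm; last first.
    by rewrite subr_ge0; apply: inf_lbound; [exact: hB.2|].
  by move: te; rewrite -/tau; lra.
- move=> t /andP[ta tt] St; have : tau <= t.
    apply: inf_lbound; [exact: hB.2|split => //]; rewrite ta/=; move: t0ab; lra.
  lra.
Qed.

(** Otherwise the path would already be in [G], hence in [S], slightly before [tau]. This places
    first hitting points on the boundary. *)
Lemma first_hit_notin c (G S : set 'rV[R]_2) (a tau : R) : continuous c -> open G ->
  G `<=` S -> a < tau -> (forall t, a <= t < tau -> ~ S (c t)) -> ~ G (c tau).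
Proof.
move=> cc oG GS atau before Gt.
have : \forall t \near tau, G (c t).
  by have := cc tau G; apply; exact: (open_nbhs_nbhs (conj oG Gt)).
move=> /nbhs_norm_ex[d d0 Hd].
pose t := Num.max a (tau - d / 2).
have t0 : a <= t by rewrite le_max lexx.
have tt : t < tau by rewrite gt_max atau/=; lra.
apply: (before t); rewrite ?t0 ?tt//; apply/GS/Hd.
rewrite ger0_norm ?subr_ge0 ?(ltW tt)//.
have : tau - d / 2 <= t by rewrite le_max lexx orbT.
lra.
Qed.

Lemma compact_thickening K O : compact K -> open O -> K `<=` O ->
  exists2 e : R, 0 < e & forall k x, K k -> `|k - x| < e -> O x.
Proof.
move=> /compact_near_coveringP cK oO KO.
have := cK R (0^'+ : set_system R) (fun e k => forall x, `|k - x| < e -> O x) _ _.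
case.
  move=> k Kk.
  have /nbhs_normP[e /= e0 He] : nbhs k O by apply: open_nbhs_nbhs; split => //; exact: KO.
  have e2 : 0 < e / 2 by rewrite divr_gt0.
  exists ([set k' | `|k - k'| < e / 2], [set e' | e' < e / 2]).
    split=> /=; first exact: nbhs_norm_lt.
    exact: nbhs_right_lt.
  move=> [k' e'] /= [k'e e'e] x xk'; apply: He; rewrite /ball_/=.
  have -> : k - x = (k - k') + (k' - x) by rewrite addrA subrK.
  apply: le_lt_trans (ler_normD _ _) _; move: k'e (lt_trans xk' e'e); lra.
move=> e /= e0 He; exists (e / 2); first by rewrite divr_gt0.
move=> k x Kk kx; apply: (He (e / 2)) kx => //=; rewrite ?divr_gt0//.
by rewrite sub0r normrN ger0_norm ?divr_ge0 ?ltW// ltr_pdivrMr//; lra.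
Qed.

Lemma open_convex_closure D x y t : open D -> convex_set D -> D x -> closure D y ->
  0 <= t < 1 -> D (seg x y t).
Proof.
move=> oD /convex_segP cD Dx cDy /andP[t0 t1].
have /nbhs_normP[e /= e0 He] : nbhs x D by apply: open_nbhs_nbhs.
(* pick y' in D close to y and correct x *)
have t1' : 0 < 1 - t by rewrite subr_gt0.
have d0 : 0 < e * (1 - t) by rewrite mulr_gt0.
have [y' [Dy' yy']] : D `&` [set y' | `|y - y'| < e * (1 - t)] !=set0.
  by apply: cDy; exact: nbhs_norm_lt.
pose x' := x + (t / (1 - t)) *: (y - y').
have Dx' : D x'.
  apply: He; rewrite /ball_/= /x' opprD addrA subrr add0r normrN normrZ.
  rewrite ger0_norm ?divr_ge0 ?(ltW t1')// mulrAC ltr_pdivrMr//.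
  by apply: le_lt_trans yy'; rewrite ler_piMl// ltW.
have -> : seg x y t = seg x' y' t.
  by apply: rV2P; rewrite !mxE; field; rewrite gt_eqF.
by apply: cD; rewrite // t0 ltW.
Qed.

End PlaneTopology.

(** * Closed curves modulo their period *)

Section Curves.
Variable R : realType.
Implicit Types (c : R -> 'rV[R]_2).

Lemma smooth_curve_continuous c : smooth_closed_curve c -> continuous c.
Proof.
move=> [cs _ _ _] t; have := cs t 0%N => /= /nbhs_singleton. exact.
Qed.

Lemma periodic_int c : (forall t, c (t + 1) = c t) -> forall (t : R) (k : int), c (t + k%:~R) = c t.
Proof.
move=> cp t k.
have H : forall (n : nat) t, c (t + n%:R) = c t.
  elim=> [|n IH] s; first by rewrite addr0.
  by rewrite -natr1 addrA cp IH.
case: k => n; first exact: H.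
by rewrite NegzE -[in RHS](subrK n.+1%:R t) H mulrNz.
Qed.

(** Uniform injectivity modulo the period, by compactness: [c (t + w) - c t] does not vanish for [t]
    in [0, 1] and [w] in [d, 1 - d], so its norm has a positive lower bound. For d > 1/2 it suffices
    that every real is within 1/2 of an integer. *)
Lemma curve_inj_mod c (d : R) : smooth_closed_curve c -> 0 < d ->
  exists2 eta, 0 < eta & forall u v, `|c u - c v| < eta ->
    exists k : int, `|u - v - k%:~R| < d.
Proof.
move=> sc d0; have cc := smooth_curve_continuous sc.
have [_ _ cp ci] := sc.
have [d2|d2] := ltP (2^-1) d.
  exists 1 => // u v _; exists (Num.floor (u - v + 2^-1)).
  have /andP[] := floor_itv (u - v + 2^-1); rewrite intrD.
  by rewrite ltr_norml; lra.
pose E := (`[0, 1] `*` `[d, 1 - d])%classic : set (R * R)%type.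
pose F (z : R * R) := c (z.1 + z.2) - c z.1.
have cF : continuous F.
  move=> z; apply: cvgB.
    apply: (@continuous_cvg _ _ _ (nbhs z) _ (fun z : R * R => z.1 + z.2) c); first exact: cc.
    by apply: cvgD; [exact: cvg_fst|exact: cvg_snd].
  apply: (@continuous_cvg _ _ _ (nbhs z) _ (fun z : R * R => z.1) c); first exact: cc.
  exact: cvg_fst.
have KE : compact (F @` E).
  apply: continuous_compact; first exact: continuous_subspaceT.
  by apply: compact_setX; exact: segment_compact.
have nz z : E z -> F z != 0.
  move=> [/=]; rewrite !in_itv/= => /andP[z0 z1] /andP[w0 w1].
  apply/eqP => /subr0_eq F0.
  have key a b : 0 <= a < 1 -> 0 <= b < 1 -> c a = c b -> a = b.
    by move=> a1 b1; apply: ci; rewrite in_itv/=.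
  have /andP[m0 m1] := floor_itv z.1.
  set m := Num.floor z.1 in m0 m1.
  have a01 : 0 <= z.1 - m%:~R < 1 by move: m1; rewrite intrD; lra.
  have Ea : c (z.1 - m%:~R) = c z.1 by rewrite -mulrNz periodic_int.
  set a := z.1 - m%:~R in a01 Ea.
  have Eb : c (a + z.2) = c a.
    by rewrite Ea -F0 /a addrAC -mulrNz periodic_int.
  have [aw|aw] := ltP (a + z.2) 1.
    have : a + z.2 = a by apply: key => //; move: a01; lra.
    lra.
  have : a + z.2 - 1 = a.
    apply: key => //; first by move: a01; lra.
    by rewrite -cp subrK.
  lra.
have o0 : open (~` [set (0 : 'rV[R]_2)]).
  rewrite openC; apply: compact_closed; first exact: norm_hausdorff.
  exact: compact_set1.
have K0 : F @` E `<=` ~` [set 0] by move=> _ [z Ez <-] /eqP; apply/negP; exact: nz.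
have [e e0 He] := compact_thickening KE o0 K0.
have He' z : E z -> e <= `|F z|.
  move=> Ez; rewrite leNgt; apply/negP => Fe.
  have FzE : (F @` E) (F z) by exists z.
  by apply: (He (F z) 0 FzE) => //; rewrite subr0.
exists e => // u v uv.
have /andP[m0 m1] := floor_itv v; set m := Num.floor v in m0 m1.
have /andP[k0 k1] := floor_itv (u - v); set k := Num.floor (u - v) in k0 k1.
rewrite !intrD in m1 k1.
have [w0|w0] := ltP (u - v - k%:~R) d.
  by exists k; rewrite ltr_norml; lra.
have [w1|w1] := ltP (1 - d) (u - v - k%:~R).
  by exists (k + 1); rewrite intrD ltr_norml; lra.
exfalso; move: uv; apply/negP; rewrite -leNgt.
have := He' (v - m%:~R, u - v - k%:~R); rewrite /E /F /= !in_itv/=.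
have -> : v - m%:~R + (u - v - k%:~R) = u + (- m - k)%:~R by rewrite intrD !mulrNz; ring.
rewrite -!mulrNz !periodic_int//; apply; split; lra.
Qed.

End Curves.

(** * The annular region *)

(** The data of [annular_region] with the two enclosed domains as parameters, so that they can be
    fixed throughout a section. *)
Definition annulus (R : realType) (cin cout : R -> 'rV[R]_2)
    (Din Dout Omega : set 'rV[R]_2) : Prop :=
  [/\ smooth_closed_curve cin /\ smooth_closed_curve cout,
      encloses cin Din /\ convex_set Din,
      encloses cout Dout /\ star_shaped Dout,
      closure Din `<=` Dout & Omega = closure Dout `\` Din].

Section Annulus.
Variables (R : realType) (cin cout : R -> 'rV[R]_2) (Din Dout Omega : set 'rV[R]_2).
Hypothesis ann : annulus cin cout Din Dout Omega.

Let scin : smooth_closed_curve cin. Proof. by case: ann => -[]. Qed.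
Let scout : smooth_closed_curve cout. Proof. by case: ann => -[]. Qed.
Let ein : encloses cin Din. Proof. by case: ann => _ []. Qed.
Let cvxin : convex_set Din. Proof. by case: ann => _ []. Qed.
Let eout : encloses cout Dout. Proof. by case: ann => _ _ []. Qed.
Let star : star_shaped Dout. Proof. by case: ann => _ _ []. Qed.
Let inout : closure Din `<=` Dout. Proof. by case: ann. Qed.
Let OmegaE : Omega = closure Dout `\` Din. Proof. by case: ann. Qed.

Implicit Types (x y z : 'rV[R]_2).

Lemma boundary_openE (D : set 'rV[R]_2) : open D -> boundary D = closure D `\` D.
Proof. by move=> /interior_id oD; rewrite /boundary oD. Qed.

Lemma open_Din : open Din. Proof. by case: ein. Qed.
Lemma open_Dout : open Dout. Proof. by case: eout. Qed.

Lemma curve_in t : closure Din (cin t) /\ ~ Din (cin t).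
Proof.
have [oD _ _ bD] := ein.
have : boundary Din (cin t) by rewrite bD; exists t.
by rewrite boundary_openE.
Qed.

Lemma curve_out t : closure Dout (cout t) /\ ~ Dout (cout t).
Proof.
have [oD _ _ bD] := eout.
have : boundary Dout (cout t) by rewrite bD; exists t.
by rewrite boundary_openE.
Qed.

Lemma range_cin x : closure Din x -> ~ Din x -> exists t, x = cin t.
Proof.
have [oD _ _ bD] := ein => cx nx.
have : boundary Din x by rewrite boundary_openE.
by rewrite bD => -[t _ <-]; exists t.
Qed.

Lemma range_cout x : closure Dout x -> ~ Dout x -> exists t, x = cout t.
Proof.
have [oD _ _ bD] := eout => cx nx.
have : boundary Dout x by rewrite boundary_openE.
by rewrite bD => -[t _ <-]; exists t.
Qed.

Lemma Din_neq0 : Din !=set0.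
Proof.
have [+ _] := curve_in 0; move=> /(_ setT filterT)[x [Dx _]].
by exists x.
Qed.

Lemma Omega_closed : closed Omega.
Proof. rewrite OmegaE setDE; apply: closedI; [exact: closed_closure|by rewrite closedC; exact: open_Din]. Qed.

Lemma closure_bounded_compact (D : set 'rV[R]_2) : bounded_set D -> compact (closure D).
Proof.
move=> bD; apply: bounded_closed_compact; last exact: closed_closure.
have [M [Mr HM]] := bD; exists M; split => // N MN x cx.
rewrite /= leNgt; apply/negP => Nx.
have [y [Dy xy]] : D `&` [set y | `|x - y| < `|x| - N] !=set0.
  by apply: cx; apply: nbhs_norm_lt; rewrite subr_gt0.
have := HM _ MN y Dy; have := ler_normD (x - y) y; rewrite subrK; move: xy => /=; lra.
Qed.

Lemma Din_compact : compact (closure Din).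
Proof. by apply: closure_bounded_compact; case: ein. Qed.

Lemma Omega_compact : compact Omega.
Proof.
apply: (@subclosed_compact _ _ (closure Dout)); first exact: Omega_closed.
  by apply: closure_bounded_compact; case: eout.
by rewrite OmegaE => x [].
Qed.

Lemma sub_Omega_int : Dout `\` closure Din `<=` Omega°.
Proof.
have oA : open (Dout `\` closure Din).
  by rewrite setDE; apply: openI; [exact: open_Dout|rewrite openC; exact: closed_closure].
move=> x Ax; apply: filterS (open_nbhs_nbhs (conj oA Ax)) => y [Dy nDy].
by rewrite OmegaE; split; [exact: subset_closure|move=> /subset_closure].
Qed.

Lemma Omega_int_notin x : Omega° x -> ~ closure Din x.
Proof.
move=> Ox cx; have [y [Dy]] := cx _ Ox.
by rewrite OmegaE => -[].
Qed.

Lemma cin_Omega t : Omega (cin t).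
Proof.
have [h1 h2] := curve_in t; rewrite OmegaE; split => //.
by apply: subset_closure; exact: inout.
Qed.

Lemma cout_Omega t : Omega (cout t).
Proof.
have [h1 h2] := curve_out t; rewrite OmegaE; split => //.
by move=> /subset_closure /inout.
Qed.

Lemma Omega_notint x : Omega x -> ~ Omega° x ->
  (exists t, x = cin t) \/ (exists t, x = cout t).
Proof.
rewrite {1}OmegaE => -[cx nDx] nint.
have [Dx|nDox] := pselect (Dout x); last by right; exact: range_cout.
left; apply: range_cin => //; apply: contrapT => ncx.
by apply: nint; exact: sub_Omega_int.
Qed.

Lemma seg_int_connected x y : (forall t, 0 <= t <= 1 -> Omega° (seg x y t)) ->
  connected_component Omega° x y.
Proof.
move=> H; apply: (@connected_component_max _ _ (seg x y @` `[0, 1])).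
- by exists 0; [rewrite /= in_itv/= lexx ler01|exact: seg0].
- by move=> _ [t t01 <-]; apply: H; move: t01; rewrite /= in_itv.
- by apply: image_connected; exact: seg_continuous.
- by exists 1; [rewrite /= in_itv/= lexx ler01|exact: seg1].
Qed.

(** Whether [Omega°] meets the outer curve is left open: a nearby point of [Dout], joined to [x] by
    a segment in a ball, takes the place of [x]. *)
Lemma Omega_int_near x : Omega° x -> exists2 y, (Dout `\` closure Din) y & connected_component Omega° x y.
Proof.
move=> Ox; have oO : open Omega° by exact: open_interior.
have oC : open (~` closure Din) by rewrite openC; exact: closed_closure.
have /nbhs_norm_ex[e e0 He] : nbhs x (Omega° `&` ~` closure Din).
  by apply: open_nbhs_nbhs; split; [exact: openI|split => //; exact: Omega_int_notin].
have cx : closure Dout x by move/interior_subset: Ox; rewrite OmegaE => -[].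
have [y [Dy xy]] : Dout `&` [set y | `|x - y| < e] !=set0 by apply: cx; exact: nbhs_norm_lt.
exists y; first by split => //; have [] := He y xy.
apply: seg_int_connected => t t01; have [] // := He (seg x y t).
by apply: seg_norm_lt; rewrite // subrr normr0.
Qed.

(** This makes the distance between interior points finite. Each point moves along the segment to
    the star centre [z], and from there to a point [p0] of the hole if necessary, until it first
    meets an enlarged hole. The connected curve bounding that enlargement joins the two meeting
    points. *)
Lemma Omega_int_connected : connected Omega°.
Proof.
have [p0 Dp0] := Din_neq0.
have [z Dz starz] := star.
pose P0 := Dout `\` closure Din.
have oP0 : open P0.
  by rewrite /P0 setDE; apply: openI; [exact: open_Dout|rewrite openC; exact: closed_closure].
(* Points of P0 are joined by going around a slightly enlarged copy of the hole *)
have key x y : P0 x -> P0 y -> connected_component Omega° x y.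
  move=> [Dx nx] [Dy ny].
  have oO : open (Dout `\` [set x; y]).
    rewrite setDE; apply: openI; first exact: open_Dout.
    rewrite openC; apply: compact_closed; first exact: norm_hausdorff.
    by apply: compactU; exact: compact_set1.
  have KO : closure Din `<=` Dout `\` [set x; y].
    by move=> k ck; split; [exact: inout|move=> [E|E]; rewrite E in ck].
  have [e e0 He] := compact_thickening Din_compact oO KO.
  have [M M0 HM] : exists2 M : R, 0 < M & forall k : 'rV[R]_2, closure Din k -> `|k - p0| <= M.
    have [M0 [M0r HM0]] := compact_bounded Din_compact.
    exists (`|M0| + 1 + `|p0|); first by have := normr_ge0 M0; have := normr_ge0 p0; lra.
    move=> k ck; apply: le_trans (ler_normB _ _) _; rewrite lerD2r.
    by apply: (HM0 (`|M0| + 1)) => //; rewrite (le_lt_trans (ler_norm _))// ltrDl.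
  (* The homothety of ratio 1 + eps about [p0] moves the points of [closure Din] by at most e / 2,
     so the enlarged hole stays in [Dout] and misses both [x] and [y]. *)
  pose eps := e / (2 * M).
  have eps0 : 0 < eps by rewrite divr_gt0// mulr_gt0.
  have epsM : eps * M = e / 2 by rewrite /eps; field; rewrite gt_eqF.
  pose l := 1 + eps.
  have l1 : 1 < l by rewrite ltrDl.
  have l0 : 0 < l by lra.
  pose f (k : 'rV[R]_2) : 'rV[R]_2 := p0 + l *: (k - p0).
  pose g (k : 'rV[R]_2) : 'rV[R]_2 := p0 + l^-1 *: (k - p0).
  have gK k : f (g k) = k.
    by rewrite /f /g addrAC subrr add0r scalerA mulfV ?gt_eqF// scale1r addrC subrK.
  have fK k : g (f k) = k.
    by rewrite /f /g addrAC subrr add0r scalerA mulVf ?gt_eqF// scale1r addrC subrK.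
  have fO k : closure Din k -> (Dout `\` [set x; y]) (f k).
    move=> ck; apply: (He k _ ck); rewrite /f.
    have -> : k - (p0 + l *: (k - p0)) = (- eps) *: (k - p0).
      by apply: rV2P; rewrite !mxE /l; ring.
    rewrite normrZ normrN gtr0_norm//.
    have : eps * `|k - p0| <= eps * M by rewrite ler_pM2l//; apply: HM.
    lra.
  pose S := [set w | closure Din (g w)].
  have gc : continuous g by exact: homothety_continuous.
  have cS : closed S by apply: closed_comp; [move=> w _; exact: gc|exact: closed_closure].
  have KS k : closure Din k -> S k.
    move=> ck; rewrite /S /=; have [->|kn] := eqVneq k p0.
      by rewrite /g subrr scaler0 addr0; exact: subset_closure.
    apply: subset_closure; apply: (open_convex_closure open_Din cvxin Dp0 ck).
    by rewrite invr_ge0 (ltW l0)/= invf_lt1.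
  have nSx : ~ S x by move=> /fO; rewrite gK => -[_]; apply; left.
  have nSy : ~ S y by move=> /fO; rewrite gK => -[_]; apply; right.
  have SD w : S w -> Dout w by move=> /fO; rewrite gK => -[].
  pose C := f @` range cin.
  have CP0 w : C w -> P0 w.
    move=> [_ [t _ <-] <-]; have [c1 c2] := curve_in t; split; first by have [] := fO _ c1.
    move=> cf; apply: c2; rewrite -(fK (cin t)).
    apply: (open_convex_closure open_Din cvxin Dp0 cf).
    by rewrite invr_ge0 (ltW l0)/= invf_lt1.
  have Cconn : connected C.
    have -> : C = (f \o cin) @` [set` `]-oo, +oo[] by rewrite set_itvE -image_comp.
    apply: image_connected => t.
    apply: continuous_comp; first exact: smooth_curve_continuous.
    exact: homothety_continuous.
  have CC w w' : C w -> C w' -> connected_component Omega° w w'.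
    move=> Cw Cw'; apply: (@connected_component_max _ _ C) => //.
    by move=> v /CP0 /sub_Omega_int.
  have P0conn u v : (forall t, 0 <= t <= 1 -> P0 (seg u v t)) -> connected_component Omega° u v.
    by move=> H; apply: seg_int_connected => t /H /sub_Omega_int.
  (* the first point of S on a segment of Dout starting outside S lies on C *)
  have hit u v : ~ S u -> (forall t, 0 <= t <= 1 -> Dout (seg u v t)) ->
      (exists2 t, 0 <= t <= 1 & S (seg u v t)) ->
      exists2 w, C w & connected_component Omega° u w.
    move=> nSu uvD hits.
    have [tau [/andP[tau0 tau1] Stau before]] := first_hit (@seg_continuous R u v) cS ler01 hits.
    have tau_gt0 : 0 < tau.
      rewrite lt_neqAle tau0 andbT; apply/negP => /eqP E; apply: nSu.
      by rewrite -(seg0 u v) E; exact: Stau.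
    have [s E] : exists s, g (seg u v tau) = cin s.
      apply: (range_cin Stau).
      have oG : open (g @^-1` Din).
        by apply: open_comp; [move=> w _; exact: gc|exact: open_Din].
      have GS : g @^-1` Din `<=` S by move=> w Dw; exact: (@subset_closure _ Din).
      exact: (first_hit_notin (@seg_continuous R u v) oG GS tau_gt0 before).
    have Cw : C (seg u v tau) by exists (cin s); [exists s|rewrite -E gK].
    exists (seg u v tau); first exact: Cw.
    have CPt := CP0 _ Cw.
    apply: P0conn => t /andP[t0 t1].
    have -> : seg u (seg u v tau) t = seg u v (t * tau).
      by apply: rV2P; rewrite !mxE; ring.
    have ttau : t * tau <= tau by rewrite ler_piMl// ltW.
    have tt0 : 0 <= t * tau by rewrite mulr_ge0.
    have [tE|tE] := eqVneq (t * tau) tau; first by rewrite tE; exact: CPt.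
    have tt1 : 0 <= t * tau < tau by rewrite tt0 lt_neqAle tE ttau.
    have tt2 : 0 <= t * tau <= 1 by rewrite tt0 (le_trans ttau tau1).
    split; first exact: uvD.
    by move=> ck; apply: (before _ tt1); exact: KS.
  have toC u : Dout u -> ~ S u -> exists2 w, C w & connected_component Omega° u w.
    move=> Du nSu.
    have uzD t : 0 <= t <= 1 -> Dout (seg u z t).
      move=> t01; have := starz u Du (1 - t); rewrite (_ : z + _ = seg u z t).
        by apply; lra.
      by apply: rV2P; rewrite !mxE; ring.
    have [hits|nohit] := pselect (exists2 t, 0 <= t <= 1 & S (seg u z t)); first exact: (hit u z).
    have nS t : 0 <= t <= 1 -> ~ S (seg u z t) by move=> t01 St; apply: nohit; exists t.
    have uz : connected_component Omega° u z.
      by apply: P0conn => t t01; split; [exact: uzD|move=> /KS; exact: nS].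
    have nSz : ~ S z by rewrite -(seg1 u z); apply: nS; rewrite ler01 lexx.
    have [|||w Cw zw] := hit z p0.
    - exact: nSz.
    - move=> t t01; apply: starz => //; apply: inout; exact: subset_closure.
    - by exists 1; rewrite ?ler01 ?lexx// seg1; apply: KS; exact: subset_closure.
    by exists w => //; apply: connected_component_trans zw.
  have [w Cw xw] := toC x Dx nSx; have [w' Cw' yw'] := toC y Dy nSy.
  apply: (connected_component_trans xw); apply: connected_component_trans (CC _ _ Cw Cw') _.
  exact: connected_component_sym.
have [->|/set0P[x0 Ox0]] := eqVneq Omega° set0; first exact: connected0.
have -> : Omega° = connected_component Omega° x0.
  apply/seteqP; split; last exact: connected_component_sub.
  move=> y Oy; have [x' Px' xx'] := Omega_int_near Ox0; have [y' Py' yy'] := Omega_int_near Oy.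
  apply: (connected_component_trans xx').
  apply: connected_component_trans (key _ _ Px' Py') _.
  exact: connected_component_sym.
exact: component_connected.
Qed.

(** By uniform injectivity a point of the curve close to [c u] has a parameter close to [u] up to a
    period, so a short arc joins the two. *)
Lemma curve_arc_connected (c : R -> 'rV[R]_2) (u e : R) : smooth_closed_curve c -> 0 < e ->
  exists2 d : R, 0 < d & forall t, `|c u - c t| < d ->
    exists C, [/\ connected C, C (c t), C (c u), C `<=` range c &
      C `<=` [set y | `|c u - y| < e]].
Proof.
move=> sc e0; have cc := smooth_curve_continuous sc; have [_ _ cp _] := sc.
have /nbhs_norm_ex[r r0 Hr] : \forall t \near u, `|c u - c t| < e.
  by have := cc u; move/cvgrPdist_lt; apply.
have [d d0 Hd] := curve_inj_mod sc r0.
exists d => // t /Hd[k]; rewrite distrC opprB addrCA -opprB => tk.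
exists (c @` [set` `]u - r, u + r[]); split.
- exact: image_connected.
- exists (t + k%:~R); last exact: periodic_int.
  by rewrite /= in_itv/=; move: tk; rewrite ltr_norml; lra.
- by exists u => //=; rewrite in_itv/=; lra.
- by move=> _ [v _ <-]; exists v.
- move=> _ [v /= + <-]; rewrite in_itv/= => uv; apply: Hr.
  by rewrite ltr_norml; lra.
Qed.

(** Follow the segment towards [y] until it leaves [Omega°], then the boundary arc. Connected
    components of [Omega] minus the bars are therefore relatively open in [Omega], boundary points
    included. *)
Lemma Omega_locally_connected y (e : R) : Omega y -> 0 < e ->
  exists2 d : R, 0 < d & forall x, Omega x -> `|y - x| < d ->
    exists C, [/\ connected C, C x, C y, C `<=` Omega & C `<=` [set w | `|y - w| < e]].
Proof.
move=> Oy e0.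
have seg_ok x w (r : R) : `|y - x| < r -> `|y - w| < r -> (forall t, 0 <= t <= 1 -> Omega (seg x w t)) ->
    exists C, [/\ connected C, C x, C w, C `<=` Omega & C `<=` [set z | `|y - z| < r]].
  move=> yx yw H; exists (seg x w @` `[0, 1]); split.
  - by apply: image_connected; exact: seg_continuous.
  - by exists 0; [rewrite /= in_itv/= lexx ler01|exact: seg0].
  - by exists 1; [rewrite /= in_itv/= lexx ler01|exact: seg1].
  - by move=> _ [t t01 <-]; apply: H; move: t01; rewrite /= in_itv.
  - by move=> _ [t t01 <-]; apply: seg_norm_lt => //; move: t01; rewrite /= in_itv.
have [Oiy|nOiy] := pselect (Omega° y).
  have /nbhs_norm_ex[d d0 Hd] : nbhs y Omega by [].
  exists (Num.min d e); first by rewrite lt_min d0.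
  move=> x Ox; rewrite lt_min => /andP[yx1 yx2].
  apply: seg_ok => //; first by rewrite subrr normr0.
  by move=> t t01; apply: Hd; apply: seg_norm_lt; rewrite // subrr normr0.
(* near y the boundary of Omega is an arc through y *)
have [d1 d10 arcs] : exists2 d : R, 0 < d & forall z, Omega z -> ~ Omega° z -> `|y - z| < d ->
    exists C, [/\ connected C, C z, C y, C `<=` Omega & C `<=` [set w | `|y - w| < e]].
  have cinO : range cin `<=` Omega by move=> _ [t _ <-]; exact: cin_Omega.
  have coutO : range cout `<=` Omega by move=> _ [t _ <-]; exact: cout_Omega.
  have [[u E]|[u E]] := Omega_notint Oy nOiy.
    have [d d0 Hd] := curve_arc_connected u scin e0.
    have yD : Dout y by rewrite E; apply: inout; have [] := curve_in u.
    have /nbhs_norm_ex[d' d'0 Hd'] : nbhs y Dout.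
      exact: (open_nbhs_nbhs (conj open_Dout yD)).
    exists (Num.min d d'); first by rewrite lt_min d0.
    move=> z Oz nOz; rewrite lt_min => /andP[z1 z2].
    have [[t Ez]|[t Ez]] := Omega_notint Oz nOz; last first.
      by have [_] := curve_out t; rewrite -Ez => /(_ (Hd' z z2)).
    rewrite E Ez in z1; have [C [C1 C2 C3 C4 C5]] := Hd t z1.
    exists C; rewrite E Ez; split => //; exact: subset_trans C4 _.
  have [d d0 Hd] := curve_arc_connected u scout e0.
  have yD : ~ closure Din y by move=> /inout; rewrite E; have [] := curve_out u.
  have oC : open (~` closure Din) by rewrite openC; exact: closed_closure.
  have /nbhs_norm_ex[d' d'0 Hd'] := open_nbhs_nbhs (conj oC yD).
  exists (Num.min d d'); first by rewrite lt_min d0.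
  move=> z Oz nOz; rewrite lt_min => /andP[z1 z2].
  have [[t Ez]|[t Ez]] := Omega_notint Oz nOz.
    by have := Hd' z z2; rewrite Ez; have [+ _] := curve_in t => /[swap]/[apply].
  rewrite E Ez in z1; have [C [C1 C2 C3 C4 C5]] := Hd t z1.
  exists C; rewrite E Ez; split => //; exact: subset_trans C4 _.
exists (Num.min d1 e); first by rewrite lt_min d10.
move=> x Ox; rewrite lt_min => /andP[yx1 yx2].
have [Oix|nOix] := pselect (Omega° x); last exact: arcs.
have cS : closed (~` Omega°) by rewrite closedC; exact: open_interior.
have hits : exists2 t, 0 <= t <= 1 & (~` Omega°) (seg x y t).
  by exists 1; [rewrite ler01 lexx|rewrite seg1].
have [tau [/andP[tau0 tau1] ntau before]] := first_hit (@seg_continuous R x y) cS ler01 hits.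
have tau_gt0 : 0 < tau.
  rewrite lt_neqAle tau0 andbT; apply/negP => /eqP E.
  by move: ntau; rewrite -E seg0 /=; apply.
have Obefore t : 0 <= t < tau -> Omega (seg x y t).
  by move=> tt; apply: interior_subset; apply: contrapT; exact: before.
have Otau : Omega (seg x y tau).
  apply: contrapT => nO.
  have oG : open (~` Omega) by rewrite openC; exact: Omega_closed.
  have GS : ~` Omega `<=` ~` Omega° by move=> w nw /interior_subset.
  by apply: (first_hit_notin (@seg_continuous R x y) oG GS tau_gt0 before).
have ytau : `|y - seg x y tau| < Num.min d1 e.
  apply: seg_norm_lt; rewrite ?lt_min ?yx1 ?yx2 ?subrr ?normr0 ?d10 ?e0//.
  by rewrite tau0 tau1.
move: ytau; rewrite lt_min => /andP[yt1 yt2].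
have [C [C1 C2 C3 C4 C5]] := arcs _ Otau ntau yt1.
have segO t : 0 <= t <= 1 -> Omega (seg x (seg x y tau) t).
  move=> /andP[t0 t1].
  have -> : seg x (seg x y tau) t = seg x y (t * tau).
    by apply: rV2P; rewrite !mxE; ring.
  have [tE|tE] := eqVneq (t * tau) tau; first by rewrite tE.
  apply: Obefore; rewrite mulr_ge0//= lt_neqAle tE/=.
  by rewrite ler_piMl// ltW.
have [C' [C'1 C'2 C'3 C'4 C'5]] := seg_ok x (seg x y tau) e yx2 yt2 segO.
exists (C' `|` C); split.
- by apply: connectedU => //; exists (seg x y tau).
- by left.
- by right.
- by move=> w [/C'4|/C4].
- by move=> w [/C'5|/C5].
Qed.

End Annulus.

(** * Tangents, normals and bars *)

Section SmoothCurves.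
Variables (R : realType) (c : R -> 'rV[R]_2).
Hypothesis sc : smooth_closed_curve c.

Lemma smooth_curve_is_derive (t : R) : is_derive t 1 c (derive1 c t).
Proof.
have [cs _ _ _] := sc; have [/nbhs_singleton dc _] := cs t 1%N.
by rewrite derive1E; apply: DeriveDef => //; exact: diff_derivable.
Qed.

Let D1E : 'D_1 c = derive1 c.
Proof. by apply/funext => t; rewrite derive1E. Qed.

Lemma smooth_curve_derive1_is_derive (t : R) :
  is_derive t 1 (derive1 c) (derive1 (derive1 c) t).
Proof.
have [cs _ _ _] := sc; have [_ /(_ 1)[+ _]] := cs t 2%N.
rewrite D1E => /nbhs_singleton dc.
by rewrite [X in is_derive _ _ _ X]derive1E; apply: DeriveDef => //; exact: diff_derivable.
Qed.

Lemma smooth_curve_derive1_continuous : continuous (derive1 c).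
Proof.
move=> t; apply: differentiable_continuous; apply/derivable1_diffP.
by case: (smooth_curve_derive1_is_derive t).
Qed.

Lemma smooth_curve_derive2_continuous : continuous (derive1 (derive1 c)).
Proof.
move=> t; have [cs _ _ _] := sc; have [_ /(_ 1)[_ /(_ 1)/= +]] := cs t 2%N.
have D2E : 'D_1 (derive1 c) = derive1 (derive1 c).
  by apply/funext => u; rewrite derive1E.
by rewrite D1E D2E => /nbhs_singleton.
Qed.

Lemma derive1_periodic (t : R) : derive1 c (t + 1) = derive1 c t.
Proof.
have [_ _ cp _] := sc.
by rewrite /derive1; under eq_fun do rewrite addrA !cp.
Qed.

(** The tangent depends only on the point, so [nu] does not depend on the parameter selected by
    [xget]. *)
Lemma derive1_same u v : c u = c v -> derive1 c u = derive1 c v.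
Proof.
move=> cuv; have [_ _ cp ci] := sc.
have key (w : R) : exists2 k : int, 0 <= w + k%:~R < 1 & True.
  exists (- Num.floor w) => //; have /andP[] := floor_itv w.
  by rewrite intrD mulrNz; lra.
have [k k1 _] := key u; have [l l1 _] := key v.
have E : u + k%:~R = v + l%:~R.
  by apply: ci; rewrite ?in_itv// !periodic_int.
have dp : forall (m : int) w, derive1 c (w + m%:~R) = derive1 c w.
  by move=> m w; apply: periodic_int; exact: derive1_periodic.
by rewrite -(dp k) E dp.
Qed.

End SmoothCurves.

Section Normals.
Variables (R : realType) (cin cout : R -> 'rV[R]_2) (Din Dout Omega : set 'rV[R]_2).
Hypothesis ann : annulus cin cout Din Dout Omega.
Implicit Types (x y z q k : 'rV[R]_2) (u v : R).

Let scin : smooth_closed_curve cin. Proof. by case: ann => -[]. Qed.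
Let cvxin : convex_set Din. Proof. by case: ann => _ []. Qed.
Let oDin : open Din. Proof. exact: open_Din ann. Qed.

Notation T := (derive1 cin).

Lemma tangent_neq0 u : T u != 0. Proof. by case: scin. Qed.

Definition perp (w : 'rV[R]_2) : 'rV[R]_2 := \row_j (if j == 0 then w 0 1 else - w 0 0).

Lemma dot_perp w : dot w (perp w) = 0.
Proof. by rewrite dotE !mxE /=; ring. Qed.

Lemma dot_perpE w w' : dot (perp w) (perp w') = dot w w'.
Proof. by rewrite !dotE !mxE /=; ring. Qed.

Lemma perp_basis (w x : 'rV[R]_2) : w != 0 ->
  x = (dot x w / dot w w) *: w + (dot x (perp w) / dot w w) *: perp w.
Proof.
rewrite -dot_eq0 => w0; apply: rV2P; rewrite !mxE /= !dotE !mxE /=;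
 rewrite dotE in w0; field; exact: w0.
Qed.

Lemma nonzero_same_sign (f : R -> R) (a b : R) : continuous f -> a <= b ->
  (forall t, a <= t <= b -> f t != 0) -> (f a < 0) = (f b < 0).
Proof.
move=> cf ab nz.
have cw : {within `[a, b], continuous f} by exact: continuous_subspaceT.
have fa : f a != 0 by apply: nz; rewrite lexx.
have fb : f b != 0 by apply: nz; rewrite lexx andbT.
apply/idP/idP => H; rewrite ltNge; apply/negP => H'.
- have [|t] := @IVT R f a b 0 ab cw.
    by rewrite ge_min le_max (ltW H) H' orbT.
  by rewrite in_itv/= => tab ft; have := nz t tab; rewrite ft eqxx.
- have [|t] := @IVT R f a b 0 ab cw.
    by rewrite ge_min le_max (ltW H) H' orbT.
  by rewrite in_itv/= => tab ft; have := nz t tab; rewrite ft eqxx.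
Qed.

(** A tangent line of the inner curve misses the hole. If [k] lay on it, chords through [cin u]
    prolonged in proportion would end near [k], hence in [Din]; by convexity their points on the
    curve would be in [Din] too. *)
Lemma curve_side u k : Din k -> dot (k - cin u) (perp (T u)) != 0.
Proof.
move=> Dk; apply/eqP => k0.
have [ccu ncu] := curve_in ann u.
have Tn := tangent_neq0 u; have TT : dot (T u) (T u) != 0 by rewrite dot_eq0.
set a := dot (k - cin u) (T u) / dot (T u) (T u).
have kE : k - cin u = a *: T u.
  by rewrite (perp_basis (k - cin u) Tn) k0 mul0r scale0r addr0.
have a0 : a != 0.
  apply/eqP => a0; apply: ncu; move: kE; rewrite a0 scale0r => /subr0_eq <-; exact: Dk.
have /nbhs_norm_ex[r r0 Hr] := open_nbhs_nbhs (conj oDin Dk).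
(* The chord from [cin u] to [cin (u + e)], prolonged by the factor a / e, tends to
   [cin u + a *: T u], which is [k]. *)
pose b (e : R) := cin u + (a / e) *: (cin (u + e) - cin u).
have bk : b e @[e --> 0^'] --> k.
  have -> : k = cin u + a *: T u by rewrite -kE addrC subrK.
  have [dc <-] := smooth_curve_is_derive scin u.
  apply: (@cvgD _ _ _ _ _ (fun=> cin u) (fun e => (a / e) *: (cin (u + e) - cin u))); first exact: cvg_cst.
  have : a *: (e^-1 *: ((cin \o shift u) (e *: 1) - cin u)) @[e --> (0:R)^'] --> a *: 'D_1 cin u.
    by apply: cvgZ; [exact: cvg_cst|exact: dc].
  apply: cvg_trans; apply: near_eq_cvg; near=> e.
  by rewrite /= scalerA [_%:A]mulr1 [e + u]addrC.
have : \forall e \near 0^', `|k - b e| < r by move/cvgrPdist_lt : bk; apply.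
move=> /nbhs_norm_ex[d d0 Hd].
pose m := Num.min (d / 2) (`|a| / 2).
have m0 : 0 < m by rewrite lt_min !divr_gt0// normr_gt0.
have md : m < d by rewrite gt_min; apply/orP; left; lra.
have ma : m < `|a| by rewrite gt_min; apply/orP; right; have := normr_gt0 a; rewrite a0; lra.
(* The sign of [a] and the size of [m] give 0 < e / a < 1, so [cin (u + e)] lies strictly between
   [cin u] and [b e]. *)
pose e := m * Num.sg a.
have e0 : e != 0 by rewrite mulf_eq0 negb_or (gt_eqF m0) sgr_eq0.
have eE : e / a = m / `|a|.
  rewrite /e -{2}[a]mulr_sg_norm; field; rewrite ?normr_eq0 ?a0//= ?sgr_eq0//.
have s0 : 0 < e / a by rewrite eE divr_gt0// normr_gt0.
have s1 : e / a < 1 by rewrite eE ltr_pdivrMr ?mul1r// normr_gt0.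
have Db : Din (b e).
  apply: Hr; apply: Hd => //; rewrite sub0r normrN /e normrM gtr0_norm//.
  by rewrite normr_sg a0 mulr1.
have [_ nD] := curve_in ann (u + e); apply: nD.
have -> : cin (u + e) = seg (b e) (cin u) (1 - e / a).
  by apply: rV2P; rewrite !mxE; field; rewrite a0 e0.
by apply: open_convex_closure => //; lra.
Unshelve. all: by end_near. Qed.

Lemma perp_cvg (I : Type) (F : set_system I) (FF : Filter F) (f : I -> 'rV[R]_2) (l : 'rV[R]_2) :
  f x @[x --> F] --> l -> perp (f x) @[x --> F] --> perp l.
Proof.
move=> fl; apply: rV_cvg; apply: ord2P; rewrite mxE /=; under eq_fun do rewrite mxE /=.
  exact: coord_cvg.
by apply: cvgN; exact: coord_cvg.
Qed.

(** The sign cannot change along the curve nor along a segment of the convex hole, because the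
    expression never vanishes. *)
Lemma side_const u k u' k' : Din k -> Din k' ->
  (dot (k - cin u) (perp (T u)) < 0) = (dot (k' - cin u') (perp (T u')) < 0).
Proof.
have Hu a b x : Din x -> a <= b ->
    (dot (x - cin a) (perp (T a)) < 0) = (dot (x - cin b) (perp (T b)) < 0).
  move=> Dx ab; apply: (@nonzero_same_sign (fun t => dot (x - cin t) (perp (T t)))) => //.
  - move=> t; apply: dot_cvg.
      apply: (@cvgB _ _ _ _ _ (fun=> x) cin); first exact: cvg_cst.
      exact: smooth_curve_continuous.
    by apply: perp_cvg; exact: smooth_curve_derive1_continuous.
  - by move=> t _; exact: curve_side.
have Hk a x y : Din x -> Din y ->
    (dot (x - cin a) (perp (T a)) < 0) = (dot (y - cin a) (perp (T a)) < 0).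
  move=> Dx Dy.
  have := @nonzero_same_sign (fun t => dot (seg x y t - cin a) (perp (T a))) 0 1.
  rewrite seg0 seg1; apply => //.
  - move=> t; apply: dot_cvg; last exact: cvg_cst.
    apply: (@cvgB _ _ _ _ _ (seg x y) (fun=> cin a)); last exact: cvg_cst.
    exact: seg_continuous.
  - by move=> t t01; apply: curve_side; move/convex_segP : cvxin; apply.
move=> Dk Dk'; transitivity (dot (k' - cin u) (perp (T u)) < 0); first exact: (Hk u k k' Dk Dk').
have [uu'|/ltW u'u] := leP u u'; first exact: (Hu u u' k' Dk' uu').
apply/esym; exact: (Hu u' u k' Dk' u'u).
Qed.

(** The inner curve may run either way round; this is the sign that turns the rotated tangent away
    from the hole. *)
Definition orient : R :=
  if pselect (exists u k, Din k /\ dot (k - cin u) (perp (T u)) < 0) then 1 else -1.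

(* Outward normal, of the same length as the tangent vector. *)
Definition normal u : 'rV[R]_2 := orient *: perp (T u).

Lemma orient_sqr : orient * orient = 1.
Proof. by rewrite /orient; case: pselect => ? /=; rewrite ?mulrNN mulr1. Qed.

Lemma normal_inside u k : Din k -> dot (k - cin u) (normal u) < 0.
Proof.
move=> Dk; rewrite /normal /orient dotZr; case: pselect => [[u' [k' [Dk' H]]]|H].
  by rewrite mul1r (side_const u u' Dk Dk').
rewrite mulN1r oppr_lt0 lt_neqAle eq_sym curve_side//= leNgt.
by apply/negP => H'; apply: H; exists u, k.
Qed.

Lemma dot_sub_continuous a w : continuous (fun x : 'rV[R]_2 => dot (x - a) w).
Proof.
move=> x; apply: (@dot_cvg _ _ (nbhs x) _ (fun x => x - a) (fun=> w)); last exact: cvg_cst.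
by apply: (@cvgB _ _ _ (nbhs x) _ id (fun=> a)); [exact: cvg_id|exact: cvg_cst].
Qed.

Lemma closure_dot_gt0 a w k : closure Din k -> 0 < dot (k - a) w ->
  exists2 x, Din x & 0 < dot (x - a) w.
Proof.
move=> ck H.
have : \forall x \near k, 0 < dot (x - a) w.
  by have := @dot_sub_continuous a w k; move/cvgr_gt; apply.
by move=> /ck[x [Dx H2]]; exists x.
Qed.

Lemma normal_closure u k : closure Din k -> dot (k - cin u) (normal u) <= 0.
Proof.
move=> ck; rewrite leNgt; apply/negP => /(closure_dot_gt0 ck)[x Dx].
by rewrite ltNge (ltW (normal_inside u Dx)).
Qed.

Lemma dot_tangent_normal u : dot (T u) (normal u) = 0.
Proof. by rewrite /normal dotZr dot_perp mulr0. Qed.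

Lemma dot_normal_normal u : dot (normal u) (normal u) = dot (T u) (T u).
Proof. by rewrite /normal dotZr dotZl dot_perpE mulrA orient_sqr mul1r. Qed.

Lemma normal_basis u x : x = (dot x (T u) / dot (T u) (T u)) *: T u +
  (dot x (normal u) / dot (T u) (T u)) *: normal u.
Proof.
rewrite {1}(perp_basis x (tangent_neq0 u)); congr (_ + _).
by rewrite /normal dotZr scalerA mulrAC [orient * _ * _]mulrAC orient_sqr mul1r.
Qed.

Lemma normal_continuous : continuous normal.
Proof.
move=> u; apply: (@cvgZ _ _ _ _ _ (fun=> orient)); first exact: cvg_cst.
by apply: perp_cvg; exact: smooth_curve_derive1_continuous.
Qed.

(** The normal line meets the hole at some [k], and convexity fills the segment from [k] to [cin u].
    Thus a bar cannot extend inwards. *)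
Lemma inward_normal u : exists2 r0 : R, r0 < 0 &
  forall r, r0 <= r < 0 -> Din (cin u + r *: normal u).
Proof.
have TT : 0 < dot (T u) (T u) by rewrite lt_neqAle eq_sym dot_eq0 tangent_neq0 dot_ge0.
have [ccu ncu] := curve_in ann u.
(* Otherwise the convex hole would lie strictly on one side of the normal line, whereas the curve
   passes from one side to the other at [cin u]. *)
have [k [Dk k0]] : exists k, Din k /\ dot (k - cin u) (T u) = 0.
  apply: contrapT => H.
  have nz k : Din k -> dot (k - cin u) (T u) != 0.
    by move=> Dk; apply/eqP => k0; apply: H; exists k.
  have same x y : Din x -> Din y -> (dot (x - cin u) (T u) < 0) = (dot (y - cin u) (T u) < 0).
    move=> Dx Dy.
    have := @nonzero_same_sign (fun t => dot (seg x y t - cin u) (T u)) 0 1.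
    rewrite seg0 seg1; apply => //.
    - move=> t; apply: dot_cvg; last exact: cvg_cst.
      apply: (@cvgB _ _ _ _ _ (seg x y) (fun=> cin u)); last exact: cvg_cst.
      exact: seg_continuous.
    - by move=> t t01; apply: nz; move/convex_segP : cvxin; apply.
  have quot : \forall e \near (0:R)^', 0 < e^-1 * dot (cin (u + e) - cin u) (T u).
    have [dc E] := smooth_curve_is_derive scin u.
    have : dot (e^-1 *: ((cin \o shift u) (e *: 1) - cin u)) (T u) @[e --> (0:R)^'] --> dot (T u) (T u).
      by apply: dot_cvg; [rewrite -{1}E; exact: dc|exact: cvg_cst].
    move/cvgr_gt => /(_ _ TT); apply: filterS => e /=.
    by rewrite dotZl [_%:A]mulr1 [e + u]addrC.
  have /nbhs_norm_ex[d d0 Hd] := quot.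
  have d2 : 0 < d / 2 by rewrite divr_gt0.
  have d2d : d / 2 < d by lra.
  have := Hd (d / 2); rewrite sub0r normrN (gtr0_norm d2) => /(_ d2d).
  have -> : d / 2 != 0 by rewrite gt_eqF.
  move=> /(_ isT); rewrite pmulr_rgt0 ?invr_gt0// => H1.
  have := Hd (- (d / 2)); rewrite sub0r opprK (gtr0_norm d2) => /(_ d2d).
  have -> : - (d / 2) != 0 by rewrite oppr_eq0 gt_eqF.
  move=> /(_ isT); rewrite nmulr_rgt0 ?invr_lt0 ?oppr_lt0// => H2.
  have [x Dx x0] := closure_dot_gt0 (curve_in ann (u + d / 2)).1 H1.
  have H3 : 0 < dot (cin (u + - (d / 2)) - cin u) (- T u) by rewrite dotNr oppr_gt0.
  have [y Dy] := closure_dot_gt0 (curve_in ann (u + - (d / 2))).1 H3.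
  rewrite dotNr oppr_gt0 => y0.
  by move: y0; rewrite -(same x y Dx Dy) ltNge (ltW x0).
pose r0 := dot (k - cin u) (normal u) / dot (T u) (T u).
have r00 : r0 < 0 by rewrite pmulr_llt0 ?invr_gt0// normal_inside.
have kE : k = cin u + r0 *: normal u.
  by rewrite -[k in LHS](subrK (cin u)) {1}(normal_basis u (k - cin u)) k0 mul0r scale0r add0r addrC.
exists r0 => // r /andP[r1 r2].
have -> : cin u + r *: normal u = seg k (cin u) (1 - r / r0).
  by rewrite kE; apply: rV2P; rewrite !mxE; field; rewrite lt_eqF.
apply: open_convex_closure => //.
have : 0 < r / r0 by rewrite nmulr_rgt0// invr_lt0.
have : r / r0 <= 1 by rewrite ler_ndivrMr// mul1r.
lra.
Qed.

(** Explicit form of the bar with foot [cin u]: the points of the outward normal ray visible from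
    the foot within [Omega]. *)
Definition barset u : set 'rV[R]_2 := [set q | [/\ dot (q - cin u) (T u) = 0,
  0 <= dot (q - cin u) (normal u) & forall t : R, 0 <= t <= 1 -> Omega (seg (cin u) q t)]].

Lemma nuE u : nu cin (cin u) = - ((enorm (T u))^-1 *: T u).
Proof.
rewrite /nu; set v := xget _ _.
suff : cin v = cin u by move=> /(derive1_same scin) ->.
rewrite /v; case: xgetP => [x _ //|/(_ u)]; by case.
Qed.

(** A connected subset of the normal line is an interval in the coordinate [r]. If it contained a
    negative coordinate, it would contain points of the hole just inside the foot. *)
Lemma barE u : bar cin Omega (cin u) = barset u.
Proof.
have en0 : 0 < enorm (T u) by rewrite enorm_gt0 tangent_neq0.
have TT : 0 < dot (T u) (T u) by rewrite lt_neqAle eq_sym dot_eq0 tangent_neq0 dot_ge0.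
have lineE q : dot (q - cin u) (nu cin (cin u)) = 0 <-> dot (q - cin u) (T u) = 0.
  rewrite nuE dotNr dotZr; split => [/eqP|->]; last by rewrite mulr0 oppr0.
  by rewrite oppr_eq0 mulf_eq0 invr_eq0 gt_eqF//= => /eqP.
rewrite /bar; apply/seteqP; split => q.
- move=> [B [Bu BA cB] Bq].
  have Oq : forall x, B x -> Omega x /\ dot (x - cin u) (T u) = 0.
    by move=> x /BA[Ox /lineE].
  pose r x := dot (x - cin u) (normal u) / dot (T u) (T u).
  have xE x : B x -> x = cin u + r x *: normal u.
    move=> /Oq[_ x0].
    by rewrite -[x in LHS](subrK (cin u)) {1}(normal_basis u (x - cin u)) x0 mul0r scale0r add0r addrC.
  have rc : continuous r.
    move=> x; apply: (@cvgM _ _ (nbhs x) _ (fun x => dot (x - cin u) (normal u)) (fun=> (dot (T u) (T u))^-1)).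
      exact: dot_sub_continuous.
    exact: cvg_cst.
  have /connected_intervalP ir : connected (r @` B).
    by apply: connected_continuous_connected => //; exact: continuous_subspaceT.
  have r_u : r (cin u) = 0 by rewrite /r subrr dot0l mul0r.
  have rB s : (exists2 x, B x & r x <= s) -> (exists2 x, B x & s <= r x) -> B (cin u + s *: normal u).
    move=> [x Bx xs] [y By sy].
    have [z Bz zs] : (r @` B) s.
      by apply: (ir (r x) (r y)); [exists x|exists y|rewrite xs].
    by rewrite -zs -xE.
  have rq0 : 0 <= r q.
    rewrite leNgt; apply/negP => rq0.
    have [r0 r00 Hr0] := inward_normal u.
    pose s := Num.max (r q) r0.
    have s0 : s < 0 by rewrite gt_max rq0.
    have Ds : Din (cin u + s *: normal u) by apply: Hr0; rewrite s0 le_max lexx orbT.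
    have /Oq[Os _] : B (cin u + s *: normal u).
      by apply: rB; [exists q; rewrite // le_max lexx|exists (cin u); rewrite // r_u ltW].
    by have [_ _ _ _ OE] := ann; move: Os; rewrite OE => -[].
  split.
  - by have [] := Oq q Bq.
  - by move: rq0; rewrite /r pmulr_lge0// invr_gt0.
  - move=> t /andP[t0 t1].
    have -> : seg (cin u) q t = cin u + (t * r q) *: normal u.
      by rewrite {1}(xE q Bq) /seg addrAC subrr add0r scalerA.
    have [] // := Oq (cin u + (t * r q) *: normal u).
    apply: rB; first by exists (cin u) => //; rewrite r_u mulr_ge0.
    by exists q => //; rewrite ler_piMl.
- move=> [q0 q1 q2].
  apply: (@connected_component_max _ _ (seg (cin u) q @` `[0, 1])).
  - by exists 0; [rewrite /= in_itv/= lexx ler01|exact: seg0].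
  - move=> _ [t /= + <-]; rewrite in_itv/= => t01; split; first exact: q2.
    apply/lineE; rewrite /seg addrAC subrr add0r dotZl q0 mulr0//.
  - by apply: image_connected; exact: seg_continuous.
  - by exists 1; [rewrite /= in_itv/= lexx ler01|exact: seg1].
Qed.

Lemma barset_sub u q : barset u q -> Omega q.
Proof. by move=> [_ _ /(_ 1)]; rewrite ler01 lexx seg1; apply. Qed.

Lemma barset_foot u : barset u (cin u).
Proof.
split; rewrite ?subrr ?dot0l// => t _; rewrite /seg subrr scaler0 addr0.
exact: cin_Omega ann u.
Qed.

(** The foot of a bar is the point of the convex set [closure Din] nearest to [q]; the two
    obtuse-angle inequalities add up to |cin u - cin v|^2 <= 0. *)
Lemma barset_disj u v q : barset u q -> barset v q -> cin u = cin v.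
Proof.
have key a b x : barset a x -> dot (x - cin a) (cin b - cin a) <= 0.
  move=> [x0 x1 _].
  rewrite (normal_basis a (x - cin a)) x0 mul0r scale0r add0r dotZl.
  apply: mulr_ge0_le0; first by rewrite divr_ge0 ?dot_ge0.
  by rewrite dotC; apply: normal_closure; have [] := curve_in ann b.
move=> bu bv; have := key u v q bu; have := key v u q bv.
move=> H1 H2; apply/eqP; rewrite -subr_eq0 -dot_eq0 eq_le dot_ge0 andbT.
have -> : dot (cin u - cin v) (cin u - cin v) =
  dot (q - cin v) (cin u - cin v) + dot (q - cin u) (cin v - cin u).
  by rewrite !dotE !mxE; ring.
lra.
Qed.

(** Closedness jointly in foot and point makes sweeps closed, hence measurable, and keeps the bars
    of nearby configurations away from a point off the bars. *)
Lemma barset_closed : closed [set z : R * 'rV[R]_2 | barset z.1 z.2].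
Proof.
have c1 : continuous (fun z : R * 'rV[R]_2 => cin z.1).
  move=> z; apply: (@continuous_cvg _ _ _ (nbhs z) _ (fun z : R * 'rV[R]_2 => z.1) cin); last exact: cvg_fst.
  exact: smooth_curve_continuous.
have c2 : continuous (fun z : R * 'rV[R]_2 => z.2 - cin z.1).
  by move=> z; apply: cvgB; [exact: cvg_snd|exact: c1].
have cT : continuous (fun z : R * 'rV[R]_2 => T z.1).
  move=> z; apply: (@continuous_cvg _ _ _ (nbhs z) _ (fun z : R * 'rV[R]_2 => z.1) T); last exact: cvg_fst.
  exact: smooth_curve_derive1_continuous.
have cN : continuous (fun z : R * 'rV[R]_2 => normal z.1).
  move=> z; apply: (@continuous_cvg _ _ _ (nbhs z) _ (fun z : R * 'rV[R]_2 => z.1) normal); last exact: cvg_fst.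
  exact: normal_continuous.
have -> : [set z : R * 'rV[R]_2 | barset z.1 z.2] =
  [set z | dot (z.2 - cin z.1) (T z.1) = 0] `&`
  [set z | 0 <= dot (z.2 - cin z.1) (normal z.1)] `&`
  \bigcap_(t in [set t : R | 0 <= t <= 1]) [set z | Omega (seg (cin z.1) z.2 t)].
  apply/seteqP; split=> z /=; first by move=> [? ? H]; split => // t; apply: H.
  by move=> [[? ?] H]; split => // t t01; exact: H.
apply: closedI; first apply: closedI.
- apply: (@closed_comp _ _ (fun z : R * 'rV[R]_2 => dot (z.2 - cin z.1) (T z.1)) [set 0]).
    by move=> z _; apply: dot_cvg; [exact: c2|exact: cT].
  exact: closed_eq.
- apply: (@closed_comp _ _ (fun z : R * 'rV[R]_2 => dot (z.2 - cin z.1) (normal z.1)) [set x | 0 <= x]).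
    by move=> z _; apply: dot_cvg; [exact: c2|exact: cN].
  exact: closed_ge.
- apply: closed_bigI => t _.
  apply: (@closed_comp _ _ (fun z : R * 'rV[R]_2 => seg (cin z.1) z.2 t) Omega).
    move=> z _; apply: cvgD; first exact: c1.
    by apply: (@cvgZ _ _ _ _ _ (fun=> t)); [exact: cvg_cst|exact: c2].
  exact: Omega_closed ann.
Qed.

Definition swept (a b : R) : set 'rV[R]_2 := [set q | exists2 u, a <= u <= b & barset u q].

Lemma swept_closed a b : closed (swept a b).
Proof.
have K : compact ((`[a, b] `*` Omega) `&` [set z : R * 'rV[R]_2 | barset z.1 z.2]).
  apply: compact_closedI; last exact: barset_closed.
  by apply: compact_setX; [exact: segment_compact|exact: Omega_compact ann].
have -> : swept a b = snd @` ((`[a, b] `*` Omega) `&` [set z : R * 'rV[R]_2 | barset z.1 z.2]).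
  apply/seteqP; split=> [q [u uab bq]|_ [[u q] /= [[uab _] bq] <-]].
    by exists (u, q) => //=; split => //=; split; [rewrite in_itv|exact: barset_sub bq].
  by exists u => //; move: uab; rewrite in_itv.
apply: compact_closed; first exact: norm_hausdorff.
by apply: continuous_compact => //; apply: continuous_subspaceT => z; exact: cvg_snd.
Qed.

End Normals.

(** * Cells *)

Lemma curve_eq_mod (R : realType) (c : R -> 'rV[R]_2) u v : smooth_closed_curve c ->
  c u = c v -> exists k : int, u = v + k%:~R.
Proof.
move=> sc cuv; have [_ _ cp ci] := sc.
have key (w : R) : exists k : int, 0 <= w + k%:~R < 1.
  exists (- Num.floor w); have /andP[] := floor_itv w.
  by rewrite intrD mulrNz; lra.
have [k k1] := key u; have [l l1] := key v.
have E : u + k%:~R = v + l%:~R.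
  by apply: ci; rewrite ?in_itv// !periodic_int.
by exists (l - k); rewrite intrD mulrNz; lra.
Qed.

Section Cells.
Variables (R : realType) (cin cout : R -> 'rV[R]_2) (Din Dout Omega : set 'rV[R]_2).
Hypothesis ann : annulus cin cout Din Dout Omega.
Variable N : nat.
Implicit Types (x y z q k : 'rV[R]_2) (u v : R) (theta : 'rV[R]_N) (i j : 'I_N).

Let scin : smooth_closed_curve cin. Proof. by case: ann => -[]. Qed.

Notation barset := (barset cin Din Omega).

Definition ordered theta := forall i j : 'I_N, (i < j)%N ->
  theta 0 i < theta 0 j /\ theta 0 j < theta 0 i + 1.

(* Lift of the base point following the i-th one. *)
Definition next theta i : R := theta 0 (ordS i) + (i.+1 == N)%:R.

Lemma row_on_curve theta i : row i (on_curve cin theta) = cin (theta 0 i).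
Proof. by apply/rowP => j; rewrite !mxE. Qed.

Lemma cin_next theta i : cin (next theta i) = row (ordS i) (on_curve cin theta).
Proof.
rewrite row_on_curve /next; case: eqP => _; last by rewrite addr0.
by have [_ _ cp _] := scin; rewrite cp.
Qed.

Lemma ordS_last i : i.+1 == N -> ordS i = 0%N :> nat.
Proof. by move=> /eqP E; rewrite /= E modnn. Qed.

Lemma ordS_nlast i : i.+1 != N -> ordS i = i.+1 :> nat.
Proof. by move=> E; rewrite /= modn_small// ltn_neqAle E ltn_ord. Qed.

Lemma next_bounds theta i : ordered theta -> theta 0 i < next theta i <= theta 0 i + 1.
Proof.
move=> o; rewrite /next; case: (boolP (i.+1 == N)) => [l|nl] /=.
  rewrite lerD2r; have l0 := ordS_last l.
  have [E|ne] := eqVneq (ordS i) i; first by rewrite E lexx andbT ltrDl.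
  have lt : (ordS i < i)%N.
    by rewrite l0 lt0n; apply: contra ne => /eqP i0; apply/eqP/ord_inj; rewrite l0 i0.
  by have [h1 h2] := o _ _ lt; rewrite h2 ltW.
rewrite addr0; have E := ordS_nlast nl.
have lt : (i < ordS i)%N by rewrite E.
by have [-> h2] := o _ _ lt; rewrite ltW.
Qed.

(** The integer [k] runs through all lifts of the base points. As bars with different feet are
    disjoint, a bar whose foot lies strictly within the gap meets no bar of the configuration. *)
Lemma next_gap theta i j (k : int) : ordered theta ->
  theta 0 i < theta 0 j + k%:~R -> next theta i <= theta 0 j + k%:~R.
Proof.
move=> o lt.
have le_ord (a b : 'I_N) : (a <= b)%N -> theta 0 a <= theta 0 b.
  rewrite leq_eqVlt => /predU1P[/val_inj ->//|ab]; by have [/ltW] := o _ _ ab.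
have lt1 (a b : 'I_N) : theta 0 b < theta 0 a + 1.
  have [ab|ba|/val_inj ->] := ltngtP a b; last by rewrite ltrDl.
    by have [] := o _ _ ab.
  by have [h _] := o _ _ ba; rewrite (lt_trans h)// ltrDl.
have kZ (m : int) : (0 < m) -> (1 : R) <= m%:~R by move=> m0; rewrite (_ : 1 = 1%:~R)// ler_int; lia.
have kZ0 (m : int) : (m <= 0) -> m%:~R <= (0 : R) by move=> m0; rewrite (_ : 0 = 0%:~R)// ler_int.
have kZ1 (m : int) : (0 <= m) -> (0 : R) <= m%:~R by move=> m0; rewrite (_ : 0 = 0%:~R)// ler_int.
have kZm (m : int) : (m < 0) -> m%:~R <= (-1 : R) by move=> m0; rewrite (_ : -1 = (-1)%:~R)// ler_int; lia.
rewrite /next; case: (boolP (i.+1 == N)) => [l|nl] /=.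
  have ji : (j <= i)%N by have := ltn_ord j; move/eqP: l; lia.
  have k1 : 0 < k.
    rewrite ltNge; apply/negP => /kZ0 k0; have := le_ord _ _ ji; lra.
  have zj : theta 0 (ordS i) <= theta 0 j by apply: le_ord; rewrite (ordS_last l).
  have := kZ _ k1; lra.
rewrite addr0; have E := ordS_nlast nl.
have [ji|ij] := leqP j i.
  have k1 : 0 < k.
    rewrite ltNge; apply/negP => /kZ0 k0; have := le_ord _ _ ji; lra.
  have := kZ _ k1; have := lt1 j (ordS i); lra.
have sj : theta 0 (ordS i) <= theta 0 j by apply: le_ord; rewrite E.
have k1 : 0 <= k.
  rewrite leNgt; apply/negP => /kZm k0; have := lt1 i j; lra.
have := kZ1 _ k1; lra.
Qed.

(** The lifts [a], [b] in [arc] are arbitrary, but b <= a + 1 forces both to differ from [theta 0 i]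
    and [next theta i] by the same integer. *)
Lemma arcE theta i : ordered theta ->
  arc cin (row i (on_curve cin theta)) (row (ordS i) (on_curve cin theta)) =
  cin @` [set u | theta 0 i < u < next theta i].
Proof.
move=> o; have /andP[n0 n1] := next_bounds i o.
rewrite -cin_next row_on_curve; apply/seteqP; split => x.
- move=> [a [b [u [Ea Eb /andP[au ub] ba ->]]]].
  have [k Ek] := curve_eq_mod scin Ea; have [l El] := curve_eq_mod scin Eb.
  exists (u - k%:~R); last by rewrite -mulrNz periodic_int//; case: scin.
  have kl : k = l.
    have H1 : (k - l)%:~R < (1 : R) by rewrite intrD mulrNz; lra.
    have H2 : (l - k)%:~R < (1 : R) by rewrite intrD mulrNz; lra.
    by move: H1 H2; rewrite !ltrz1; lia.
  by move: El; rewrite /= -kl; lra.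
- move=> [u /= /andP[u0 u1] <-]; exists (theta 0 i), (next theta i), u; split => //.
  by rewrite u0.
Qed.

Definition bars theta : set 'rV[R]_2 := \bigcup_(j in [set: 'I_N]) barset (theta 0 j).

Lemma off_barsE theta : off_bars cin Omega (on_curve cin theta) = Omega `\` bars theta.
Proof.
rewrite /off_bars /bars; congr (_ `\` _); apply: eq_bigcupr => j _.
by rewrite row_on_curve (barE ann).
Qed.

Lemma barset_connected u : connected_component (barset u) (cin u) = barset u.
Proof.
apply: connected_component_id; first exact: barset_foot ann u.
rewrite -(barE ann) /bar; exact: component_connected.
Qed.

Lemma barset_off theta i u : ordered theta -> theta 0 i < u < next theta i ->
  barset u `<=` Omega `\` bars theta.
Proof.
move=> o /andP[u0 u1] q bq; split; first exact: barset_sub bq.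
move=> [j _ bj]; have [k E] := curve_eq_mod scin (barset_disj ann bq bj).
by move: u1; rewrite E ltNge next_gap// -E.
Qed.

Lemma cellP theta i q : ordered theta -> cell cin Omega (on_curve cin theta) i q <->
  exists2 u, theta 0 i < u < next theta i &
    connected_component (Omega `\` bars theta) (cin u) q.
Proof.
move=> o; rewrite /cell off_barsE arcE//; split.
  by move=> [_ [u u0 <-] H]; exists u.
by move=> [u u0 H]; exists (cin u) => //; exists u.
Qed.

Lemma cell_barset theta i u q : ordered theta -> theta 0 i < u < next theta i ->
  barset u q -> cell cin Omega (on_curve cin theta) i q.
Proof.
move=> o ui bq; apply/(cellP _ _ o); exists u => //.
have sub := barset_off o ui.
apply: (@connected_component_max _ _ (barset u)) => //.
  exact: barset_foot ann u.
by rewrite -barset_connected; exact: component_connected.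
Qed.

Lemma bars_away theta y : ~ bars theta y -> exists2 e : R, 0 < e &
  \forall theta' \near (theta : 'rV[R]_N), forall x, `|y - x| < e -> ~ bars theta' x.
Proof.
move=> nb.
have H j : exists2 e : R, 0 < e & \forall theta' \near (theta : 'rV[R]_N),
    forall x, `|y - x| < e -> ~ barset ((theta' : 'rV[R]_N) 0 j) x.
  have oB : open (~` [set z : R * 'rV[R]_2 | barset z.1 z.2]).
    by rewrite openC; exact: barset_closed ann.
  have nz : (~` [set z : R * 'rV[R]_2 | barset z.1 z.2]) (theta 0 j, y).
    by move=> /= H; apply: nb; exists j.
  have [[A1 A2] /= [A1n /nbhs_norm_ex[e e0 He]] HA] := open_nbhs_nbhs (conj oB nz).
  exists e => //.
  have : \forall theta' \near (theta : 'rV[R]_N), A1 ((theta' : 'rV[R]_N) 0 j).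
    by have := @coord_continuous R 1 N 0 j theta; apply.
  apply: filterS => theta' A1t x yx; apply: (HA (theta' 0 j, x)).
  by split => //=; exact: He.
have {}H : {e : 'I_N -> R | (forall j, 0 < e j) /\ forall j, \forall theta' \near (theta : 'rV[R]_N),
    forall x, `|y - x| < e j -> ~ barset ((theta' : 'rV[R]_N) 0 j) x}.
  have /choice[e He] : forall j, exists e : R, 0 < e /\ \forall theta' \near (theta : 'rV[R]_N),
      forall x, `|y - x| < e -> ~ barset ((theta' : 'rV[R]_N) 0 j) x.
    by move=> j; have [e e0 He] := H j; exists e.
  by apply: cid; exists e; split=> j; case: (He j).
have [e [e0 He]] := H.
exists (\big[Num.min/1]_j e j).
  by elim/big_ind : _ => // a b a0 b0; rewrite lt_min a0.
have : \forall theta' \near (theta : 'rV[R]_N), forall j, forall x, `|y - x| < e j -> ~ barset ((theta' : 'rV[R]_N) 0 j) x.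
  apply: (@filter_forall 'rV[R]_N 'I_N (fun j (theta' : 'rV[R]_N) => forall x, `|y - x| < e j -> ~ barset (theta' 0 j) x) (nbhs theta)).
  exact: He.
apply: filterS => theta' H' x yx [j _]; apply: H'.
by apply: lt_le_trans yx _; exact: bigmin_le_cond.
Qed.

Lemma offbars_local theta y : (Omega `\` bars theta) y ->
  exists2 d : R, 0 < d & \forall theta' \near (theta : 'rV[R]_N), forall x, Omega x -> `|y - x| < d ->
    connected_component (Omega `\` bars theta') y x.
Proof.
move=> [Oy nb]; have [e e0 He] := bars_away nb.
have [d d0 Hd] := Omega_locally_connected ann Oy e0.
exists d => //; apply: filterS He => theta' He x Ox yx.
have [C [C1 C2 C3 C4 C5]] := Hd x Ox yx.
apply: (@connected_component_max _ _ C) => // z Cz; split; first exact: C4.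
by apply: He; exact: C5.
Qed.

Lemma cell_rel_open theta i y : ordered theta -> cell cin Omega (on_curve cin theta) i y ->
  exists2 d : R, 0 < d & forall x, Omega x -> `|y - x| < d ->
    cell cin Omega (on_curve cin theta) i x.
Proof.
move=> o /(cellP _ _ o)[u ui yc].
have yo := connected_component_sub yc.
have [d d0 Hd] := offbars_local yo; exists d => // x Ox yx.
apply/(cellP _ _ o); exists u => //; apply: connected_component_trans yc _.
by have := nbhs_singleton Hd; apply.
Qed.

(** Let [W] be the set of points that stay connected to [x0] off the bars for all configurations
    near [theta]. By [offbars_local] it is relatively clopen in the component [C] of [x0], hence all
    of [C]. No uniformity over [C] is required. *)
Lemma cell_theta_open theta i q : ordered theta ->
  cell cin Omega (on_curve cin theta) i q ->
  \forall theta' \near (theta : 'rV[R]_N), ordered theta' -> cell cin Omega (on_curve cin theta') i q.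
Proof.
move=> o /(cellP _ _ o)[u ui qc].
set x0 := cin u in qc.
pose W := [set y | \forall theta' \near (theta : 'rV[R]_N), connected_component (Omega `\` bars theta') x0 y].
pose C := connected_component (Omega `\` bars theta) x0.
have Csub y : C y -> (Omega `\` bars theta) y by exact: connected_component_sub.
have x0off : (Omega `\` bars theta) x0.
  by apply: (barset_off o ui); exact: barset_foot ann u.
have loc y : C y -> exists2 d : R, 0 < d & forall x, C x -> `|y - x| < d -> (W y <-> W x).
  move=> Cy; have [d d0 Hd] := offbars_local (Csub y Cy); exists d => // x Cx yx.
  have Ox : Omega x by have [] := Csub x Cx.
  split; rewrite /W /=; apply: filterS2 Hd => theta' Hd H.
    exact: connected_component_trans H (Hd x Ox yx).
  apply: connected_component_trans H _; apply: connected_component_sym; exact: Hd.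
have WC : C `&` W = C.
  have cC : connected C by exact: component_connected.
  apply: cC.
  - exists x0; split; first exact: connected_component_refl.
    have [d d0 Hd] := offbars_local x0off; rewrite /W /=; apply: filterS Hd => theta' Hd.
    by apply: Hd; [case: x0off|rewrite subrr normr0].
  (* Relative openness is witnessed by the union of the balls about points of [W] in which [C] stays
     within [W]. *)
  - exists [set y | exists2 z, C z /\ W z & exists2 d : R, `|z - y| < d &
       forall x, C x -> `|z - x| < d -> W x].
      rewrite openE => y [z [Cz Wz] [d zy Hd]].
      have := @nbhs_norm_lt R _ y (d - `|z - y|); rewrite subr_gt0 => /(_ zy).
      apply: filterS => w /= yw; exists z => //; exists d => //.
      have -> : z - w = (z - y) + (y - w) by rewrite addrA subrK.
      by apply: le_lt_trans (ler_normD _ _) _; move: yw; lra.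
    apply/seteqP; split=> y [Cy].
      move=> Wy; split => //; have [d d0 Hd] := loc y Cy; exists y => //.
      exists d; first by rewrite subrr normr0.
      by move=> x Cx yx; apply/(Hd x Cx yx).
    by move=> [z [Cz Wz] [d zy Hd]]; split => //; exact: Hd.
  - exists (~` [set y | exists2 z, C z /\ ~ W z & exists2 d : R, `|z - y| < d &
       forall x, C x -> `|z - x| < d -> ~ W x]).
      rewrite closedC openE => y [z [Cz Wz] [d zy Hd]].
      have := @nbhs_norm_lt R _ y (d - `|z - y|); rewrite subr_gt0 => /(_ zy).
      apply: filterS => w /= yw; exists z => //; exists d => //.
      have -> : z - w = (z - y) + (y - w) by rewrite addrA subrK.
      by apply: le_lt_trans (ler_normD _ _) _; move: yw; lra.
    apply/seteqP; split=> y [Cy].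
      by move=> Wy; split => // -[z [Cz Wz] [d zy Hd]]; exact: (Hd y).
    move=> nH; split => //; apply: contrapT => nW; apply: nH.
    have [d d0 Hd] := loc y Cy; exists y => //.
    exists d; first by rewrite subrr normr0.
    by move=> x Cx yx Wx; apply: nW; apply/(Hd x Cx yx).
have Wq : W q by have : (C `&` W) q by [rewrite WC]; case.
have cc j : (fun theta' : 'rV[R]_N => theta' 0 j) @ theta --> theta 0 j.
  exact: coord_continuous.
move: ui => /andP[u0 u1].
near=> theta' => o'; apply/(cellP _ _ o'); exists u; last by near: theta'; exact: Wq.
apply/andP; split; near: theta'.
  by have /cvgr_lt := cc i; apply.
have : (fun theta' : 'rV[R]_N => next theta' i) @ theta --> next theta i.
  by apply: (@cvgD _ _ _ (nbhs theta) _ (fun theta' : 'rV[R]_N => theta' 0 (ordS i)) (fun=> (i.+1 == N)%:R)); [exact: cc|exact: cvg_cst].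
by move/cvgr_gt; apply.
Unshelve. all: by end_near. Qed.

Lemma partition_ordered s : partition_config cin Omega s ->
  exists2 theta, s = on_curve cin theta & ordered theta.
Proof. by move=> [[theta E o] _ _]; exists theta. Qed.

Lemma closure_cell_sub theta i y : ordered theta ->
  partition_config cin Omega (on_curve cin theta) ->
  closure (cell cin Omega (on_curve cin theta) i) y ->
  Omega y /\ (bars theta y \/ cell cin Omega (on_curve cin theta) i y).
Proof.
move=> o [_ tI cover] cy.
have Oy : Omega y.
  have : closure Omega y.
    apply: closure_subset cy => x /(cellP _ _ o)[u _ /connected_component_sub[]//].
  by move: (Omega_closed ann) => /closure_id <-.
split => //; have [|nb] := pselect (bars theta y); [by left|right].
have : off_bars cin Omega (on_curve cin theta) y by rewrite off_barsE.
rewrite cover => -[j _ cj]; have [d d0 Hd] := cell_rel_open o cj.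
have [x [cx yx]] := cy _ (nbhs_norm_lt y d0).
have Ox : Omega x by move: cx => /(cellP _ _ o)[u _ /connected_component_sub[]].
suff <- : j = i by [].
by apply: (tI j i) => //; exists x; split => //; exact: Hd.
Qed.

End Cells.

(** * Area by slices *)

Section PlaneMeasure.
Variable R : realType.
Implicit Types (A K : set 'rV[R]_2) (z : R * R).

Lemma point_continuous : continuous (@point R).
Proof.
move=> z; apply: rV_cvg; apply: ord2P; rewrite mxE /=; under eq_fun do rewrite mxE /=.
  exact: cvg_fst.
exact: cvg_snd.
Qed.

Lemma ballR_measurable (x e : R) : measurable (ball x e).
Proof. by apply: open_measurable; exact: ball_open. Qed.

(** An open set is the union of the countably many squares with rational centre and radius that it
    contains. *)
Lemma open_prod_measurable (U : set (R * R)) : open U -> measurable U.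
Proof.
move=> oU.
pose F (r : rat * rat * rat) : set (R * R) :=
  let B := ball (ratr r.1.1 : R) (ratr r.2) `*` ball (ratr r.1.2 : R) (ratr r.2) in
  if `[< B `<=` U >] then B else set0.
have -> : U = \bigcup_r F r.
  apply/seteqP; split => [[x y] Uxy|z [r _]]; last first.
    by rewrite /F; case: asboolP => // H; exact: H.
  have /nbhs_ballP[e /= e0 He] : nbhs (x, y) U by exact: open_nbhs_nbhs.
  have e4 : 0 < e / 4 by rewrite divr_gt0.
  have [rx Hx] : exists r : rat, `|x - ratr r| < e / 4.
    have xe : x < x + e / 4 by rewrite ltrDl.
    have [r] := rat_in_itvoo xe.
    by rewrite in_itv/= => /andP[r1 r2]; exists r; rewrite ltr_norml; lra.
  have [ry Hy] : exists r : rat, `|y - ratr r| < e / 4.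
    have ye : y < y + e / 4 by rewrite ltrDl.
    have [r] := rat_in_itvoo ye.
    by rewrite in_itv/= => /andP[r1 r2]; exists r; rewrite ltr_norml; lra.
  have ee : e / 4 < e / 2 by lra.
  have [re] := rat_in_itvoo ee.
  rewrite in_itv/= => /andP[r1 r2].
  have rxe : `|ratr rx - x| < ratr re by rewrite distrC; lra.
  have rye : `|ratr ry - y| < ratr re by rewrite distrC; lra.
  exists (rx, ry, re) => //; rewrite /F; case: asboolP => [_|[]]; first by split.
  move=> [x' y'] [/= Bx By]; apply: He; split => /=; rewrite /ball/= in Bx By *.
    move: Hx Bx; rewrite !ltr_norml; lra.
  move: Hy By; rewrite !ltr_norml; lra.
apply: countable_bigcupT_measurable => [|r]; first exact: countableP.
rewrite /F; case: asboolP => _; last exact: measurable0.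
by apply: measurableX; exact: ballR_measurable.
Qed.

Lemma point_closed_measurable K : closed K -> measurable (@point R @^-1` K).
Proof.
move=> cK; rewrite -[X in measurable X]setCK; apply: measurableC.
apply: open_prod_measurable.
apply: closed_openC; apply: closed_comp => // z _; exact: point_continuous.
Qed.

(** The point with coordinate [x] along axis [j] and [y] along the other one, so that horizontal and
    vertical slices are treated together. *)
Definition row2 (j : 'I_2) (x y : R) : 'rV[R]_2 :=
  point (if j == 0 then (x, y) else (y, x)).

(** One direction is the definition of the product measure; for the other, the two orders of
    integration agree by uniqueness of the product measure. *)
Lemma area_slices (j : 'I_2) A : measurable (@point R @^-1` A) ->
  exists g : R -> \bar R, [/\ measurable_fun setT g,
    forall y, measurable [set x | A (row2 j x y)],
    forall y, g y = lebesgue_measure [set x | A (row2 j x y)] &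
    area (@point R @^-1` A) = (\int[@lebesgue_measure R]_y g y)%E].
Proof.
set B := _ @^-1` _ => mB; move: j; apply: ord2P.
- have E y : [set x | A (row2 0 x y)] = ysection B y.
    by apply/seteqP; split => x /=; rewrite /ysection/= inE.
  exists (lebesgue_measure \o ysection B); split => [|y|y|].
  + exact: measurable_fun_ysection.
  + by rewrite E; exact: measurable_ysection.
  + by rewrite E.
  + rewrite /area (@product_measure_unique _ _ _ _ _ _ _ (@lebesgue_measure R \x^ @lebesgue_measure R)%E)//.
    by move=> C D mC mD; exact: product_measure2E.
- have E y : [set x | A (row2 1 x y)] = xsection B y.
    by apply/seteqP; split => x /=; rewrite /xsection/= inE.
  exists (lebesgue_measure \o xsection B); split => [|y|y|//].
  + exact: measurable_fun_xsection.
  + by rewrite E; exact: measurable_xsection.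
  + by rewrite E.
Qed.

Lemma area_slices_ge (j : 'I_2) A (y0 y1 l : R) : measurable (@point R @^-1` A) ->
  0 <= l -> y0 <= y1 ->
  (forall y, y0 <= y <= y1 -> exists x0 x1, l <= x1 - x0 /\
     forall x, x0 <= x <= x1 -> A (row2 j x y)) ->
  ((l * (y1 - y0))%:E <= area (@point R @^-1` A))%E.
Proof.
move=> /(area_slices j)[g [mg msl gE ->]] l0 y01 H.
have g0 y : (0 <= g y)%E by rewrite gE.
apply: (@le_trans _ _ (\int[@lebesgue_measure R]_(y in `[y0, y1]) g y)%E); last first.
  by apply: ge0_subset_integral => //; exact: measurable_funTS.
apply: (@le_trans _ _ (\int[@lebesgue_measure R]_(y in `[y0, y1]) cst l%:E y)%E).
  rewrite integral_cst//= lebesgue_measure_itv/= lte_fin; case: ltP => h.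
    by rewrite -EFinD -EFinM.
  by rewrite (_ : y1 - y0 = 0) ?mulr0 ?mule0//; apply/eqP; rewrite subr_eq0 eq_le h y01.
apply: ge0_le_integral => //=.
  by apply: measurable_funTS; exact: mg.
move=> y; rewrite in_itv/= => /H[x0 [x1 [lx Hx]]].
rewrite gE.
apply: (@le_trans _ _ (lebesgue_measure `[x0, x1]%classic)).
  rewrite lebesgue_measure_itv/= lte_fin; case: ltP => h; first by rewrite -EFinD lee_fin.
  rewrite lee_fin; lra.
apply: le_measure; rewrite ?inE//; first exact: msl.
Qed.

Lemma area_slices_null (j : 'I_2) A : measurable (@point R @^-1` A) ->
  (forall y x x', A (row2 j x y) -> A (row2 j x' y) -> x = x') ->
  area (@point R @^-1` A) = 0%E.
Proof.
move=> /(area_slices j)[g [mg msl gE ->]] H.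
rewrite (eq_integral (fun=> 0%E)) ?integral0// => y _.
rewrite gE; have [->|/set0P[x Ax]] := eqVneq [set x | A (row2 j x y)] set0.
  exact: measure0.
have -> : [set x | A (row2 j x y)] = [set x].
  apply/seteqP; split=> [x' Ax'|x' ->//]; exact: H Ax' Ax.
exact: lebesgue_measure_set1.
Qed.

Lemma area_bounded K : compact K -> (area (@point R @^-1` K) < +oo)%E.
Proof.
move=> cK; have cl := compact_closed (@norm_hausdorff _ _) cK.
have [M [_ HM]] := compact_bounded cK.
have {}HM : forall x, K x -> `|x| <= M + 1 by move=> x /HM; apply; rewrite ltrDl.
apply: (@le_lt_trans _ _ (area (`[-(M+1), M+1] `*` `[-(M+1), M+1]))).
  apply: le_measure; rewrite ?inE; first exact: point_closed_measurable.
    by apply: measurableX.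
  move=> [x y] /= /HM H; rewrite !in_itv/= -!ler_norml; split.
    by have := coord_le_norm (point (x, y)) 0; rewrite mxE /=; lra.
  by have := coord_le_norm (point (x, y)) 1; rewrite mxE /=; lra.
rewrite /area [X in (X < _)%E]product_measure1E//.
have L : (@lebesgue_measure R `[(- (M + 1))%R, (M + 1)%R]%classic < +oo)%E.
  by rewrite lebesgue_measure_itv/=; case: ifP => _; rewrite -?EFinB ltry.
by apply: lte_mul_pinfty; rewrite ?ge0_fin_numE//; exact: L.
Qed.

End PlaneMeasure.

(** * Workloads *)

(** An additive periodic function of intervals is the increment of a function on the line.
    Additivity is limited to one period because longer sweeps cover [Omega] more than once. *)
Lemma periodic_primitive (R : realType) (F : R -> R -> R) :
  (forall a b c, a <= b -> b <= c -> c <= a + 1 -> F a c = F a b + F b c) ->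
  (forall a b, F (a + 1) (b + 1) = F a b) ->
  exists g : R -> R, (forall a b, a <= b <= a + 1 -> g b - g a = F a b) /\
    (forall u v, g (u + 1) - g u = g (v + 1) - g v).
Proof.
move=> add per.
have perk a b (k : int) : F (a + k%:~R) (b + k%:~R) = F a b.
  have pern (n : nat) a' b' : F (a' + n%:R) (b' + n%:R) = F a' b'.
    elim: n a' b' => [|n IH] a' b'; first by rewrite !addr0.
    by rewrite -natr1 !addrA per.
  case: k => n; first exact: pern.
  rewrite NegzE mulrNz /= -[LHS](pern n.+1); congr F; rewrite -pmulrn; lra.
pose fl (u : R) : R := (Num.floor u)%:~R.
(* Whole turns count [F 0 1] each, and the fractional part is measured from 0. *)
pose g u := F 0 (u - fl u) + fl u * F 0 1.
exists g; split.
- move=> a b /andP[ab ba].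
  have /andP[a0 a1] := floor_itv a; have /andP[b0 b1] := floor_itv b.
  rewrite intrD in a1; rewrite intrD in b1.
  have fab : fl b = fl a \/ fl b = fl a + 1.
    have H1 : Num.floor a <= Num.floor b by exact: le_floor.
    have H2 : Num.floor b <= Num.floor a + 1.
      rewrite -ltzD1; rewrite -(ltr_int R) !intrD; lra.
    have [E|E] : Num.floor b = Num.floor a \/ Num.floor b = Num.floor a + 1 by lia.
      by left; rewrite /fl E.
    by right; rewrite /fl E intrD.
  have Fab : F a b = F (a - fl a) (b - fl a).
    by rewrite -(perk _ _ (- Num.floor a)) mulrNz.
  rewrite Fab /g; rewrite -!/(fl _) in a0 a1 b0 b1 *.
  case: fab => E; rewrite E in b0 b1 *.
    by rewrite (add 0 (a - fl a) (b - fl a)); lra.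
  have E1 : F 0 1 = F 0 (a - fl a) + F (a - fl a) 1 by apply: add; lra.
  have E2 : F (a - fl a) (b - fl a) = F (a - fl a) 1 + F 1 (b - fl a) by apply: add; lra.
  have E3 : F 1 (b - fl a) = F 0 (b - (fl a + 1)).
    rewrite -[RHS]per; congr F; lra.
  rewrite E2 E3; lra.
- move=> u v.
  have H w : g (w + 1) - g w = F 0 1.
    have E : fl (w + 1) = fl w + 1.
      by rewrite /fl floorDrz ?int_num1// intrD floor1.
    rewrite /g E (_ : w + 1 - (fl w + 1) = w - fl w); lra.
  by rewrite !H.
Qed.

Section Mass.
Variables (R : realType) (cin cout : R -> 'rV[R]_2) (Din Dout Omega : set 'rV[R]_2).
Hypothesis ann : annulus cin cout Din Dout Omega.
Variables (rho : 'rV[R]_2 -> R) (rho_min rho_max : R).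
Hypothesis rho_min_gt0 : 0 < rho_min.
Hypothesis rho_bounds : forall q, Omega q -> rho_min <= rho q <= rho_max.
Hypothesis rho_meas : measurable_fun (@point R @^-1` Omega) (rho \o @point R).
Variable N : nat.
Hypothesis hN : (0 < N)%N.
Implicit Types (x y z q k : 'rV[R]_2) (u v : R) (theta : 'rV[R]_N) (i j : 'I_N).
Implicit Types (A B Z : set 'rV[R]_2).

Let scin : smooth_closed_curve cin. Proof. by case: ann => -[]. Qed.

Notation barset := (barset cin Din Omega).
Notation swept := (swept cin Din Omega).
Notation bars := (@bars R cin Din Omega N).
Notation mu := (@lebesgue_measure R \x @lebesgue_measure R)%E.
Notation ms A := (measurable (@point R @^-1` A)).
Notation cell th i := (cell cin Omega (on_curve cin th) i).

Definition mass A := plane_integral A rho.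

Lemma measurable_Omega : ms Omega.
Proof. apply: point_closed_measurable; exact: Omega_closed ann. Qed.

Lemma measurable_swept a b : ms (swept a b).
Proof. apply: point_closed_measurable; exact: swept_closed ann a b. Qed.

Lemma sweptS a b : swept a b `<=` Omega.
Proof. by move=> q [u _]; exact: barset_sub. Qed.

Lemma barset_swept u : barset u = swept u u.
Proof.
apply/seteqP; split => [q bq|q [v vu bq]]; first by exists u; rewrite // lexx.
by have -> : u = v by apply/eqP; rewrite eq_le.
Qed.

Lemma area_Omega : (area (@point R @^-1` Omega) < +oo)%E.
Proof. by apply: area_bounded; exact: Omega_compact ann. Qed.

Lemma area_fin A : ms A -> A `<=` Omega -> area (@point R @^-1` A) \is a fin_num.
Proof.
move=> mA AO; rewrite ge0_fin_numE//; apply: le_lt_trans area_Omega.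
by apply: le_measure; rewrite ?inE//; [exact: measurable_Omega|move=> z; exact: AO].
Qed.

Lemma rho_integrable A : ms A -> A `<=` Omega ->
  mu.-integrable (@point R @^-1` A) (EFin \o (rho \o @point R)).
Proof.
move=> mA AO.
have I : mu.-integrable (@point R @^-1` Omega) (EFin \o (rho \o @point R)).
  apply: measurable_bounded_integrable => //.
  - exact: measurable_Omega.
  - exact: area_Omega.
  exists rho_max; split; first exact: num_real.
  move=> M HM z /= Oz; have /andP[r1 r2] := rho_bounds Oz.
  rewrite ger0_norm; first exact: le_trans r2 (ltW HM).
  exact: le_trans (ltW rho_min_gt0) r1.
apply: integrableS I => //; first exact: measurable_Omega.
by move=> z; exact: AO.
Qed.

Lemma massU A B : ms A -> ms B -> A `<=` Omega -> B `<=` Omega ->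
  A `&` B = set0 -> mass (A `|` B) = mass A + mass B.
Proof.
move=> mA mB AO BO AB; rewrite /mass /plane_integral preimage_setU.
apply: Rintegral_setU => //.
- by apply: (@rho_integrable (A `|` B)); [exact: measurableU|rewrite subUset].
- by apply/disj_set2P; rewrite -preimage_setI AB preimage_set0.
Qed.

Lemma mass_null A : ms A -> A `<=` Omega -> area (@point R @^-1` A) = 0%E -> mass A = 0.
Proof.
move=> mA AO A0; rewrite /mass /plane_integral /Rintegral null_set_integral//.
by have /integrableP[] := rho_integrable mA AO.
Qed.

Lemma mass_eq A B Z : ms A -> ms B -> A `<=` Omega -> B `<=` Omega ->
  ms Z -> area (@point R @^-1` Z) = 0%E -> A `\` Z = B `\` Z -> mass A = mass B.
Proof.
move=> mA mB AO BO mZ Z0 E.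
have H C : ms C -> C `<=` Omega -> mass C = mass (C `\` Z).
  move=> mC CO; have mCZ : ms (C `&` Z) by apply: measurableI.
  have mCD : ms (C `\` Z) by apply: measurableD.
  rewrite -{1}(setUIDK C Z) massU//.
  - rewrite mass_null ?add0r//; first by move=> q [/CO].
    apply/eqP; rewrite eq_le measure_ge0 andbT -Z0.
    by apply: le_measure; rewrite ?inE// => z [].
  - by move=> q [/CO].
  - by move=> q [/CO].
  - by apply/seteqP; split => // q [[_ ?] [_]].
by rewrite (H A)// (H B)// E.
Qed.

Lemma mass_ge A : ms A -> A `<=` Omega -> rho_min * fine (area (@point R @^-1` A)) <= mass A.
Proof.
move=> mA AO; rewrite -Rintegral_cst//.
apply: le_Rintegral => //.
- apply: measurable_bounded_integrable => //.
  by rewrite -ge0_fin_numE//; exact: area_fin.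
  exists `|rho_min|; split; first exact: num_real.
  by move=> M HM z _; exact: ltW.
- exact: rho_integrable.
- by move=> z /= Az; have /andP[] := rho_bounds (AO _ Az).
Qed.

Lemma measurable_barset u : ms (barset u).
Proof. by rewrite barset_swept; exact: measurable_swept. Qed.

(** A bar lies on a line normal to [T u]; if coordinate [j] of [T u] is nonzero, every line parallel
    to axis [j] meets it at most once. *)
Lemma area_barset u : area (@point R @^-1` barset u) = 0%E.
Proof.
have [j Tj] : exists j : 'I_2, derive1 cin u 0 j != 0.
  apply: contrapT => H; have [_ /(_ u)/negP + _ _] := scin; apply.
  apply/eqP/rowP => j; rewrite mxE; apply/eqP; apply: contrapT => /negP Tj.
  by apply: H; exists j.
apply: (area_slices_null (j := j)); first exact: measurable_barset.
move=> y x x' [H _ _] [H' _ _].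
have E : (x - x') * derive1 cin u 0 j = 0.
  rewrite (_ : _ * _ = dot (row2 j x y - cin u) (derive1 cin u) -
    dot (row2 j x' y - cin u) (derive1 cin u)); first by rewrite H H' subrr.
  by move: j {Tj H H'}; apply: ord2P; rewrite !dotE !mxE /=; ring.
by apply/eqP; rewrite -subr_eq0; move/eqP: E; rewrite mulf_eq0 (negPf Tj) orbF.
Qed.

Lemma barset_negligible u : mu.-negligible (@point R @^-1` barset u).
Proof.
exists (@point R @^-1` barset u); split => //; first exact: measurable_barset.
exact: area_barset.
Qed.

Lemma measurable_bars theta : ms (bars theta).
Proof.
rewrite /bars preimage_bigcup; apply: fin_bigcup_measurable => // j _.
exact: measurable_barset.
Qed.

Lemma area_bars theta : area (@point R @^-1` bars theta) = 0%E.
Proof.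
apply: measure_negligible; first exact: measurable_bars.
have -> : bars theta = \big[setU/set0]_(j <- enum 'I_N) barset (theta 0 j).
  rewrite -bigcup_seq; apply/seteqP; split => q [j _ bj]; exists j => //=.
  by rewrite mem_enum.
have H (s : seq 'I_N) : mu.-negligible (@point R @^-1` (\big[setU/set0]_(j <- s) barset (theta 0 j))).
  elim: s => [|j s IH]; first by rewrite big_nil preimage_set0; exact: negligible_set0.
  rewrite big_cons preimage_setU; apply: negligibleU => //.
  exact: barset_negligible.
exact: H.
Qed.

Lemma cell_sub theta i : ordered theta -> cell theta i `<=` Omega `\` bars theta.
Proof. by move=> o q /(cellP ann _ _ o)[u _ /connected_component_sub]. Qed.

(** Cells are components, with no evident measurability; but a cell is its closure minus the closed
    bars. *)
Lemma measurable_cell theta i : ordered theta ->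
  partition_config cin Omega (on_curve cin theta) -> ms (cell theta i).
Proof.
move=> o pc; have -> : cell theta i = closure (cell theta i) `\` bars theta.
  apply/seteqP; split => q.
    by move=> cq; split; [exact: subset_closure|have [] := cell_sub o cq].
  by move=> [/(closure_cell_sub ann o pc)[_ []]].
apply: measurableD; last exact: measurable_bars.
by apply: point_closed_measurable; exact: closed_closure.
Qed.

Lemma workload_cell theta i : ordered theta ->
  partition_config cin Omega (on_curve cin theta) ->
  workload cin Omega rho (on_curve cin theta) i = mass (cell theta i).
Proof.
move=> o pc; apply: (@mass_eq _ _ (bars theta)).
- by apply: point_closed_measurable; exact: closed_closure.
- exact: measurable_cell.
- by move=> q /(closure_cell_sub ann o pc)[].
- by move=> q /(cell_sub o)[].
- exact: measurable_bars.
- exact: area_bars.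
- apply/seteqP; split => q [cq nq]; split => //.
    by have [_ []] := closure_cell_sub ann o pc cq.
  exact: subset_closure.
Qed.

Lemma next_cover theta u : ordered theta ->
  exists i (k : int), theta 0 i <= u + k%:~R < next theta i.
Proof.
move=> o; pose i0 := Ordinal hN.
(* Shift [u] into the period that starts at the first base point, then take the last base point not
   beyond it. *)
pose k := - Num.floor (u - theta 0 i0); exists (@Order.arg_max _ _ _ i0 (fun i => theta 0 i <= u + k%:~R) (@nat_of_ord N)), k.
have /andP[f0 f1] := floor_itv (u - theta 0 i0).
rewrite intrD in f1.
have Ek : k%:~R = - (Num.floor (u - theta 0 i0))%:~R :> R by rewrite mulrNz.
case: arg_maxP => [|i Hi Mi]; first by rewrite Ek; lra.
rewrite Hi /next /=; case: (boolP (i.+1 == N)) => [l|nl] /=.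
  have -> : ordS i = i0 by apply/val_inj; rewrite /= (eqP l) modnn.
  rewrite Ek; lra.
rewrite addr0 ltNge; apply/negP => /Mi /=; rewrite modn_small ?leEnat ?ltnn//.
by rewrite ltn_neqAle nl ltn_ord.
Qed.

Lemma swept_periodic a b : swept (a + 1) (b + 1) = swept a b.
Proof.
have [_ _ cp _] := scin.
have P u : barset (u + 1) = barset u.
  have E : cin (u + 1) = cin u by exact: cp.
  by rewrite -!(barE ann) E.
apply/seteqP; split => q [u uab bu]; first by exists (u - 1); [lra|rewrite -P subrK].
by exists (u + 1); [lra|rewrite P].
Qed.

Lemma barset_int u (m : int) : barset (u + m%:~R) = barset u.
Proof. by rewrite -!(barE ann) periodic_int//; case: scin. Qed.

(** Over at most one turn, two adjacent sweeps overlap only in the bars at [b] and, when the turn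
    closes up, at [a]; both are null. *)
Lemma mass_swept_add a b c : a <= b -> b <= c -> c <= a + 1 ->
  mass (swept a c) = mass (swept a b) + mass (swept b c).
Proof.
move=> ab bc ca.
pose Z := barset a `|` barset b.
have mZ : ms Z by apply: measurableU; exact: measurable_barset.
have Z0 : area (@point R @^-1` Z) = 0%E.
  apply: measure_negligible => //; rewrite preimage_setU.
  by apply: negligibleU; apply: barset_negligible.
have mb : ms (swept b c `\` Z).
  by apply: measurableD => //; exact: measurable_swept.
rewrite (@mass_eq (swept b c) (swept b c `\` Z) Z)//; first 1 last.
- exact: measurable_swept.
- exact: sweptS.
- by move=> q [/sweptS].
- by rewrite setDDl setUid.
rewrite -massU//; first 1 last.
- exact: measurable_swept.
- exact: sweptS.
- by move=> q [/sweptS].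
- apply/seteqP; split => // q [[u uab bu] [[v vbc bv] nZ]].
  have [m E] := curve_eq_mod scin (barset_disj ann bu bv).
  have [m0|m0] : (0 <= m) \/ (m <= -1) by lia.
    have : 0 <= (m%:~R : R) by rewrite ler0z.
    move=> m1; apply: nZ; right; rewrite (_ : b = v) //; lra.
  have : (m%:~R : R) <= -1 by rewrite (_ : -1 = (-1)%:~R)// ler_int.
  move=> m1; apply: nZ; left; rewrite (_ : a = u) //; lra.
apply: (@mass_eq _ _ Z) => //.
- exact: measurable_swept.
- by apply: measurableU => //; exact: measurable_swept.
- exact: sweptS.
- by rewrite subUset; split; [exact: sweptS|move=> q [/sweptS]].
- apply/seteqP; split => q.
  + move=> [[u uac bu] nq]; split => //.
    by have [ub|bu'] := leP u b; [left; exists u => //; lra|right; split => //; exists u => //; lra].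
  + move=> [[[u uab bu]|[[u uab bu] _]] nq]; split => //; exists u => //; lra.
Qed.

(** [swept 0 1] is the union of all possible bars. Inside a cell it reduces to the bars with feet in
    the gap, and the remainder is reached by no bar. *)
Lemma cell_swept theta i : ordered theta ->
  partition_config cin Omega (on_curve cin theta) ->
  mass (cell theta i) = mass (swept (theta 0 i) (next theta i)) + mass (cell theta i `\` swept 0 1).
Proof.
move=> o pc; have mc := measurable_cell i o pc; have ms01 := measurable_swept 0 1.
have mI : ms (cell theta i `&` swept 0 1) by apply: measurableI.
have mD : ms (cell theta i `\` swept 0 1) by apply: measurableD.
have cO : cell theta i `<=` Omega by move=> q /(cell_sub o)[].
rewrite -{1}(setUIDK (cell theta i) (swept 0 1)) massU//; first 1 last.
- by move=> q [/cO].
- by move=> q [/cO].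
- by apply/seteqP; split => // q [[_ ?] [_]].
congr (_ + _); apply: (@mass_eq _ _ (bars theta)) => //.
- exact: measurable_swept.
- by move=> q [/cO].
- exact: sweptS.
- exact: measurable_bars.
- exact: area_bars.
apply/seteqP; split => q.
- move=> [[cq [u _ bu]] nb]; split => //.
  have [j [k /andP[j0 j1]]] := next_cover u o.
  have bu' : barset (u + k%:~R) q by rewrite barset_int.
  move: j0; rewrite le_eqVlt => /predU1P[E|j0].
    by case: nb; exists j => //; rewrite E.
  have cj : cell theta j q by apply: (cell_barset ann o _ bu'); rewrite j0.
  have [_ tI _] := pc; have E := tI j i I I (ex_intro _ q (conj cj cq)).
  by exists (u + k%:~R) => //; rewrite -E (ltW j0) (ltW j1).
- move=> [[u /andP[u0 u1] bu] nb]; split => //.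
  have /andP[n0 n1] := next_bounds i o.
  have ne0 : theta 0 i != u.
    by apply/eqP => E; apply: nb; exists i => //; rewrite E.
  have ne1 : u != next theta i.
    apply/eqP => E; apply: nb; exists (ordS i) => //.
    have : barset (next theta i) q by rewrite -E.
    by rewrite /next pmulrn barset_int.
  split.
    by apply: (cell_barset ann o _ bu); rewrite !lt_neqAle ne0 ne1 u0.
  have /andP[f0 f1] := floor_itv u; rewrite intrD in f1.
  exists (u + (- Num.floor u)%:~R); first by rewrite mulrNz; lra.
  by rewrite barset_int.
Qed.

End Mass.

(** * Lower bound for the area swept by a moving bar *)

Definition other (j : 'I_2) : 'I_2 := if j == 0 then 1 else 0.

Lemma dot_other (R : realType) j (x w : 'rV[R]_2) :
  dot x w = x 0 j * w 0 j + x 0 (other j) * w 0 (other j).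
Proof. by move: j; apply: ord2P; rewrite dotE // addrC. Qed.

Lemma row2_same (R : realType) j (x y : R) : row2 j x y 0 j = x.
Proof. by move: j; apply: ord2P; rewrite /row2 mxE. Qed.

Lemma row2_other (R : realType) j (x y : R) : row2 j x y 0 (other j) = y.
Proof. by move: j; apply: ord2P; rewrite /row2 mxE. Qed.

Lemma row2_eq (R : realType) j (x : 'rV[R]_2) : row2 j (x 0 j) (x 0 (other j)) = x.
Proof. by apply: rV2P; move: j; apply: ord2P; rewrite /row2 mxE. Qed.

Lemma cvg_comp_fst (R : realType) (V : topologicalType) (f : R -> V) (z : R * R) :
  continuous f -> f w.1 @[w --> z] --> f z.1.
Proof.
move=> cf; apply: (@continuous_cvg _ _ _ (nbhs z) _ (fun w : R * R => w.1) f); first exact: cf.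
exact: cvg_fst.
Qed.

Section SweepRate.
Variables (R : realType) (cin cout : R -> 'rV[R]_2) (Din Dout Omega : set 'rV[R]_2).
Hypothesis ann : annulus cin cout Din Dout Omega.
Implicit Types (q k : 'rV[R]_2) (u v : R).

Let scin : smooth_closed_curve cin. Proof. by case: ann => -[]. Qed.

Notation barset := (barset cin Din Omega).
Notation swept := (swept cin Din Omega).
Notation normal := (normal cin Din).
Notation T := (derive1 cin).

(** Within distance [e] of the hole nothing leaves [Dout], so the outward normal is unobstructed
    near its foot. *)
Lemma barset_near u q (e : R) : (forall k x, closure Din k -> `|k - x| < e -> Dout x) ->
  dot (q - cin u) (T u) = 0 -> 0 < dot (q - cin u) (normal u) -> `|q - cin u| < e ->
  barset u q.
Proof.
move=> He q0 q1 q2; split => //; first exact: ltW.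
move=> t /andP[t0 t1]; have [_ _ _ _ ->] := ann; split.
  apply: subset_closure; apply: (He (cin u)); first by have [] := curve_in ann u.
  rewrite /seg opprD addNKr normrN normrZ ger0_norm//.
  by apply: le_lt_trans q2; rewrite ler_piMl.
move=> /(normal_inside ann u); rewrite /seg addrAC subrr add0r dotZl.
by rewrite ltNge mulr_ge0// ltW.
Qed.

(** [X u y] is where the bar at [u] crosses the line at height [y], and [X1] is its speed in [u].
    The slice of the sweep contains all points between [X a y] and [X b y] by the intermediate value
    theorem, a length of at least m (b - a) by the mean value theorem; heights range over an
    interval of length [r]. *)
Lemma swept_slices (j : 'I_2) (X X1 : R -> R -> R) (a0 y0 r m e : R) (a b : R) :
  (forall k x, closure Din k -> `|k - x| < e -> Dout x) -> 0 < r -> 0 < m ->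
  (forall u y, T u 0 j != 0 -> X u y * T u 0 j + y * T u 0 (other j) = dot (cin u) (T u)) ->
  (forall u y, T u 0 j != 0 -> is_derive u 1 (X ^~ y) (X1 u y)) ->
  (forall u y, `|u - a0| < r -> `|y - y0| < r -> [/\ T u 0 j != 0, m <= `|X1 u y|,
    0 < dot (row2 j (X u y) y - cin u) (normal u) & `|row2 j (X u y) y - cin u| < e]) ->
  `|a - a0| < r / 2 -> a <= b <= a + r / 2 ->
  ((m * (b - a) * r)%:E <= area (@point R @^-1` swept a b))%E.
Proof.
move=> He r0 m0 XE dX Hr ar /andP[ab br].
rewrite -[X in (_ * X)%:E](_ : (y0 + r / 2) - (y0 - r / 2) = r); last by field.
apply: (area_slices_ge (j := j)).
- by apply: point_closed_measurable; exact: swept_closed ann a b.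
- by apply: mulr_ge0; [exact: ltW|rewrite subr_ge0].
- lra.
move=> y yY.
have yr : `|y - y0| < r by rewrite ltr_norml; lra.
have Hab u : a <= u <= b -> `|u - a0| < r.
  by move: ar; rewrite !ltr_norml => /andP[? ?] /andP[? ?]; apply/andP; split; lra.
have Xc : {within `[a, b], continuous (X ^~ y)}.
  apply: derivable_within_continuous => u; rewrite in_itv/= => uab.
  have [Tu _ _ _] := Hr _ _ (Hab u uab) yr.
  by have [] := dX u y Tu.
exists (Num.min (X a y) (X b y)), (Num.max (X a y) (X b y)); split.
  apply: (@le_trans _ _ `|X b y - X a y|); last first.
    by have [h|h] := lerP (X a y) (X b y); rewrite lexx.
  have [|u uab ->] := @MVT_segment _ (X ^~ y) (X1 ^~ y) _ _ ab _ Xc.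
    move=> u; rewrite in_itv/= => /andP[u1 u2]; apply: dX.
    by have [] := Hr u y (Hab u _) yr; rewrite ?(ltW u1) ?(ltW u2).
  rewrite normrM (ger0_norm (_ : 0 <= b - a)) ?subr_ge0//.
  apply: ler_wpM2r; first by rewrite subr_ge0.
  move: uab; rewrite in_itv/= => uab.
  by have [] := Hr _ _ (Hab u uab) yr.
move=> x xab; have [u uab Xu] := IVT ab Xc xab.
move: uab; rewrite in_itv/= => uab; exists u => //.
have [h1 h2 h3 h4] := Hr _ _ (Hab u uab) yr.
rewrite Xu in h3 h4; apply: (barset_near He) => //.
by rewrite dotBl (dot_other j (row2 _ _ _)) row2_same row2_other -Xu XE// subrr.
Qed.

(* Each line parallel to a coordinate axis not normal to the curve meets the
   nearby bars at a point which moves with nonzero speed, so that the slices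
   of a sweep have lengths comparable to b - a. *)
Lemma sweep_area_local (a0 : R) : \forall a \near a0 & c \near (0 : R)^'+,
  forall b, a <= b <= a + c -> ((c * (b - a))%:E <= area (@point R @^-1` swept a b))%E.
Proof.
have [e e0 He] : exists2 e : R, 0 < e & forall k x, closure Din k -> `|k - x| < e -> Dout x.
  apply: compact_thickening; [exact: Din_compact ann|exact: open_Dout ann|].
  by have [_ _ _] := ann.
have T0 : T a0 != 0 by exact: tangent_neq0 ann a0.
have TT0 : 0 < dot (T a0) (T a0) by rewrite lt_neqAle eq_sym dot_eq0 T0 dot_ge0.
have [j Tj] : exists j : 'I_2, T a0 0 j != 0.
  apply: contrapT => H; move/negP: T0; apply.
  by apply/eqP/rowP => j; rewrite mxE; apply/eqP; apply: contrapT => /negP Tj; apply: H; exists j.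
pose j' : 'I_2 := other j.
pose D u := dot (cin u) (T u).
pose D1 u := dot (T u) (T u) + dot (cin u) (derive1 T u).
have dD u : is_derive u 1 D (D1 u).
  rewrite /D1 addrC; apply: is_derive_eq; first apply: is_derive_dot.
  - exact: smooth_curve_is_derive scin u.
  - exact: smooth_curve_derive1_is_derive scin u.
  - exact: addrC.
(* Coordinate along axis [j] of the point where the normal line at [cin u] meets the line on which
   the other coordinate is [y]. *)
pose X u y := (D u - y * T u 0 j') / T u 0 j.
pose X1 u y := ((D1 u - y * derive1 T u 0 j') * T u 0 j -
   (D u - y * T u 0 j') * derive1 T u 0 j) / (T u 0 j * T u 0 j).
have dX u y : T u 0 j != 0 -> is_derive u 1 (X ^~ y) (X1 u y).
  move=> Tu.
  have dT i : is_derive u 1 (fun u => T u 0 i) (derive1 T u 0 i).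
    by move/is_derive_coordP: (smooth_curve_derive1_is_derive scin u); exact.
  have H1 := is_deriveV Tu (dT j).
  have H2 := is_deriveB (dD u) (is_deriveM (is_derive_cst y u 1) (dT j')).
  have [d3 v3] := is_deriveM H2 H1.
  apply: DeriveDef; [exact: d3|apply: (etrans v3)].
  rewrite -[LHS]/((D u - y * T u 0 j') * (- T u 0 j ^- 2 * derive1 T u 0 j) +
    (T u 0 j)^-1 * (D1 u - (y * derive1 T u 0 j' + T u 0 j' * 0))) /X1.
  by field.
have cT := smooth_curve_derive1_continuous scin.
have cT' := smooth_curve_derive2_continuous scin.
have cc := smooth_curve_continuous scin.
have cD : continuous D.
  by move=> u; apply: differentiable_continuous; apply/derivable1_diffP; have [] := dD u.
have cD1 : continuous D1.
  move=> u; apply: cvgD.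
    exact: (@dot_cvg _ _ (nbhs u) _ T T _ _ (cT u) (cT u)).
  exact: (@dot_cvg _ _ (nbhs u) _ cin (derive1 T) _ _ (cc u) (cT' u)).
(* A height on the normal at [cin a0]: positive, to be strictly on the outer side; of size below
   [e], to remain in [Dout]; and small enough that the numerator of [X1] keeps the sign of its value
   |T|^2 at the curve. *)
have [la [la0 la1 la2]] : exists la : R, [/\ 0 < la, `|la *: normal a0| < e &
    0 < dot (T a0) (T a0) - la * dot (normal a0) (derive1 T a0)].
  have H0 : \forall la \near (0 : R)^'+, [/\ 0 < la, `|la *: normal a0| < e &
      0 < dot (T a0) (T a0) - la * dot (normal a0) (derive1 T a0)].
    have L1 : (fun la : R => `|la *: normal a0|) la @[la --> (0 : R)^'+] --> (0 : R).
      have H : `|la *: normal a0| @[la --> (0 : R)] --> `|(0 : R) *: normal a0|.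
        by apply: cvg_norm; apply: (@cvgZ _ _ _ _ _ id (fun=> normal a0)); [exact: cvg_id|exact: cvg_cst].
      by rewrite scale0r normr0 in H; exact: cvg_at_right_filter H.
    have L2 : (fun la : R => dot (T a0) (T a0) - la * dot (normal a0) (derive1 T a0)) la
        @[la --> (0 : R)^'+] --> dot (T a0) (T a0).
      have H : dot (T a0) (T a0) - la * dot (normal a0) (derive1 T a0) @[la --> (0 : R)] -->
          dot (T a0) (T a0) - 0 * dot (normal a0) (derive1 T a0).
        apply: cvgB; first exact: cvg_cst.
        by apply: cvgM; [exact: cvg_id|exact: cvg_cst].
      by rewrite mul0r subr0 in H; exact: cvg_at_right_filter H.
    near=> la; split.
    - by near: la; exact: nbhs_right_gt.
    - by near: la; move/cvgr_lt: L1; exact.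
    - by near: la; move/cvgr_gt: L2; exact.
  by have [la Hla] := @filter_ex _ _ (at_right_proper_filter (0 : R)) _ H0; exists la.
pose k0 := cin a0 + la *: normal a0.
pose Y0 := k0 0 j'.
have X0 : X a0 Y0 = k0 0 j.
  have : dot (k0 - cin a0) (T a0) = 0.
    by rewrite /k0 addrAC subrr add0r dotZl dotC dot_tangent_normal mulr0.
  rewrite dotBl (dot_other j) -/(D a0) -/Y0 /X => /eqP.
  rewrite subr_eq0 => /eqP <-; field; exact: Tj.
have X10 : X1 a0 Y0 != 0.
  have -> : X1 a0 Y0 = (dot (T a0) (T a0) - la * dot (normal a0) (derive1 T a0)) / T a0 0 j.
    have E : D a0 - Y0 * T a0 0 j' = k0 0 j * T a0 0 j.
      by rewrite -X0 /X; field; exact: Tj.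
    have E2 : la * dot (normal a0) (derive1 T a0) = dot k0 (derive1 T a0) - dot (cin a0) (derive1 T a0).
      by rewrite -dotBl /k0 addrAC subrr add0r dotZl.
    by rewrite /X1 E E2 /D1 (dot_other j k0) -/Y0; field; exact: Tj.
  by rewrite mulf_eq0 invr_eq0 negb_or Tj gt_eqF.
pose m := `|X1 a0 Y0| / 2.
have m0 : 0 < m by rewrite divr_gt0 ?normr_gt0.
pose Q (z : R * R) := row2 j (X z.1 z.2) z.2.
pose z0 : R * R := (a0, Y0).
have cTz i : T z.1 0 i @[z --> z0] --> T a0 0 i.
  have ci : continuous (fun u => T u 0 i).
    by move=> u; exact: (@coord_cvg _ _ _ (nbhs u) _ T _ i (cT u)).
  exact: (@cvg_comp_fst R R (fun u => T u 0 i) z0 ci).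
have cTz' i : derive1 T z.1 0 i @[z --> z0] --> derive1 T a0 0 i.
  have ci : continuous (fun u => derive1 T u 0 i).
    by move=> u; exact: (@coord_cvg _ _ _ (nbhs u) _ (derive1 T) _ i (cT' u)).
  exact: (@cvg_comp_fst R R (fun u => derive1 T u 0 i) z0 ci).
have cDz : D z.1 @[z --> z0] --> D a0 by exact: cvg_comp_fst.
have cX : X z.1 z.2 @[z --> z0] --> X a0 Y0.
  apply: cvgM; last by apply: cvgV.
  by apply: cvgB => //; apply: cvgM => //; exact: cvg_snd.
have cX1 : X1 z.1 z.2 @[z --> z0] --> X1 a0 Y0.
  apply: cvgM; last by apply: cvgV; [rewrite mulf_neq0|apply: cvgM].
  apply: cvgB; apply: cvgM => //; apply: cvgB => //.
  - exact: cvg_comp_fst.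
  - by apply: cvgM => //; exact: cvg_snd.
  - by apply: cvgM => //; exact: cvg_snd.
have cQ : Q z @[z --> z0] --> k0.
  apply: rV_cvg => i; rewrite -(row2_eq j k0) -X0 -/j' -/Y0.
  have [->|->] : i = j \/ i = j' by rewrite /j'; move: i j {Tj j' X X1 dX Y0 X0 X10 m m0 Q z0 cTz cTz' cDz cX cX1}; do 2!apply: ord2P; auto.
    rewrite row2_same (_ : (fun z => Q z 0 j) = fun z => X z.1 z.2); first exact: cX.
    by apply/funext => z; exact: row2_same.
  rewrite row2_other (_ : (fun z => Q z 0 j') = snd); first exact: cvg_snd.
  by apply/funext => z; exact: row2_other.
have cQc : Q z - cin z.1 @[z --> z0] --> la *: normal a0.
  have -> : la *: normal a0 = k0 - cin a0 by rewrite /k0 addrAC subrr add0r.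
  by apply: cvgB => //; exact: cvg_comp_fst.
have cQn : dot (Q z - cin z.1) (normal z.1) @[z --> z0] --> dot (la *: normal a0) (normal a0).
  exact: (@dot_cvg _ _ (nbhs z0) _ (fun z => Q z - cin z.1) (fun z => normal z.1) _ _ cQc (@cvg_comp_fst R 'rV[R]_2 normal z0 (normal_continuous ann))).
have : \forall z \near z0, [/\ T z.1 0 j != 0, m <= `|X1 z.1 z.2|,
   0 < dot (Q z - cin z.1) (normal z.1) & `|Q z - cin z.1| < e].
  near=> z; split.
  - by near: z; move/cvgr_neq0: (cTz j); exact.
  - near: z; apply: (cvgr_ge _ (cvg_norm cX1)).
    by rewrite /m ltr_pdivrMr// ltr_pMr ?normr_gt0// ltrDl.
  - near: z; move/cvgr_gt: cQn; apply.
    by rewrite dotZl mulr_gt0// dot_normal_normal.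
  - by near: z; exact: (cvgr_lt _ (cvg_norm cQc)).
move=> /nbhs_ballP[r /= r0 Hr].
have {}Hr u y : `|u - a0| < r -> `|y - Y0| < r -> [/\ T u 0 j != 0, m <= `|X1 u y|,
   0 < dot (row2 j (X u y) y - cin u) (normal u) & `|row2 j (X u y) y - cin u| < e].
  by move=> ur yr; apply: (Hr (u, y)); split; rewrite /= /ball/= distrC.
have mr : 0 < m * r by exact: mulr_gt0.
have r2 : 0 < r / 2 by rewrite divr_gt0.
near=> a c => b /andP[ab bc].
have ar : `|a - a0| < r / 2.
  by rewrite distrC; near: a; exact: (@nbhsx_ballx _ _ a0).
have c0 : 0 < c by near: c; exact: nbhs_right_gt.
have cr : c < r / 2 by near: c; exact: nbhs_right_lt.
have cmr : c < m * r by near: c; exact: nbhs_right_lt.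
apply: (le_trans _ (swept_slices He r0 m0 _ dX Hr ar _)).
- rewrite lee_fin mulrAC; apply: ler_wpM2r; first by rewrite subr_ge0.
  exact: ltW.
- by move=> u y Tu; rewrite /X divfK// subrK.
- by rewrite ab (le_trans bc)// lerD2l ltW.
Unshelve. all: by end_near.
Qed.

End SweepRate.

(** * Workloads along a path of configurations *)

Lemma clopen_path (R : realType) (P : R -> Prop) (a b : R) : open [set t | P t] ->
  open [set t | ~ P t] -> P a -> P b.
Proof.
move=> oP onP Pa; apply: contrapT => nPb.
have E : `[Num.min a b, Num.max a b]%classic `&` [set t | P t] = `[Num.min a b, Num.max a b]%classic.
  apply: (@segment_connected R).
  - by exists a; split => //=; rewrite in_itv/= ge_min le_max lexx.
  - by exists [set t | P t].
  - exists [set t | P t] => //.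
    by rewrite (_ : [set t | P t] = ~` [set t | ~ P t]); [exact: open_closedC|
      apply/seteqP; split => t /=; [move=> ? ?|move=> /contrapT]].
have : (`[Num.min a b, Num.max a b]%classic `&` [set t | P t]) b.
  by rewrite E /= in_itv/= ge_min le_max lexx !orbT.
by case.
Qed.

Section WorkloadShift.
Variables (R : realType) (cin cout : R -> 'rV[R]_2) (Din Dout Omega : set 'rV[R]_2).
Hypothesis ann : annulus cin cout Din Dout Omega.
Variables (rho : 'rV[R]_2 -> R) (rho_min rho_max : R).
Hypothesis rho_min_gt0 : 0 < rho_min.
Hypothesis rho_bounds : forall q, Omega q -> rho_min <= rho q <= rho_max.
Hypothesis rho_meas : measurable_fun (@point R @^-1` Omega) (rho \o @point R).
Variable N : nat.
Hypothesis hN : (0 < N)%N.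
Implicit Types (q k : 'rV[R]_2) (u v a b c : R) (theta : 'rV[R]_N) (i j : 'I_N).

Let scin : smooth_closed_curve cin. Proof. by case: ann => -[]. Qed.

Notation barset := (barset cin Din Omega).
Notation swept := (swept cin Din Omega).
Notation bars := (@bars R cin Din Omega N).
Notation cell th i := (cell cin Omega (on_curve cin th) i).
Notation mass := (mass rho).

Lemma swept_int a b (m : int) : swept (a + m%:~R) (b + m%:~R) = swept a b.
Proof.
apply/seteqP; split => q [u uab bu].
  exists (u - m%:~R); first lra.
  by rewrite -mulrNz (barset_int ann).
by exists (u + m%:~R); [lra|rewrite (barset_int ann)].
Qed.

(** The local bounds become uniform over one period by compactness, and over the line by
    periodicity; the density contributes the factor [rho_min]. *)
Lemma sweep_rate : exists2 c : R, 0 < c & forall a b, a <= b <= a + c ->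
  c * (b - a) <= mass (swept a b).
Proof.
have /compact_near_coveringP H := @segment_compact R 0 1.
have [c [c0 Hc]] : exists c : R, 0 < c /\ forall a, `[0, 1]%classic a -> forall b, a <= b <= a + c ->
    ((c * (b - a))%:E <= area (@point R @^-1` swept a b))%E.
  have Hn := H R (0^'+ : set_system R) (fun c a => forall b, a <= b <= a + c ->
    ((c * (b - a))%:E <= area (@point R @^-1` swept a b))%E) _ (fun x _ => sweep_area_local ann x).
  near (0 : R)^'+ => c; exists c; split; first by near: c; exact: nbhs_right_gt.
  by near: c; exact: Hn.
have rc0 : 0 < rho_min * c by exact: mulr_gt0.
exists (Num.min c (rho_min * c)); first by rewrite lt_min c0.
move=> a b /andP[ab bc].
pose m := - Num.floor a; pose a' := a + m%:~R; pose b' := b + m%:~R.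
have /andP[f0 f1] := floor_itv a; rewrite intrD in f1.
have a01 : `[0, 1]%classic a' by rewrite /= in_itv/= /a' mulrNz; lra.
have bc' : a' <= b' <= a' + c.
  rewrite lerD2r ab /=; have : b <= a + c by rewrite (le_trans bc)// lerD2l ge_min lexx.
  by rewrite /b' /a'; lra.
have ms' : measurable (@point R @^-1` swept a' b') by exact: measurable_swept ann a' b'.
have sO : swept a' b' `<=` Omega by exact: sweptS.
have := Hc _ a01 _ bc'; rewrite -(fineK (area_fin ann ms' sO)) lee_fin => H1.
have H2 := mass_ge ann rho_min_gt0 rho_bounds rho_meas ms' sO.
rewrite -(swept_int a b m); apply: le_trans H2.
apply: (@le_trans _ _ (rho_min * (c * (b' - a')))); last by rewrite ler_pM2l.
rewrite mulrA (_ : b' - a' = b - a); last by rewrite /a' /b'; ring.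
by apply: ler_wpM2r; rewrite ?subr_ge0// ge_min lexx orbT.
Unshelve. all: by end_near.
Qed.

Lemma sweep_primitive : exists2 c : R, 0 < c & exists g : R -> R,
  [/\ forall a b, a <= b -> c * (b - a) <= g b - g a,
      forall u v, g (u + 1) - g u = g (v + 1) - g v &
      forall a b, a <= b <= a + 1 -> mass (swept a b) = g b - g a].
Proof.
have [c c0 Hc] := sweep_rate.
have [g [gE gp]] := @periodic_primitive R (fun a b => mass (swept a b))
  (mass_swept_add ann rho_min_gt0 rho_bounds rho_meas hN)
  (fun a b => congr1 mass (swept_periodic ann a b)).
exists c => //; exists g; split => [a b ab|//|a b ab]; last by rewrite gE.
have [d d0 [dc d1]] : exists2 d : R, 0 < d & d <= c /\ d <= 1.
  by exists (Num.min c 1); rewrite ?lt_min ?c0 ?ltr01// !ge_min !lexx orbT.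
have step x y : x <= y <= x + d -> c * (y - x) <= g y - g x.
  move=> /andP[xy yx]; rewrite gE; last by rewrite xy (le_trans yx)// lerD2l.
  by apply: Hc; rewrite xy (le_trans yx)// lerD2l.
(* The rate holds on short intervals only; increments of [g] add up, so chaining them covers any
   interval. *)
have steps (n : nat) x y : x <= y <= x + n%:R * d -> c * (y - x) <= g y - g x.
  elim: n x y => [|n IH] x y /andP[xy yx].
    have -> : x = y by lra.
    by rewrite !subrr mulr0.
  have [h|h] := leP y (x + d); first by apply: step; rewrite xy h.
  have H1 : c * (x + d - x) <= g (x + d) - g x by apply: step; lra.
  have H2 : c * (y - (x + d)) <= g y - g (x + d).
    apply: IH; rewrite (ltW h)/=; apply: le_trans yx _; rewrite -natr1; lra.
  by have := lerD H1 H2; congr (_ <= _); ring.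
apply: (steps (Num.truncn ((b - a) / d)).+1); rewrite ab /= -lerBlDl -ler_pdivrMr//.
by apply/ltW; apply: truncnS_gt.
Qed.

Lemma bars_swept theta : bars theta `<=` swept 0 1.
Proof.
move=> q [j _ bq]; have /andP[f0 f1] := floor_itv (theta 0 j); rewrite intrD in f1.
exists (theta 0 j + (- Num.floor (theta 0 j))%:~R); first by rewrite mulrNz; lra.
by rewrite (barset_int ann).
Qed.

(** A point on no bar lies in exactly one cell at every time, and lying in a given cell is an open
    condition in time; so the set of times spent in cell [i] is clopen. *)
Lemma cell_const (Theta : R -> 'rV[R]_N) i a b : continuous Theta ->
  (forall t, ordered (Theta t)) ->
  (forall t, partition_config cin Omega (on_curve cin (Theta t))) ->
  cell (Theta a) i `\` swept 0 1 `<=` cell (Theta b) i `\` swept 0 1.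
Proof.
move=> cT o pc q [cq nq].
have oP j : open [set t | cell (Theta t) j q].
  rewrite openE => t ct; rewrite /interior.
  have H := cell_theta_open ann (o t) ct.
  exact: (filterS (fun u (h : ordered (Theta u) -> _) => h (o u)) (cT t _ H)).
split; last exact: nq.
apply: (@clopen_path R (fun t => cell (Theta t) i q) a b); [exact: oP| |exact: cq].
rewrite (_ : mkset _ = \bigcup_(j in [set j | j != i]) [set t | cell (Theta t) j q]).
  exact: bigcup_open.
have Oq : Omega q by have [] := cell_sub ann (o a) cq.
apply/seteqP; split => t /=.
  move=> nc; have [_ _ cover] := pc t.
  have : (off_bars cin Omega (on_curve cin (Theta t))) q.
    rewrite (off_barsE ann); split; first exact: Oq.
    by move=> bq; apply: nq; exact: bars_swept bq.
  rewrite cover => -[j _ cj]; exists j; last exact: cj.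
  by apply/eqP => E; apply: nc; rewrite -E.
move=> [j /= /eqP ji cj ci]; apply: ji; have [_ tI _] := pc t.
by apply: (tI j i I I); exists q.
Qed.

(* The part of a cell swept by no bar does not depend on the configuration, so
   the workload changes only through the two bars of the cell. *)
Lemma workload_shift (g : R -> R) (Theta : R -> 'rV[R]_N) i a b :
  (forall u v, g (u + 1) - g u = g (v + 1) - g v) ->
  (forall a b, a <= b <= a + 1 -> mass (swept a b) = g b - g a) ->
  continuous Theta -> (forall t, ordered (Theta t)) ->
  (forall t, partition_config cin Omega (on_curve cin (Theta t))) ->
  workload cin Omega rho (on_curve cin (Theta b)) i -
  workload cin Omega rho (on_curve cin (Theta a)) i =
  (g (Theta b 0 (ordS i)) - g (Theta a 0 (ordS i))) - (g (Theta b 0 i) - g (Theta a 0 i)).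
Proof.
move=> gp gE cT o pc.
have W t := etrans (workload_cell ann rho_min_gt0 rho_bounds rho_meas i (o t) (pc t))
  (cell_swept ann rho_min_gt0 rho_bounds rho_meas hN i (o t) (pc t)).
have C := congr1 (mass) (iffRL (seteqP _ _)
  (conj (@cell_const Theta i b a cT o pc) (@cell_const Theta i a b cT o pc))).
have aux (wa wb ma mb ca cb : R) : wa = ma + ca -> wb = mb + cb -> cb = ca -> wb - wa = mb - ma.
  by move=> -> -> ->; ring.
apply: (etrans (aux _ _ _ _ _ _ (W a) (W b) C)) => {W C aux}.
rewrite !gE; first 1 last.
- by have /andP[/ltW -> ->] := next_bounds i (o a).
- by have /andP[/ltW -> ->] := next_bounds i (o b).
(* For the last cell the second bar is lifted by one period, which shifts [g] by the same amount at
   both times. *)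
rewrite /next; case: (i.+1 == N) => /=; rewrite ?addr0; last by ring.
by have := gp (Theta b 0 (ordS i)) (Theta a 0 (ordS i)); lra.
Qed.

End WorkloadShift.

(** * Lifting configurations to the parameter line *)

Lemma int_lt1_eq0 (R : realType) (k : int) : `|k%:~R : R| < 1 -> k = 0.
Proof.
rewrite ltr_norml => /andP[k1 k2].
have : (-1 : R) = (-1)%:~R by []. move=> E; rewrite E ltr_int in k1.
rewrite ltrz1 in k2; lia.
Qed.

Ltac minmax := rewrite /Order.max /Order.min; repeat case: ifPn; rewrite -?leNgt; intros; lra.

Lemma continuous_comp_fun (T U V : topologicalType) (f : T -> U) (g : U -> V) :
  continuous f -> continuous g -> continuous (fun t => g (f t)).
Proof. by move=> cf cg t; apply: continuous_comp; [exact: cf|exact: cg]. Qed.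

Section Clamp.
Variable R : realType.
Implicit Types (t T x y z : R).

(** Freezes time outside [0, T], so that lifts over [0, T] are handled as continuous functions on
    the whole line. *)
Definition clamp (T t : R) : R := Num.max 0 (Num.min t T).

Lemma clamp_id T t : 0 <= t <= T -> clamp T t = t.
Proof. by move=> /andP[t0 tT]; rewrite /clamp min_l// max_r. Qed.

Lemma clamp_ge0 T t : 0 <= clamp T t.
Proof. by rewrite le_max lexx. Qed.

Lemma clamp_continuous T : continuous (clamp T).
Proof.
move=> t; apply: (@continuous_max _ _ (fun=> 0) (fun t => Num.min t T)); first exact: cvg_cst.
by apply: (@continuous_min _ _ id (fun=> T)); [exact: cvg_id|exact: cvg_cst].
Qed.

Lemma clamp0 T : clamp T 0 = 0.
Proof. rewrite /clamp; minmax. Qed.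

Lemma clampK T T' t : T <= T' -> clamp T' (clamp T t) = clamp T t.
Proof. move=> TT; rewrite /clamp; minmax. Qed.

Lemma clamp_maxxx x y : x < y -> clamp y (Num.max x x) = clamp x x.
Proof. move=> xy; rewrite /clamp; minmax. Qed.

Lemma clamp_neg x y : x < 0 -> clamp y (Num.max 0 x) = clamp y (Num.max x x).
Proof. move=> x0; rewrite /clamp; minmax. Qed.

Lemma clamp_widen x y t : t <= x -> x < y -> clamp x t = clamp y t.
Proof. move=> tx xy; rewrite /clamp; minmax. Qed.

Lemma clamp_past x t : x < t -> clamp x t = clamp x x.
Proof. move=> xt; rewrite /clamp; minmax. Qed.

Lemma min_max_itv x y t : x < y -> x <= Num.min (Num.max t x) y <= y.
Proof. move=> xy; minmax. Qed.

End Clamp.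

Section Lift.
Variables (R : realType) (c : R -> 'rV[R]_2).
Hypothesis sc : smooth_closed_curve c.

(** Choose the parameter within 1/4 of [u0]. Two such parameters differ by less than 1/2, so the
    integer ambiguity between nearby times is below 1 in absolute value and vanishes, which gives
    continuity. *)
Lemma short_lift : exists2 e : R, 0 < e & forall gamma : R -> 'rV[R]_2, continuous gamma ->
  (forall t, exists u, gamma t = c u) -> forall t0 u0, c u0 = gamma t0 ->
  (forall t, `|gamma t - gamma t0| < e) -> exists l : R -> R,
  [/\ continuous l, forall t, c (l t) = gamma t & forall t, gamma t = gamma t0 -> l t = u0].
Proof.
have d0 : 0 < 4^-1 :> R by [].
have [e e0 He] := curve_inj_mod sc d0.
exists e => // gamma cg gc t0 u0 gu0 ge.
have /choice[l Hl] : forall t, exists l, c l = gamma t /\ `|l - u0| < 4^-1.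
  move=> t; have [u gu] := gc t.
  have [k Hk] : exists k : int, `|u - u0 - k%:~R| < 4^-1 by apply: He; rewrite -gu gu0.
  exists (u - k%:~R); split; first by rewrite -mulrNz periodic_int//; case: sc.
  by rewrite addrAC.
exists l; split.
- move=> t; apply/cvgrPdist_lt => r r0.
  have r40 : 0 < Num.min r 4^-1 by rewrite lt_min r0.
  have [e' e'0 He'] := curve_inj_mod sc r40.
  have := cg t; move=> /cvgrPdist_lt /(_ _ e'0); apply: filterS => t' gt'.
  have [k Hk] : exists k : int, `|l t - l t' - k%:~R| < Num.min r 4^-1.
    by apply: He'; rewrite (Hl t).1 (Hl t').1.
  have k0 : k = 0.
    apply: (@int_lt1_eq0 R).
    move: Hk (Hl t).2 (Hl t').2; rewrite lt_min => /andP[_].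
    by rewrite !ltr_norml => /andP[? ?] /andP[? ?] /andP[? ?]; apply/andP; split; lra.
  by move: Hk; rewrite k0 subr0 lt_min => /andP[].
- by move=> t; have [] := Hl t.
- move=> t gt; have [k E] : exists k : int, l t = u0 + k%:~R.
    by apply: (curve_eq_mod sc); rewrite (Hl t).1 gt gu0.
  suff k0 : k = 0 by rewrite E k0 addr0.
  apply: (@int_lt1_eq0 R); have := (Hl t).2; rewrite E addrAC subrr add0r => h.
  by apply: lt_trans h _; rewrite invf_lt1// ltr1n.
Qed.

(** The set of [T] for which a lift exists is clopen, and every negative [T] belongs to it because
    the clamped path is then constant. *)
Lemma path_lift (gamma : R -> 'rV[R]_2) u0 T : continuous gamma ->
  (forall t, exists u, gamma t = c u) -> c u0 = gamma 0 ->
  exists l : R -> R, [/\ continuous l, l 0 = u0 & forall t, c (l t) = gamma (clamp T t)].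
Proof.
move=> cg gc g0.
pose P T := exists l : R -> R, [/\ continuous l, l 0 = u0 & forall t, c (l t) = gamma (clamp T t)].
have [e e0 SL] := short_lift.
have cgm : continuous (fun z : R => gamma (Num.max 0 z)).
  apply: (@continuous_comp_fun R R _ (fun z => Num.max 0 z) gamma _ cg) => z.
  by apply: (@continuous_max _ _ (fun=> 0) id); [exact: cvg_cst|exact: cvg_id].
have ext x y : (forall z, x <= z <= y -> `|gamma (Num.max 0 z) - gamma (Num.max 0 x)| < e) ->
    P x -> P y.
  move=> Hz [l [cl l0 lE]].
  have [yx|xy] := leP y x.
    exists (fun t => l (clamp y t)); split.
    - exact: (continuous_comp_fun (@clamp_continuous R y) cl).
    - by rewrite clamp0.
    - by move=> t; rewrite lE clampK.
  (* The piece of the path between times [x] and [y], frozen outside. Its short lift starts at the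
     end value of the lift up to [x], and the two are glued by adding increments. *)
  pose beta t := gamma (clamp y (Num.max t x)).
  have bE t : exists2 z, x <= z <= y & beta t = gamma (Num.max 0 z).
    by exists (Num.min (Num.max t x) y) => //; exact: min_max_itv.
  have bx : beta x = gamma (clamp x x).
    by rewrite /beta clamp_maxxx.
  have cb : continuous beta.
    apply: (@continuous_comp_fun R R _ (fun t => clamp y (Num.max t x)) gamma _ cg).
    apply: (@continuous_comp_fun R R R (fun t => Num.max t x) _ _ (@clamp_continuous R y)) => t.
    by apply: (@continuous_max _ _ id (fun=> x)); [exact: cvg_id|exact: cvg_cst].
  have [] := SL beta cb (fun t => gc _) x (l (clamp x x)) _ _.
  - by rewrite lE bx clampK.
  - move=> t; have [z zxy ->] := bE t; rewrite bx /clamp minxx; exact: Hz.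
  move=> b [cb' bl bx'].
  have bleft t : t <= x -> b t = l (clamp x x).
    by move=> tx; apply: bx'; rewrite /beta max_r ?maxxx.
  exists (fun t => l (clamp x t) + (b t - l (clamp x x))); split.
  - move=> t; apply: cvgD; last by apply: cvgB; [exact: cb'|exact: cvg_cst].
    exact: (continuous_comp_fun (@clamp_continuous R x) cl).
  - have [x0|x0] := leP 0 x.
      by rewrite bleft// subrr addr0 clamp_id ?lexx.
    have -> : b 0 = l (clamp x x).
      by apply: bx'; rewrite /beta clamp_neg.
    by rewrite subrr addr0 clamp0.
  - move=> t; have [tx|xt] := leP t x.
      by rewrite bleft// subrr addr0 lE clampK// (clamp_widen tx xy).
    rewrite (clamp_past xt); by rewrite addrC subrK bl /beta max_l// ltW.
have loc x : \forall y \near x, (P x -> P y) /\ (P y -> P x).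
  have e2 : 0 < e / 2 by rewrite divr_gt0.
  have := cgm x; move=> /cvgrPdist_lt /(_ _ e2) /nbhs_ballP[d /= d0 Hd].
  apply/nbhs_ballP; exists d => //= y xy.
  have key z z' : `|x - z| < d -> `|x - z'| < d -> `|gamma (Num.max 0 z) - gamma (Num.max 0 z')| < e.
    move=> /Hd /= hz /Hd /= hz'.
    rewrite (splitr e); apply: le_lt_trans (ler_distD (gamma (Num.max 0 x)) _ _) _.
    by apply: ltrD => //; rewrite distrC.
  have xx : `|x - x| < d by rewrite subrr normr0.
  rewrite /ball/= in xy.
  split; apply: ext => z zxy; apply: key => //.
  - move: xy; rewrite !ltr_norml => /andP[? ?]; apply/andP; split; lra.
  - move: xy; rewrite !ltr_norml => /andP[? ?]; apply/andP; split; lra.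
apply: (@clopen_path R P (-1) T).
- rewrite openE => x Px; apply: filterS (loc x) => y [h _]; exact: h.
- rewrite openE => x nPx; apply: filterS (loc x) => y [_ h] Py; exact: nPx (h Py).
exists (fun=> u0); split => // [t|t]; first exact: cvg_cst.
by rewrite g0 /clamp max_l// ge_min lerN10 orbT.
Qed.

End Lift.

Section ConfigLift.
Variables (R : realType) (cin cout : R -> 'rV[R]_2) (Din Dout Omega : set 'rV[R]_2).
Hypothesis ann : annulus cin cout Din Dout Omega.
Variable N : nat.

Let scin : smooth_closed_curve cin. Proof. by case: ann => -[]. Qed.

Lemma config_lift (s : R -> 'M[R]_(N, 2)) (T : R) (theta0 : 'rV[R]_N) :
  (forall i, continuous (fun t => row i (s t))) -> (forall t, partition_config cin Omega (s t)) ->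
  ordered theta0 -> s 0 = on_curve cin theta0 ->
  exists Theta : R -> 'rV[R]_N, [/\ continuous Theta, Theta 0 = theta0,
    forall t, ordered (Theta t) & forall t, s (clamp T t) = on_curve cin (Theta t)].
Proof.
move=> cs pc o0 s0.
have sE t i : exists u, row i (s t) = cin u.
  by have [th -> _] := partition_ordered (pc t); exists (th 0 i); rewrite row_on_curve.
have /choice[l Hl] : forall i, exists l : R -> R, [/\ continuous l, l 0 = theta0 0 i &
    forall t, cin (l t) = row i (s (clamp T t))].
  move=> i; apply: (path_lift scin (gamma := fun t => row i (s t))) => //.
  by rewrite s0 row_on_curve.
pose Theta t : 'rV[R]_N := \row_i l i t.
have ThE t : s (clamp T t) = on_curve cin (Theta t).
  by apply/row_matrixP => i; rewrite row_on_curve mxE; have [_ _ ->] := Hl i.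
exists Theta; split => //.
- move=> t; apply: rV_cvg => j; rewrite mxE; under eq_fun do rewrite mxE.
  by have [+ _ _] := Hl j; exact.
- by apply/rowP => j; rewrite mxE; have [] := Hl j.
move=> t i j ij; rewrite !mxE.
pose d t := l j t - l i t.
have cd : continuous d.
  by move=> t'; apply: cvgB; [have [+ _ _] := Hl j|have [+ _ _] := Hl i]; exact.
(* Two lifts at distance 0 or 1 would be the same base point, against the ordering of the
   configuration at that time. Hence [d] cannot leave ]0, 1[. *)
have dn t' : d t' != 0 /\ d t' != 1.
  have [th E oth] := partition_ordered (pc (clamp T t')).
  have Ek k : exists m : int, l k t' = th 0 k + m%:~R.
    by apply: (curve_eq_mod scin); have [_ _ ->] := Hl k; rewrite E row_on_curve.
  have [mi Ei] := Ek i; have [mj Ej] := Ek j; have [h1 h2] := oth _ _ ij.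
  rewrite /d Ei Ej; split; apply/eqP => H.
    have : `|(mi - mj)%:~R : R| < 1 by rewrite intrD mulrNz ltr_norml; lra.
    move=> /int_lt1_eq0 E0; have : (mi - mj)%:~R = 0 :> R by rewrite E0.
    rewrite intrD mulrNz; lra.
  have : `|(mi + 1 - mj)%:~R : R| < 1 by rewrite !intrD mulrNz ltr_norml; lra.
  move=> /int_lt1_eq0 E0; have : (mi + 1 - mj)%:~R = 0 :> R by rewrite E0.
  rewrite !intrD mulrNz; lra.
suff /andP[d0t d1t] : 0 < d t < 1 by rewrite /d in d0t d1t; split; lra.
apply: (@clopen_path R (fun t => 0 < d t < 1) 0 t).
- rewrite (_ : mkset _ = d @^-1` `]0, 1[%classic).
    by apply: open_comp => //; exact: interval_open.
  by apply/seteqP; split => x /=; rewrite in_itv.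
- rewrite (_ : mkset _ = d @^-1` [set x | x < 0] `|` d @^-1` [set x | 1 < x]).
    apply: openU; apply: open_comp; [by move=> z _; exact: cd|exact: open_lt|by move=> z _; exact: cd|exact: open_gt].
  apply/seteqP; split => x /=.
    have [d0 d1] := dn x => /negP; rewrite negb_and -!leNgt => /orP[] h; [left|right];
      by rewrite lt_neqAle h ?d0// eq_sym d1.
  by move=> h /andP[h1 h2]; case: h => h; [have := lt_trans h h1|have := lt_trans h h2]; rewrite ltxx.
have [_ li _] := Hl i; have [_ lj _] := Hl j; have [h1 h2] := o0 _ _ ij.
rewrite /d li lj; apply/andP; split; lra.
Qed.

End ConfigLift.

(** * Decay of the cyclic system *)

Lemma is_derive_expM (R : realType) (c t : R) :
  is_derive t 1 (fun s => expR (c * s)) (c * expR (c * t)).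
Proof.
have H1 : is_derive t 1 (fun s : R => c * s) (c * 1) := is_deriveZ c (is_derive_id t 1).
have [d v] := is_derive1_comp (is_derive_expR (c * t)) H1.
by apply: DeriveDef; [exact: d|rewrite v mulr1 mulrC].
Qed.

(** The function Y e^(kt) + K / (d - k) e^(-(d - k)t) is nonincreasing: its second term compensates
    the forcing, which decays faster than the homogeneous rate. *)
Lemma gronwall_exp (R : realType) (Y Y1 : R -> R) (a b k K d : R) : a <= b ->
  {within `[a, b], continuous Y} -> (forall t, a < t < b -> is_derive t 1 Y (Y1 t)) ->
  (forall t, a < t < b -> Y1 t <= - k * Y t + K * expR (- d * t)) ->
  0 <= K -> k < d ->
  Y b * expR (k * b) <= Y a * expR (k * a) + K / (d - k) * expR (- (d - k) * a).
Proof.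
move=> ab cY dY HY K0 kd.
have dk : 0 < d - k by lra.
have Kd : 0 <= K / (d - k) by rewrite divr_ge0// ltW.
pose G t := Y t * expR (k * t) + K / (d - k) * expR (- (d - k) * t).
suff GG : G b <= G a.
  apply: le_trans GG; rewrite /G lerDl; apply: mulr_ge0 => //; exact: expR_ge0.
move: ab; rewrite le_eqVlt => /predU1P[->//|ab].
have dG t : a < t < b -> is_derive t 1 G (Y t * (k * expR (k * t)) + expR (k * t) * Y1 t +
    K / (d - k) * (- (d - k) * expR (- (d - k) * t))).
  move=> tab.
  exact: (is_deriveD (is_deriveM (dY t tab) (is_derive_expM k t))
    (is_deriveZ (K / (d - k)) (is_derive_expM (- (d - k)) t))).
have ce c : continuous (fun t : R => expR (c * t)).
  by move=> t; apply: differentiable_continuous; apply/derivable1_diffP; have [] := is_derive_expM c t.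
have cG : {within `[a, b], continuous G}.
  move=> t; apply: cvgD; first by apply: cvgM; [exact: cY|exact: (continuous_subspaceT (ce k))].
  by apply: cvgM; [exact: cvg_cst|exact: (continuous_subspaceT (ce _))].
have dG' t : t \in `]a, b[ -> is_derive t 1 G (Y t * (k * expR (k * t)) + expR (k * t) * Y1 t +
    K / (d - k) * (- (d - k) * expR (- (d - k) * t))).
  by rewrite in_itv/= => tab; exact: dG.
have [c] := MVT ab dG' cG; rewrite in_itv/= => cab GE; rewrite -subr_le0 GE pmulr_lle0 ?subr_gt0//.
have E : expR (- (d - k) * c) = expR (k * c) * expR (- d * c).
  by rewrite -expRD; congr expR; ring.
have -> : Y c * (k * expR (k * c)) + expR (k * c) * Y1 c + K / (d - k) * (- (d - k) * expR (- (d - k) * c)) =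
   expR (k * c) * (k * Y c + Y1 c - K * expR (- d * c)).
  by rewrite E; field; rewrite gt_eqF.
rewrite pmulr_rle0 ?expR_gt0//; have := HY c cab; lra.
Qed.

Section CyclicSums.
Variables (R : realType) (N : nat).
Implicit Types (D e x : 'I_N -> R) (i k : 'I_N).

Lemma sum_ord_pred (F : 'I_N -> R) : \sum_i F (ord_pred i) = \sum_i F i.
Proof. by rewrite [RHS](reindex_inj (@ord_pred_inj N)). Qed.

Definition psum D k : R := \sum_(j : 'I_N | (j <= k)%N) D j.
(** On vectors of zero sum this inverts the cyclic difference, normalized to mean zero. *)
Definition centered D k : R := psum D k - N%:R^-1 * \sum_i psum D i.

Lemma psum_pred D k : \sum_i D i = 0 -> psum D k - psum D (ord_pred k) = D k.
Proof.
move=> D0; case: (posnP k) => k0.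
  have -> : psum D k = D k.
    rewrite /psum (bigD1 k)//= big1 ?addr0// => j /andP[jk /eqP jk']; case: jk'.
    by apply/val_inj => /=; move: jk; rewrite [in RHS]k0 k0 leqn0 => /eqP.
  have -> : psum D (ord_pred k) = \sum_i D i.
    apply: eq_bigl => j; rewrite /= k0 add0n modn_small ?ltn_predL; have := ltn_ord j; lia.
  by rewrite D0 subr0.
have Ep : ord_pred k = k.-1 :> nat.
  rewrite /= -subn1 -addnBAC// subn1 modnDr modn_small//; have := ltn_ord k; lia.
rewrite {1}/psum (bigD1 k)//= -addrA -[RHS]addr0; congr (_ + _); apply/eqP; rewrite subr_eq0; apply/eqP.
by apply: eq_bigl => j; rewrite Ep -val_eqE /=; lia.
Qed.

Lemma centered_pred D k : \sum_i D i = 0 -> centered D k - centered D (ord_pred k) = D k.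
Proof. by move=> /(psum_pred k) <-; rewrite /centered; ring. Qed.

Lemma sum_centered D : \sum_i centered D i = 0.
Proof.
rewrite /centered big_split /= sumr_const card_ord; case: (posnP N) => [N0|N0].
  by rewrite big1 ?N0 ?mulr0n ?addr0// => i; have := ltn_ord i; rewrite {2}N0.
by rewrite mulNrn -[X in _ - X]mulr_natl mulrA divff ?mul1r ?subrr// pnatr_eq0; lia.
Qed.

Lemma cyclic_const (f : 'I_N -> R) i k : (forall j, f j = f (ord_pred j)) -> f i = f k.
Proof.
move=> H.
have [z z0] : exists z : 'I_N, z = 0%N :> nat.
  have N0 : (0 < N)%N by have := ltn_ord i; lia.
  by exists (Ordinal N0).
have f0 (n : nat) (j : 'I_N) : j = n :> nat -> f j = f z.
  elim: n j => [|n IH] j jn; first by congr f; apply/val_inj; rewrite /= jn z0.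
  rewrite H; apply: IH; rewrite /= jn /= modnDr modn_small//; have := ltn_ord j; lia.
by rewrite (f0 _ i erefl) (f0 _ k erefl).
Qed.

Lemma sum_by_parts e x : \sum_i e i * (x (ordS i) - x i) =
  - \sum_i x i * (e i - e (ord_pred i)).
Proof.
under eq_bigr do rewrite mulrBr; rewrite big_split /= -sum_ord_pred.
have -> : \sum_i e (ord_pred i) * x (ordS (ord_pred i)) = \sum_i e (ord_pred i) * x i.
  by apply: eq_bigr => i _; rewrite ord_predK.
rewrite -big_split -sumrN /=; apply: eq_bigr => i _; ring.
Qed.

Lemma sum_sqr_le_centered D : \sum_i D i = 0 ->
  \sum_i D i ^+ 2 <= 4 * \sum_i centered D i ^+ 2.
Proof.
move=> D0; set e := centered D.
have -> : 4 * \sum_i e i ^+ 2 = \sum_i 2 * (e i ^+ 2 + e (ord_pred i) ^+ 2).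
  rewrite -mulr_sumr big_split /= (sum_ord_pred (fun i => e i ^+ 2)); ring.
apply: ler_sum => i _; rewrite -(centered_pred i D0) -/e.
by have := sqr_ge0 (e i + e (ord_pred i)); rewrite !expr2; lra.
Qed.

(** Every entry is at most the Euclidean norm [d], so a partial sum and the mean of the partial sums
    are each at most [N d]. *)
Lemma centered_sqr_le D k : centered D k ^+ 2 <= 4 * N%:R ^+ 2 * \sum_i D i ^+ 2.
Proof.
set d := Num.sqrt (\sum_i D i ^+ 2).
have S0 : 0 <= \sum_i D i ^+ 2 by apply: sumr_ge0 => i _; exact: sqr_ge0.
have d0 : 0 <= d by exact: sqrtr_ge0.
have N0 : 0 < N%:R :> R by rewrite ltr0n; have := ltn_ord k; lia.
have Dd i : `|D i| <= d.
  rewrite -ler_sqr ?nnegrE// sqr_sqrtr// real_normK ?num_real//.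
  by rewrite (bigD1 i)//= lerDl; apply: sumr_ge0 => j _; exact: sqr_ge0.
have Pd i : `|psum D i| <= N%:R * d.
  apply: le_trans (ler_norm_sum _ _ _) _.
  apply: (@le_trans _ _ (\sum_(j : 'I_N) d)).
    rewrite [leLHS]big_mkcond /=; apply: ler_sum => j _; by case: ifP.
  by rewrite sumr_const card_ord mulr_natl.
have Md : `|N%:R^-1 * (\sum_i psum D i)| <= N%:R * d.
  rewrite mulrC normrM normfV (ger0_norm (ltW N0)) ler_pdivrMr//.
  apply: le_trans (ler_norm_sum _ _ _) _.
  apply: (@le_trans _ _ (\sum_(j : 'I_N) N%:R * d)); first by apply: ler_sum.
  by rewrite sumr_const card_ord mulr_natr.
have H : `|centered D k| <= 2 * (N%:R * d).
  by apply: le_trans (ler_normB _ _) _; have := Pd k; lra.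
have H2 : 0 <= 2 * (N%:R * d) by rewrite !mulr_ge0// ltW.
rewrite -(real_normK (num_real (centered D k))) -[X in _ <= _ * X](sqr_sqrtr S0) -/d.
apply: (@le_trans _ _ ((2 * (N%:R * d)) ^+ 2)); first by rewrite ler_sqr.
by rewrite !exprMn; lra.
Qed.

End CyclicSums.

Lemma is_derive_bigsum (R : realType) (I : Type) (r : seq I) (P : pred I) (F : I -> R -> R) (F' : I -> R) (t : R) :
  (forall i, P i -> is_derive t 1 (F i) (F' i)) ->
  is_derive t 1 (fun s => \sum_(i <- r | P i) F i s) (\sum_(i <- r | P i) F' i).
Proof.
move=> H; elim: r => [|i r IH].
  rewrite big_nil; under eq_fun do rewrite big_nil; exact: is_derive_cst.
rewrite big_cons; under eq_fun do rewrite big_cons; case: ifP => // Pi.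
by apply: is_deriveD => //; exact: H.
Qed.

Lemma cvg_bigsum (R : realType) (T : Type) (F : set_system T) (FF : Filter F) (I : Type)
    (r : seq I) (P : pred I) (f : I -> T -> R) (l : I -> R) :
  (forall i, f i x @[x --> F] --> l i) ->
  (\sum_(i <- r | P i) f i x) @[x --> F] --> \sum_(i <- r | P i) l i.
Proof.
move=> H; elim: r => [|i r IH].
  by rewrite big_nil; under eq_fun do rewrite big_nil; exact: cvg_cst.
rewrite big_cons; under eq_fun do rewrite big_cons; case: ifP => // Pi.
by apply: cvgD.
Qed.

Lemma is_derive_centered (R : realType) N (D : 'I_N -> R -> R) (D' : 'I_N -> R) k (t : R) :
  (forall i, is_derive t 1 (D i) (D' i)) ->
  is_derive t 1 (fun s => centered (D ^~ s) k) (centered D' k).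
Proof.
move=> H; have HP i : is_derive t 1 (fun s => psum (D ^~ s) i) (psum D' i).
  by apply: is_derive_bigsum => j _.
have HS : is_derive t 1 (fun s => \sum_i psum (D ^~ s) i) (\sum_i psum D' i).
  by apply: is_derive_bigsum.
exact: (is_deriveB (HP k) (is_deriveZ (N%:R^-1) HS)).
Qed.

(* The Lyapunov function is the sum of the squares of the centred partial sums
   of D: its derivative is - 2 kappa sum x_i D_i by summation by parts. *)
Lemma cyclic_decay (R : realType) N (D x : 'I_N -> R -> R) (kappa c L0 L : R) :
  0 < kappa -> 0 < c -> L0 <= L -> (0 < N)%N ->
  (forall i, {within `[L0, L], continuous (D i)}) ->
  (forall i t, L0 < t < L -> is_derive t 1 (D i)
    (kappa * ((x (ordS i) t - x i t) - (x i t - x (ord_pred i) t)))) ->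
  (forall i t, L0 < t < L -> c * D i t ^+ 2 <= x i t * D i t) ->
  (forall t, L0 <= t <= L -> \sum_i D i t = 0) ->
  forall a, a = kappa * c / (4 * N%:R ^+ 3) ->
  (\sum_i D i L ^+ 2) * expR (2 * a * L) <=
    16 * N%:R ^+ 3 * (\sum_i D i L0 ^+ 2) * expR (2 * a * L0).
Proof.
move=> k0 c0 L0L N0 cD dD Dx D0 a aE.
have Nn0 : 0 < N%:R :> R by rewrite ltr0n.
have N3 : 0 < N%:R ^+ 3 :> R by rewrite exprn_gt0.
pose e i t := centered (D ^~ t) i.
pose Y t := \sum_i e i t ^+ 2.
pose D' i t := kappa * ((x (ordS i) t - x i t) - (x i t - x (ord_pred i) t)).
pose Y1 t := \sum_i (e i t * centered (D' ^~ t) i + e i t * centered (D' ^~ t) i).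
have De i t : L0 < t < L -> is_derive t 1 (e i) (centered (D' ^~ t) i).
  by move=> tL; apply: is_derive_centered => j; exact: dD.
have dY t : L0 < t < L -> is_derive t 1 Y (Y1 t).
  move=> tL; apply: is_derive_bigsum => i _.
  exact: (is_deriveM (De i t tL) (De i t tL)).
have cY : {within `[L0, L], continuous Y}.
  move=> t; have ce i : e i x @[x --> nbhs (t : subspace `[L0, L])] --> e i t.
    apply: cvgB; first by apply: cvg_bigsum => j; exact: cD.
    apply: cvgM; first exact: cvg_cst.
    by apply: cvg_bigsum => l; apply: cvg_bigsum => j; exact: cD.
  by apply: cvg_bigsum => i; apply: cvgM.
have YD t : L0 <= t <= L -> Y t <= 4 * N%:R ^+ 3 * \sum_i D i t ^+ 2.
  move=> tL; apply: (@le_trans _ _ (\sum_(i : 'I_N) 4 * N%:R ^+ 2 * \sum_i D i t ^+ 2)).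
    by apply: ler_sum => i _; exact: centered_sqr_le.
  rewrite sumr_const card_ord -mulr_natl le_eqVlt; apply/orP; left; apply/eqP; ring.
have HY t : L0 < t < L -> Y1 t <= - (2 * a) * Y t + 0 * expR (- (2 * a + 1) * t).
  move=> tL; rewrite mul0r addr0.
  have tL' : L0 <= t <= L by case/andP: tL => /ltW -> /ltW ->.
  have D'0 : \sum_i D' i t = 0.
    rewrite -mulr_sumr sumrB -(sum_ord_pred (fun i => x (ordS i) t - x i t)).
    rewrite -sumrB big1 ?mulr0// => i _; rewrite ord_predK; ring.
  pose w i := x (ordS i) t - x i t.
  (* [D'] is the cyclic difference of [kappa * w], so its centred sums equal [kappa * w] up to a
     constant; the constant drops out against [e], whose sum is zero. *)
  have cst i j : centered (D' ^~ t) i - kappa * w i = centered (D' ^~ t) j - kappa * w j.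
    apply: (@cyclic_const _ _ (fun i => centered (D' ^~ t) i - kappa * w i)) => l.
    have H : centered (D' ^~ t) l - centered (D' ^~ t) (ord_pred l) =
      kappa * ((x (ordS l) t - x l t) - (x l t - x (ord_pred l) t)) := centered_pred l D'0.
    by rewrite /w ord_predK; lra.
  pose i0 : 'I_N := Ordinal N0.
  have Ce i : centered (D' ^~ t) i = kappa * w i + (centered (D' ^~ t) i0 - kappa * w i0).
    by rewrite -(cst i); ring.
  have -> : Y1 t = - (2 * kappa) * \sum_i x i t * D i t.
    rewrite /Y1; under eq_bigr do rewrite Ce.
    set b := _ - _.
    have -> : \sum_i (e i t * (kappa * w i + b) + e i t * (kappa * w i + b)) =
       2 * kappa * (\sum_i e i t * w i) + 2 * b * \sum_i e i t.
      by rewrite !mulr_sumr -big_split; apply: eq_bigr => i _ /=; ring.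
    rewrite sum_centered mulr0 addr0 (sum_by_parts (e ^~ t) (x ^~ t)).
    under [X in - X]eq_bigr do rewrite (centered_pred _ (D0 _ tL')).
    ring.
  have H1 : c * \sum_i D i t ^+ 2 <= \sum_i x i t * D i t.
    by rewrite mulr_sumr; apply: ler_sum => i _; exact: Dx.
  have H2 := YD t tL'.
  have H3 : 2 * a * Y t <= 2 * kappa * (c * \sum_i D i t ^+ 2).
    apply: (@le_trans _ _ (2 * a * (4 * N%:R ^+ 3 * \sum_i D i t ^+ 2))).
      apply: ler_wpM2l => //; rewrite aE mulr_ge0// divr_ge0// ?mulr_ge0// ltW//.
    rewrite le_eqVlt; apply/orP; left; apply/eqP; rewrite aE; field.
    by rewrite gt_eqF.
  have H4 : 2 * kappa * (c * \sum_i D i t ^+ 2) <= 2 * kappa * \sum_i x i t * D i t.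
    by apply: ler_wpM2l => //; rewrite mulr_ge0// ltW.
  lra.
(* There is no forcing: K = 0, and any rate above 2a may stand for [d]. *)
have := gronwall_exp L0L cY dY HY (lexx 0) (_ : 2 * a < 2 * a + 1).
rewrite ltrDl ltr01 => /(_ isT); rewrite mul0r mul0r addr0 => H.
have HL : L0 <= L <= L by rewrite L0L lexx.
have H0 : L0 <= L0 <= L by rewrite L0L lexx.
apply: (@le_trans _ _ (4 * (Y L * expR (2 * a * L)))).
  rewrite mulrA; apply: ler_wpM2r; first exact: expR_ge0.
  by apply: sum_sqr_le_centered; exact: D0.
apply: (@le_trans _ _ (4 * (Y L0 * expR (2 * a * L0)))); first by rewrite ler_pM2l.
rewrite !mulrA; apply: ler_wpM2r; first exact: expR_ge0.
have := YD L0 H0; lra.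
Qed.

(** * Partition dynamics *)

(** Project both curves on the tangent [T0]. Carathéodory slopes [g] of the parametrization and [k]
    of [gamma] give l(s) - l(t) = (k / g)(s - t), and [g] is nonzero near [l t]; no local inverse is
    needed. *)
Lemma lift_derive (R : realType) (c gamma : R -> 'rV[R]_2) (l : R -> R) (t v : R) :
  smooth_closed_curve c -> {for t, continuous l} -> (\forall t' \near t, c (l t') = gamma t') ->
  is_derive t 1 gamma (v *: derive1 c (l t)) -> is_derive t 1 l v.
Proof.
move=> sc cl cE dg.
pose T0 := derive1 c (l t).
have T0n : dot T0 T0 != 0 by rewrite dot_eq0; have [_ /(_ (l t))] := sc.
have cstd (t' : R) (w : 'rV[R]_2) : is_derive t' (1 : R) (fun=> w) 0 := is_derive_cst w t' 1.
have dk : is_derive t 1 (fun s => dot (gamma s) T0) (v * dot T0 T0).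
  have [d e] := is_derive_dot dg (cstd t T0).
  by apply: DeriveDef; [exact: d|rewrite e dotZl (dotC _ 0) dot0l addr0].
have dp : is_derive (l t) 1 (fun u => dot (c u) T0) (dot T0 T0).
  have [d e] := is_derive_dot (smooth_curve_is_derive sc (l t)) (cstd (l t) T0).
  by apply: DeriveDef; [exact: d|rewrite e (dotC _ 0) dot0l addr0].
have [g [gE cg g0]] := (is_derive1_caratheodory _ _ _).1 dp.
have [k [kE ck k0]] := (is_derive1_caratheodory _ _ _).1 dk.
have cgl : g (l s) @[s --> t] --> g (l t) by exact: continuous_comp cl cg.
have gn : g (l t) != 0 by rewrite g0.
have H : \forall s \near t, l s = l t + (k s / g (l s)) * (s - t).
  have := nbhs_singleton cE => ct.
  near=> s.
  have gs : g (l s) != 0 by near: s; move/cvgr_neq0: cgl; exact.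
  have cs : c (l s) = gamma s by near: s.
  have : g (l s) * (l s - l t) = k s * (s - t) by rewrite -gE -kE cs ct.
  move=> E; rewrite mulrAC -E; field; exact: gs.
have -> : v = k t / g (l t) by rewrite k0 g0; field.
have ht := nbhs_singleton cE.
apply/is_derive1_caratheodory.
exists (fun s => if s == t then k t / g (l t) else (l s - l t) / (s - t)); split.
- move=> z; case: eqP => [->|/eqP zt]; first by rewrite !subrr mulr0.
  by rewrite divfK// subr_eq0.
- have ckg : k s / g (l s) @[s --> t] --> k t / g (l t) by apply: cvgM => //; apply: cvgV.
  rewrite /prop_for /continuous_at /= eqxx; apply: cvg_trans ckg; apply: near_eq_cvg.
  apply: filterS H => s E; case: eqP => [->//|/eqP st].
  have -> : l s - l t = k s / g (l s) * (s - t) by rewrite {1}E addrAC subrr add0r.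
  by rewrite mulfK// subr_eq0.
- by rewrite eqxx.
Unshelve. all: by end_near.
Qed.

Lemma speed_bounds (R : realType) (c : R -> 'rV[R]_2) : smooth_closed_curve c ->
  exists m M : R, 0 < m /\ forall u, m <= enorm (derive1 c u) <= M.
Proof.
move=> sc; have cT := smooth_curve_derive1_continuous sc.
have cs : {within `[0, 1], continuous (fun u => enorm (derive1 c u))}.
  apply: continuous_subspaceT => u.
  exact: (@enorm_cvg _ _ (nbhs u) _ (derive1 c) _ (cT u)).
have [a _ Ha] := EVT_min ler01 cs; have [b _ Hb] := EVT_max ler01 cs.
exists (enorm (derive1 c a)), (enorm (derive1 c b)); split.
  by rewrite enorm_gt0; have [_ /(_ a)] := sc.
move=> u; have E : derive1 c (u + (- Num.floor u)%:~R) = derive1 c u.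
  apply: (derive1_same sc); apply: periodic_int; by case: sc.
have /andP[f0 f1] := floor_itv u; rewrite intrD in f1.
have u01 : u + (- Num.floor u)%:~R \in `[0, 1] by rewrite in_itv/= mulrNz; lra.
have h1 := Ha _ u01; have h2 := Hb _ u01.
apply: (eq_ind _ (fun w => enorm (derive1 c a) <= enorm w <= enorm (derive1 c b)) _ _ E).
by apply/andP; split; [exact: h1|exact: h2].
Qed.

Lemma row_cvg (R : realType) m n (T : Type) (F : set_system T) (FF : Filter F)
    (f : T -> 'M[R]_(m, n)) (l : 'M[R]_(m, n)) i :
  f x @[x --> F] --> l -> row i (f x) @[x --> F] --> row i l.
Proof.
move=> fl; apply: rV_cvg => j; rewrite mxE; under eq_fun do rewrite mxE.
apply: (@continuous_cvg _ _ _ F FF f (fun v : 'M[R]_(m, n) => v i j)) => //.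
exact: coord_continuous.
Qed.

Lemma continuous_extend_left (R : realType) (V : topologicalType) (f : R -> V) :
  {within `[0, +oo[, continuous f} -> continuous (fun t : R => f (Num.max 0 t)).
Proof.
move=> /subspace_continuousP cf t.
have mt (u : R) : `[0, +oo[%classic (Num.max 0 u) by rewrite /= in_itv/= andbT le_max lexx.
apply: cvg_comp (cf _ (mt t)).
move=> A HA; have cm : continuous (fun t : R => Num.max 0 t).
  by move=> u; apply: (@continuous_max _ _ (fun=> 0) id); [exact: cvg_cst|exact: cvg_id].
exact: (filterS (fun u (h : `[0, +oo[%classic (Num.max 0 u) -> A (Num.max 0 u)) => h (mt u)) (cm t _ HA)).
Qed.

Section Dynamics.
Variables (R : realType) (cin cout : R -> 'rV[R]_2) (Din Dout Omega : set 'rV[R]_2).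
Hypothesis ann : annulus cin cout Din Dout Omega.
Variables (rho : 'rV[R]_2 -> R) (rho_min rho_max : R).
Hypothesis rho_min_gt0 : 0 < rho_min.
Hypothesis rho_bounds : forall q, Omega q -> rho_min <= rho q <= rho_max.
Hypothesis rho_meas : measurable_fun (@point R @^-1` Omega) (rho \o @point R).
Variable N : nat.
Hypothesis hN : (0 < N)%N.
Variables (kappa : R) (s : R -> 'M[R]_(N, 2)).
Hypothesis kappa_gt0 : 0 < kappa.
Hypothesis s_cont : {within `[0, +oo[, continuous s}.
Hypothesis s_part : forall t : R, 0 <= t -> partition_config cin Omega (s t).
Hypothesis s_ode : forall (t : R) (i : 'I_N), 0 < t ->
  is_derive t 1 (fun t' => row i (s t'))
    (- (kappa * (workload cin Omega rho (s t) i - workload cin Omega rho (s t) (ord_pred i)))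
       *: nu cin (row i (s t))).
Implicit Types (i j : 'I_N) (t T : R).

Let scin : smooth_closed_curve cin. Proof. by case: ann => -[]. Qed.

Definition vel t i : R := kappa * (workload cin Omega rho (s t) i - workload cin Omega rho (s t) (ord_pred i)).

(** The minus sign of the dynamics cancels that of [nu], so the lift moves with arc-length velocity
    [vel]. Freezing time at [T] keeps the partition conditions valid for all t. *)
Lemma s_lift T (theta0 : 'rV[R]_N) : ordered theta0 -> s 0 = on_curve cin theta0 ->
  exists Theta : R -> 'rV[R]_N, [/\ continuous Theta /\ Theta 0 = theta0,
    forall t, ordered (Theta t),
    forall t, partition_config cin Omega (on_curve cin (Theta t)),
    forall t, 0 <= t <= T -> s t = on_curve cin (Theta t) &
    forall t i, 0 < t < T -> is_derive t 1 (fun t => Theta t 0 i)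
      (vel t i / enorm (derive1 cin (Theta t 0 i)))].
Proof.
move=> o0 s0.
have pc t : partition_config cin Omega (s (Num.max 0 t)) by apply: s_part; rewrite le_max lexx.
have cs i : continuous (fun t : R => row i (s (Num.max 0 t))).
  move=> t; apply: row_cvg; exact: (continuous_extend_left s_cont).
have s0' : s (Num.max 0 0) = on_curve cin theta0 by rewrite maxxx.
have [ Theta [cT T0 ordT ThE]] := config_lift ann T cs pc o0 s0'.
have {}ThE t : s (clamp T t) = on_curve cin (Theta t).
  by rewrite -ThE max_r// clamp_ge0.
have ThE' t : 0 <= t <= T -> s t = on_curve cin (Theta t).
  by move=> tT; rewrite -ThE clamp_id.
exists Theta; split; [by split|exact: ordT| |exact: ThE'|].
  by move=> t; rewrite -ThE; apply: s_part; exact: clamp_ge0.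
move=> t i /andP[t0 tT].
have tT' : 0 <= t <= T by rewrite !ltW.
apply: (lift_derive scin (gamma := fun t' => row i (s t'))).
- exact: (@coord_cvg _ _ _ (nbhs t) _ Theta _ i (cT t)).
- have : \forall t' \near t, t' \in `]0, T[ by apply: near_in_itvoo; rewrite in_itv/= t0.
  apply: filterS => t'; rewrite in_itv/= => /andP[h0 h1].
  by rewrite (ThE' t') ?row_on_curve// !ltW.
- have := s_ode i t0; rewrite {3}(ThE' t tT') row_on_curve (nuE ann).
  by rewrite -/(vel t i) scalerN scaleNr opprK scalerA.
Qed.

Lemma workload_bounds t i : 0 <= t ->
  0 <= workload cin Omega rho (s t) i <= mass rho Omega.
Proof.
move=> t0; have pc := s_part t0; have [th E o] := partition_ordered pc; rewrite E in pc *.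
rewrite (workload_cell ann rho_min_gt0 rho_bounds rho_meas i o pc).
set C := cell _ _ _ _.
have mC : measurable (@point R @^-1` C) := measurable_cell ann i o pc.
have mO := measurable_Omega ann.
have CO : C `<=` Omega by move=> q /(cell_sub ann o)[].
have pos (A : set 'rV[R]_2) : measurable (@point R @^-1` A) -> A `<=` Omega -> 0 <= mass rho A.
  move=> mA AO; apply: le_trans (mass_ge ann rho_min_gt0 rho_bounds rho_meas mA AO).
  by rewrite mulr_ge0 ?fine_ge0// ltW.
rewrite pos//=.
have mD : measurable (@point R @^-1` (Omega `\` C)) by apply: measurableD.
have DO : Omega `\` C `<=` Omega by move=> q [].
have -> : Omega = C `|` (Omega `\` C) by rewrite setDUK.
rewrite (massU ann rho_min_gt0 rho_bounds rho_meas mC mD CO DO) ?lerDl ?pos//.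
by apply/seteqP; split => // q [? [_]].
Qed.

Lemma vel_bound t i : 0 <= t -> `|vel t i| <= kappa * mass rho Omega.
Proof.
move=> t0; rewrite normrM gtr0_norm// ler_pM2l//.
have /andP[a0 a1] := workload_bounds i t0; have /andP[b0 b1] := workload_bounds (ord_pred i) t0.
by rewrite ler_norml; apply/andP; split; lra.
Qed.

Lemma sum_vel t : \sum_i vel t i = 0.
Proof.
rewrite -mulr_sumr sumrB (sum_ord_pred (fun i => workload cin Omega rho (s t) i)).
by rewrite subrr mulr0.
Qed.

(* The arc lengths D_i travelled by the base points during a time lag d satisfy
   the hypotheses of cyclic_decay, x_i being the mass swept by the i-th bar; the
   velocities are recovered as d tends to 0. *)
Lemma vel_decay : exists a C : R, [/\ 0 < a, 0 <= C & forall t0 t1, 0 < t0 -> t0 <= t1 ->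
  (\sum_i vel t1 i ^+ 2) * expR (2 * a * t1) <= C * (\sum_i vel t0 i ^+ 2) * expR (2 * a * t0)].
Proof.
have [m [M [m0 Hm]]] := speed_bounds scin.
have M0 : 0 < M by have /andP[h1 h2] := Hm 0; lra.
have [c c0 [g [gc gp gE]]] := sweep_primitive ann rho_min_gt0 rho_bounds rho_meas hN.
have Nn0 : 0 < N%:R :> R by rewrite ltr0n.
(* The constant of [cyclic_decay] is c / M: a parameter increment u sweeps mass at least c u while
   its arc length is at most M u. *)
pose a := kappa * (c / M) / (4 * N%:R ^+ 3).
exists a, (16 * N%:R ^+ 3); split.
- by rewrite !(divr_gt0, mulr_gt0, exprn_gt0).
- by rewrite mulr_ge0// exprn_ge0// ltW.
move=> t0 t1 t00 t01.
(* Leaves room for a lag of at most 1 after [t1]. *)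
pose T := t1 + 2.
have T0 : 0 <= T by rewrite /T; lra.
have [theta0 s0 o0] := partition_ordered (s_part (lexx 0)).
have [ Theta [cT0 ordT pT ThE dT]] := s_lift T o0 s0; have [cT _] := cT0.
have [B B0 HB] : exists2 B : R, 0 < B & forall t i, 0 <= t <= T -> `|Theta t 0 i| < B.
  have K : compact (Theta @` `[0, T]).
    by apply: continuous_compact; [exact: continuous_subspaceT|exact: segment_compact].
  have [B [_ HB]] := compact_bounded K.
  exists (`|B| + 2) => [|t i tT]; first by have := normr_ge0 B; lra.
  have BB : B < `|B| + 1 by have := ler_norm B; lra.
  have := HB _ BB (Theta t) (ex_intro2 _ _ t _ erefl).
  move=> /(_ tT) h; apply: le_lt_trans (coord_le_norm _ i) _.
  by apply: le_lt_trans h _; lra.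
have cen : continuous (fun u => enorm (derive1 cin u)).
  move=> u; apply: enorm_cvg; exact: smooth_curve_derive1_continuous scin u.
(* [A] is arc length along the inner curve, so [A (Theta t 0 i)] has derivative exactly
   [vel t i]. *)
have [A dA] := continuous_antiderivative (- B) B cen.
have rng t i : 0 <= t <= T -> - B < Theta t 0 i < B.
  by move=> tT; rewrite -ltr_norml; exact: HB.
have A_mono u v : - B < u -> u <= v -> v < B -> 0 <= A v - A u <= M * (v - u).
  move=> Bu; rewrite le_eqVlt => /predU1P[->|uv vB]; first by rewrite !subrr mulr0 lexx.
  have cA : {within `[u, v], continuous A}.
    apply: derivable_within_continuous => w; rewrite in_itv/= => /andP[w0 w1].
    by have [] := dA w _; rewrite ?(lt_le_trans Bu w0) ?(le_lt_trans w1 vB).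
  have dA' w : w \in `]u, v[ -> is_derive w 1 A (enorm (derive1 cin w)).
    rewrite in_itv/= => /andP[w0 w1]; apply: dA.
    by rewrite (lt_trans Bu w0) (lt_trans w1 vB).
  have [w _ ->] := MVT uv dA' cA.
  have /andP[h1 h2] := Hm w.
  rewrite ler_pM2r ?subr_gt0// h2 andbT mulr_ge0 ?subr_ge0 ?ltW//; lra.
have dAT t i : 0 < t < T -> is_derive t 1 (fun t => A (Theta t 0 i)) (vel t i).
  move=> tT; have tT' : 0 <= t <= T by case/andP: tT => /ltW -> /ltW ->.
  have [d v] := is_derive1_comp (dA _ (rng t i tT')) (dT t i tT).
  apply: DeriveDef; [exact: d|rewrite v].
  have /andP[h1 _] := Hm (Theta t 0 i).
  by field; rewrite gt_eqF// (lt_le_trans m0).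
(* The velocities sum to zero, so the total arc length is conserved and the [D] sum to zero. *)
have Fcst t d : 0 < t -> 0 < d -> t + d < T ->
    \sum_i (A (Theta (t + d) 0 i) - A (Theta t 0 i)) = 0.
  move=> tp dp tdT.
  pose F t := \sum_i A (Theta t 0 i).
  have dF r : 0 < r < T -> is_derive r 1 F 0.
    by move=> rT; rewrite -(sum_vel r); apply: is_derive_bigsum => i _; exact: dAT.
  have ltd : t < t + d by rewrite ltrDl.
  have cF : {within `[t, t + d], continuous F}.
    apply: derivable_within_continuous => w; rewrite in_itv/= => /andP[w0 w1].
    by have [] := dF w _; rewrite ?(lt_le_trans tp w0) ?(le_lt_trans w1 tdT).
  have dF' w : w \in `]t, t + d[ -> is_derive w 1 F 0.
    rewrite in_itv/= => /andP[w0 w1]; apply: dF.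
    by rewrite (lt_trans tp w0) (lt_trans w1 tdT).
  have [w _] := MVT ltd dF' cF.
  by rewrite mul0r /F -sumrB.
pose D (d : R) i t := A (Theta (t + d) 0 i) - A (Theta t 0 i).
have key d : 0 < d -> d <= 1 ->
   (\sum_i D d i t1 ^+ 2) * expR (2 * a * t1) <=
    16 * N%:R ^+ 3 * (\sum_i D d i t0 ^+ 2) * expR (2 * a * t0).
  move=> d0 d1.
  have win t : t0 <= t <= t1 -> [/\ 0 < t < T, 0 < t + d < T, 0 <= t <= T & 0 <= t + d <= T].
    by move=> /andP[? ?]; rewrite /T; split; apply/andP; split; lra.
  pose x i t := g (Theta (t + d) 0 i) - g (Theta t 0 i).
  have dD i t : t0 <= t <= t1 -> is_derive t 1 (D d i) (vel (t + d) i - vel t i).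
    move=> /win[tT tdT _ _].
    have sh : is_derive t (1 : R) (fun t => t + d) 1.
      by have [e v] := is_deriveD (is_derive_id t 1) (is_derive_cst d t 1); apply: DeriveDef; [exact: e|rewrite v addr0].
    have [e v] := @is_derive1_comp R (fun t => A (Theta t 0 i)) (fun r => r + d) t _ _ (dAT _ i tdT) sh.
    have H : is_derive t 1 (fun t => A (Theta (t + d) 0 i)) (vel (t + d) i).
      by apply: DeriveDef; [exact: e|rewrite v mulr1].
    exact: is_deriveB H (dAT t i tT).
  have sh i t : t0 <= t <= t1 -> workload cin Omega rho (s (t + d)) i - workload cin Omega rho (s t) i =
      x (ordS i) t - x i t.
    move=> /win[_ _ tT tdT]; rewrite (ThE _ tT) (ThE _ tdT).
    exact: (workload_shift ann rho_min_gt0 rho_bounds rho_meas hN i t (t + d) gp gE cT ordT pT).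
  have aux (w1 w2 w3 w4 x1 x2 x3 : R) : w1 - w2 = x1 - x2 -> w3 - w4 = x2 - x3 ->
      kappa * (w1 - w3) - kappa * (w2 - w4) = kappa * (x1 - x2 - (x2 - x3)).
    by move=> <- <-; ring.
  apply: (@cyclic_decay R N (D d) x kappa (c / M) t0 t1) => //.
  - by rewrite divr_gt0.
  - move=> i; apply: derivable_within_continuous => t; rewrite in_itv/= => tt.
    by have [] := dD i t tt.
  - move=> i t /andP[h0 h1]; have tt : t0 <= t <= t1 by rewrite !ltW.
    have <- : vel (t + d) i - vel t i = kappa * (x (ordS i) t - x i t - (x i t - x (ord_pred i) t)).
      have E := sh (ord_pred i) t tt; rewrite ord_predK in E.
      exact: aux (sh i t tt) E.
    exact: dD.
  - move=> i t /andP[h0 h1]; have tt : t0 <= t <= t1 by rewrite !ltW.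
    have [_ _ tT tdT] := win t tt.
    have /andP[r1 r2] := rng _ i tT; have /andP[r3 r4] := rng _ i tdT.
    rewrite mulrAC ler_pdivrMr// expr2 /x /D.
    have [uv|/ltW vu] := leP (Theta t 0 i) (Theta (t + d) 0 i).
      have /andP[p1 p2] := A_mono _ _ r1 uv r4; have q1 := gc _ _ uv.
      set dA_ := A _ - A _ in p1 p2 *; set dg_ := g _ - g _ in q1 *.
      set du := _ - _ in p2 q1.
      have : c * dA_ <= M * dg_ by have := ler_wpM2l (ltW M0) q1; have := ler_wpM2l (ltW c0) p2; lra.
      by move=> /(ler_wpM2r p1); lra.
    have /andP[p1 p2] := A_mono _ _ r3 vu r2; have q1 := gc _ _ vu.
    rewrite -(opprB (A (Theta t 0 i))) -(opprB (g (Theta t 0 i))).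
    set dA_ := A _ - A _ in p1 p2 *; set dg_ := g _ - g _ in q1 *.
    set du := _ - _ in p2 q1.
    have : c * dA_ <= M * dg_ by have := ler_wpM2l (ltW M0) q1; have := ler_wpM2l (ltW c0) p2; lra.
    by move=> /(ler_wpM2r p1); lra.
  - by move=> t /win[/andP[h1 _] /andP[_ h2] _ _]; exact: Fcst.
(* With d = 1 / (n + 1), inequality [key] multiplied by (n + 1)^2 compares squared difference
   quotients, which tend to the squared velocities. *)
have cvgD t : 0 < t < T ->
    (fun n : nat => \sum_i (D n.+1%:R^-1 i t * n.+1%:R) ^+ 2) @ \oo --> \sum_i vel t i ^+ 2.
  move=> tT; apply: cvg_bigsum => i; rewrite expr2.
  under eq_fun do rewrite expr2.
  by apply: cvgM; exact: (diffquot_cvg (dAT t i tT)).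
have t0T : 0 < t0 < T by rewrite /T; apply/andP; split; lra.
have t1T : 0 < t1 < T by rewrite /T; apply/andP; split; lra.
have cstc (r : R) : (fun _ : nat => r) @ \oo --> r by exact: cvg_cst.
have L1 : (fun n : nat => (\sum_i (D n.+1%:R^-1 i t1 * n.+1%:R) ^+ 2) * expR (2 * a * t1)) @ \oo -->
    (\sum_i vel t1 i ^+ 2) * expR (2 * a * t1).
  by apply: cvgM; [exact: cvgD|exact: cstc].
have L0 : (fun n : nat => 16 * N%:R ^+ 3 * (\sum_i (D n.+1%:R^-1 i t0 * n.+1%:R) ^+ 2) * expR (2 * a * t0))
    @ \oo --> 16 * N%:R ^+ 3 * (\sum_i vel t0 i ^+ 2) * expR (2 * a * t0).
  by apply: cvgM; [apply: cvgM; [exact: cstc|exact: cvgD]|exact: cstc].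
apply: (ler_cvg_to L1 L0).
near=> n.
have n0 : 0 < n.+1%:R :> R by rewrite ltr0n.
have := key n.+1%:R^-1 _ _; rewrite invr_gt0 invf_le1// ler1n => /(_ n0 isT).
have sc t : \sum_i (D n.+1%:R^-1 i t * n.+1%:R) ^+ 2 = n.+1%:R ^+ 2 * \sum_i D n.+1%:R^-1 i t ^+ 2.
  by rewrite mulr_sumr; apply: eq_bigr => i _; rewrite exprMn mulrC.
rewrite /= !sc => H.
have n2 : 0 <= n.+1%:R ^+ 2 :> R by exact: exprn_ge0.
by have := ler_wpM2l n2 H; rewrite !mulrA [16 * _ * _]mulrC !mulrA; congr (_ <= _); ring.
Unshelve. all: by end_near.
Qed.

Lemma vel_exp : exists a C : R, [/\ 0 < a, 0 <= C & forall t i, 0 < t -> `|vel t i| <= C * expR (- a * t)].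
Proof.
have [a [C [a0 C0 H]]] := vel_decay.
pose V := kappa * mass rho Omega.
have i0 : 'I_N := Ordinal hN.
have V0 : 0 <= V by apply: le_trans (vel_bound i0 (lexx 0)).
(* The decay is started at time 1, as the dynamics holds at positive times only; hence the factor
   [expR a], and K >= 1 for the times before. Afterwards K^2 >= C N is what the squared estimate
   requires. *)
pose K := 1 + C * N%:R.
have CN : 0 <= C * N%:R by rewrite mulr_ge0.
have e0 (r : R) : 0 < expR r by exact: expR_gt0.
have K0 : 0 <= K by rewrite /K addr_ge0.
exists a, (K * V * expR a); split => //; first by apply: mulr_ge0; [exact: mulr_ge0|exact: expR_ge0].
move=> t i t0; rewrite -mulrA -expRD.
have [t1|t1] := leP t 1.
  apply: (@le_trans _ _ V); first by apply: vel_bound; exact: ltW.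
  apply: (@le_trans _ _ (1 * V * 1)); first by rewrite mul1r mulr1.
  apply: ler_pM; rewrite ?mul1r//; first by rewrite ler_peMl// /K lerDl.
  have h : a * t <= a * 1 by rewrite ler_pM2l.
  by rewrite -expR0 ler_expR; lra.
have H1 := H 1 t ltr01 (ltW t1).
have KV : 0 <= K * V by rewrite mulr_ge0.
have KVe : 0 <= K * V * expR (a + - a * t) by apply: mulr_ge0; [exact: KV|exact: expR_ge0].
rewrite -ler_sqr; [|exact: normr_ge0|exact: KVe].
have E2 : expR (a + - a * t) ^+ 2 = expR ((a + - a * t) * 2) by rewrite expr2 -expRD; congr expR; ring.
rewrite (real_normK (num_real _)) (exprMn 2 (K * V)) E2.
have vi : vel t i ^+ 2 <= \sum_i vel t i ^+ 2.
  by rewrite (bigD1 i)//= lerDl; apply: sumr_ge0 => j _; exact: sqr_ge0.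
have v1 : \sum_i vel 1 i ^+ 2 <= N%:R * V ^+ 2.
  apply: (@le_trans _ _ (\sum_(i : 'I_N) V ^+ 2)); last by rewrite sumr_const card_ord mulr_natl.
  apply: ler_sum => j _; rewrite -(real_normK (num_real _)) ler_sqr ?nnegrE//.
  exact: vel_bound ler01.
apply: (le_trans vi); rewrite -(ler_pM2r (e0 (2 * a * t))); apply: (le_trans H1).
rewrite -[leRHS]mulrA -expRD.
have -> : (a + - a * t) * 2 + 2 * a * t = 2 * a * 1 by ring.
rewrite ler_pM2r//.
apply: (@le_trans _ _ (C * (N%:R * V ^+ 2))); first by apply: ler_wpM2l.
rewrite mulrA (exprMn 2 K); apply: ler_wpM2r; first exact: sqr_ge0.
rewrite /K; set r := C * N%:R in CN *.
have -> : (1 + r) ^+ 2 = r + (1 + r + r * r) by ring.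
by rewrite lerDl !addr_ge0// mulr_ge0.
Qed.

End Dynamics.

(** * Optimal positions along the trajectory *)

Lemma row_norm_le (R : realType) m n (A : 'M[R]_(m, n)) i : `|row i A| <= `|A|.
Proof.
rewrite [leLHS]/Num.norm/= mx_normrE; apply: bigmax_le => [|[k j] _]; first exact: normr_ge0.
rewrite !mxE [leRHS]/Num.norm/= /mx_norm.
exact: (le_bigmax _ (fun ij => `|A ij.1 ij.2|%:nng) (i, j)).
Qed.

Lemma is_derive_comp_rV (R : realType) n (W : normedModType R) (F : 'rV[R]_n -> W)
    (c : R -> 'rV[R]_n) (t : R) v :
  differentiable F (c t) -> is_derive t 1 c v ->
  is_derive t 1 (fun s => F (c s)) (\sum_j v 0 j *: 'D_(delta_mx 0 j) F (c t)).
Proof.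
move=> dF [dc Ev].
have dc' : differentiable c t by exact/derivable1_diffP.
have dFc : differentiable (F \o c) t by exact: differentiable_comp.
apply: DeriveDef; first exact/derivable1_diffP.
rewrite deriveE// diff_comp//= -[X in 'd F _ X]deriveE// Ev {1}(row_sum_delta v) linear_sum.
by apply: eq_bigr => j _; rewrite linearZ /= deriveE.
Qed.

(** Adding (C / a) e^(-at) to f or to -f gives a nonincreasing function. *)
Lemma exp_increment (R : realType) (f f1 : R -> R) (a C x y : R) : 0 < a -> 0 <= C -> x <= y ->
  {within `[x, y], continuous f} -> (forall t, x < t < y -> is_derive t 1 f (f1 t)) ->
  (forall t, x < t < y -> `|f1 t| <= C * expR (- a * t)) ->
  `|f y - f x| <= C / a * expR (- a * x).
Proof.
move=> a0 C0; rewrite le_eqVlt => /predU1P[->|xy] cf df bf.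
  by rewrite subrr normr0 mulr_ge0 ?expR_ge0// divr_ge0// ltW.
pose e (t : R) : R := C / a * expR (- a * t).
have de (t : R) : is_derive t (1 : R) e (- (C * expR (- a * t))).
  have [d v] := is_deriveZ (C / a) (is_derive_expM (- a) t).
  apply: DeriveDef; [exact: d|rewrite v /GRing.scale/=].
  by field; rewrite gt_eqF.
have ce : continuous e.
  by move=> t; apply: differentiable_continuous; apply/derivable1_diffP; have [] := de t.
have key (s : R) : `|s| <= 1 -> s * (f y - f x) <= e x - e y.
  move=> s1; rewrite -subr_le0.
  pose G t := s * f t + e t.
  have dG t : t \in `]x, y[ -> is_derive t 1 G (s * f1 t - C * expR (- a * t)).
    by rewrite in_itv/= => txy; exact: (is_deriveD (is_deriveZ s (df t txy)) (de t)).
  have cG : {within `[x, y], continuous G}.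
    move=> t; apply: cvgD; last exact: (continuous_subspaceT ce).
    by apply: cvgM; [exact: cvg_cst|exact: cf].
  have [t] := MVT xy dG cG; rewrite in_itv/= => txy GE.
  have -> : s * (f y - f x) - (e x - e y) = G y - G x by rewrite /G; ring.
  rewrite GE pmulr_lle0 ?subr_gt0// subr_le0; apply: le_trans (bf t txy).
  apply: le_trans (ler_norm _) _; rewrite normrM ler_piMl//.
have ey : 0 <= e y by rewrite mulr_ge0 ?expR_ge0// divr_ge0// ltW.
rewrite -/(e x) ler_norml; apply/andP; split.
  by have := key (-1) _; rewrite normrN normr1 => /(_ (lexx _)); lra.
by have := key 1 _; rewrite normr1 => /(_ (lexx _)); lra.
Qed.

Section OptimalPath.
Variables (R : realType) (cin cout : R -> 'rV[R]_2) (Din Dout Omega : set 'rV[R]_2).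
Hypothesis ann : annulus cin cout Din Dout Omega.
Variables (rho : 'rV[R]_2 -> R) (rho_min rho_max : R).
Hypothesis rho_min_gt0 : 0 < rho_min.
Hypothesis rho_bounds : forall q, Omega q -> rho_min <= rho q <= rho_max.
Hypothesis rho_meas : measurable_fun (@point R @^-1` Omega) (rho \o @point R).
Variable N : nat.
Hypothesis hN : (0 < N)%N.
Variables (kappa : R) (s : R -> 'M[R]_(N, 2)).
Hypothesis kappa_gt0 : 0 < kappa.
Hypothesis s_cont : {within `[0, +oo[, continuous s}.
Hypothesis s_part : forall t : R, 0 <= t -> partition_config cin Omega (s t).
Hypothesis s_ode : forall (t : R) (i : 'I_N), 0 < t ->
  is_derive t 1 (fun t' => row i (s t'))
    (- (kappa * (workload cin Omega rho (s t) i - workload cin Omega rho (s t) (ord_pred i)))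
       *: nu cin (row i (s t))).
Variables (h : 'rV[R]_2 -> R) (qstar : 'M[R]_(N, 2) -> 'M[R]_(N, 2)).
Hypothesis h_cont : continuous h.
Hypothesis q_pos : forall s', closure (s @` `[0, +oo[) s' -> forall i, 0 < h (row i (qstar s')).
Hypothesis qstar_C1 : forall theta : 'rV[R]_N, closure (s @` `[0, +oo[) (on_curve cin theta) ->
  Ck_at 1 (fun theta' => qstar (on_curve cin theta')) theta.
Implicit Types (i j : 'I_N) (t T : R).

Let scin : smooth_closed_curve cin. Proof. by case: ann => -[]. Qed.
Let F (theta : 'rV[R]_N) := qstar (on_curve cin theta).

Lemma on_curve_continuous : continuous (fun theta : 'rV[R]_N => on_curve cin theta).
Proof.
move=> theta; apply: (@mx_cvg _ _ _ _ (nbhs (theta : 'rV[R]_N))) => i j.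
rewrite mxE; under eq_fun do rewrite mxE.
apply: (@coord_cvg _ _ _ (nbhs (theta : 'rV[R]_N)) _ (fun theta' : 'rV[R]_N => cin (theta' 0 i))).
apply: (@continuous_cvg _ _ _ (nbhs (theta : 'rV[R]_N)) _ (fun theta' : 'rV[R]_N => theta' 0 i) cin).
  exact: smooth_curve_continuous scin _.
exact: coord_continuous.
Qed.

(** The exponential decay makes the total displacement of each lifted base point finite, with a
    bound [B] independent of the horizon [T]. *)
Lemma lift_bounded (theta0 : 'rV[R]_N) : ordered theta0 -> s 0 = on_curve cin theta0 ->
  exists B : R, forall T, 0 <= T -> exists Th : R -> 'rV[R]_N,
  [/\ continuous Th, forall t, 0 <= t <= T -> s t = on_curve cin (Th t),
    forall t i, 0 < t < T -> is_derive t 1 (fun t => Th t 0 i)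
      (vel cin Omega rho kappa s t i / enorm (derive1 cin (Th t 0 i))) &
    forall t i, 0 <= t <= T -> theta0 0 i - B <= Th t 0 i <= theta0 0 i + B].
Proof.
move=> o0 s0.
have [a [C [a0 C0 HC]]] := vel_exp ann rho_min_gt0 rho_bounds rho_meas hN kappa_gt0 s_cont s_part s_ode.
have [m [M [m0 Hm]]] := speed_bounds scin.
exists (C / m / a) => T T0.
have [Th [cT0 ordT pT ThE dT]] := s_lift ann s_cont s_part s_ode T o0 s0; have [cT Th0] := cT0.
exists Th; split; [exact: cT|exact: ThE|exact: dT|].
move=> t i /andP[t0 tT].
have Cm : 0 <= C / m by rewrite divr_ge0// ltW.
have : `|Th t 0 i - Th 0 0 i| <= C / m / a * expR (- a * 0).
  apply: (@exp_increment _ (fun t => Th t 0 i)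
    (fun t => vel cin Omega rho kappa s t i / enorm (derive1 cin (Th t 0 i)))) => //.
  - by apply: continuous_subspaceT => r; exact: (@coord_cvg _ _ _ (nbhs r) _ Th _ i (cT r)).
  - by move=> r /andP[r0 rt]; apply: dT; rewrite r0 (lt_le_trans rt).
  - move=> r /andP[r0 rt]; rewrite normrM normfV (ger0_norm (enorm_ge0 _)).
    have /andP[h1 _] := Hm (Th r 0 i).
    rewrite mulrAC; apply: ler_pM; rewrite ?invr_ge0 ?enorm_ge0//; first exact: HC.
    by rewrite lef_pV2 ?posrE// (lt_le_trans m0).
rewrite mulr0 expR0 mulr1 Th0 ler_norml => /andP[? ?]; apply/andP; split; lra.
Qed.

(** The configurations of [K] in the closure of the trajectory form a compact set. Positivity of [h]
    and continuity of the first derivatives hold at each of them, so the bounds are uniform. *)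
Lemma qstar_uniform (K : set 'rV[R]_N) : compact K ->
  exists M c : R, [/\ 0 <= M, 0 < c & forall theta, K theta ->
    closure (s @` `[0, +oo[) (on_curve cin theta) ->
    [/\ differentiable F theta, forall j, `|'D_(delta_mx 0 j) F theta| <= M &
      forall i, c <= h (row i (F theta))]].
Proof.
move=> cK.
pose K' := K `&` (on_curve cin @^-1` closure (s @` `[0, +oo[)).
have cK' : compact K'.
  apply: compact_closedI => //; apply: closed_comp; last exact: closed_closure.
  by move=> th _; exact: on_curve_continuous.
have /compact_near_coveringP cov := cK'.
have P1 i th : K' th -> \forall th' \near (th : 'rV[R]_N) & c \near (0 : R)^'+, c <= h (row i (F th')).
  move=> [Kth cl].
  have [/nbhs_singleton dF _] := qstar_C1 cl.
  have hF : h (row i (F th')) @[th' --> (th : 'rV[R]_N)] --> h (row i (F th)).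
    apply: (@continuous_cvg _ _ _ (nbhs (th : 'rV[R]_N)) _ (fun th' => row i (F th')) h); first exact: h_cont.
    apply: (@row_cvg _ _ _ _ (nbhs (th : 'rV[R]_N))).
    exact: differentiable_continuous.
  have hp : 0 < h (row i (F th)) := q_pos cl i.
  have h2 : h (row i (F th)) / 2 < h (row i (F th)) by lra.
  near=> th' c; rewrite /=.
  apply: (@le_trans _ _ (h (row i (F th)) / 2)).
    by near: c; apply: nbhs_right_le; rewrite divr_gt0.
  by near: th'; exact: (cvgr_ge _ hF).
have P2 j th : K' th -> \forall th' \near (th : 'rV[R]_N) & M \near (+oo : set_system R),
    `|'D_(delta_mx 0 j) F th'| <= M.
  move=> [Kth cl]; have [_ cD] := qstar_C1 cl.
  have /nbhs_singleton := cD (delta_mx 0 j); move=> /cvg_norm cDj.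
  near=> th' M; rewrite /=; apply: (@le_trans _ _ (`|'D_(delta_mx 0 j) F th| + 1)).
    by near: th'; apply: (cvgr_le _ cDj); rewrite ltrDl.
  by near: M; exact: nbhs_pinfty_ge.
have N1 i := cov R (0^'+ : set_system R) (fun c th => c <= h (row i (F th))) _ (P1 i).
have N2 j := cov R (+oo : set_system R) (fun M th => `|'D_(delta_mx 0 j) F th| <= M) _ (P2 j).
have [c [c0 Hc]] : exists c : R, 0 < c /\ forall i th, K' th -> c <= h (row i (F th)).
  near (0 : R)^'+ => c; exists c; split; first by near: c; exact: nbhs_right_gt.
  by near: c; apply: filter_forall => i; exact: N1.
have [M [M0 HM]] : exists M : R, 0 < M /\ forall j th, K' th -> `|'D_(delta_mx 0 j) F th| <= M.
  near (+oo : set_system R) => M; exists M; split; first by near: M; exact: nbhs_pinfty_gt.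
  by near: M; apply: filter_forall => j; exact: N2.
exists M, c; split => //; first exact: ltW.
move=> th Kth cl; have [/nbhs_singleton dF _] := qstar_C1 cl.
by split; [exact: dF|move=> j; exact: HM|move=> i; exact: Hc].
Unshelve. all: by end_near.
Qed.

(** Chain rule through the lift. A different lift is used for each horizon, but all of them stay in
    the same box, so the constants are common. *)
Lemma q_path : exists a C c : R, [/\ 0 < a /\ 0 <= C, 0 < c,
  forall t i, 0 <= t -> c <= h (row i (qstar (s t))),
  forall i, {within `[0, +oo[, continuous (fun t => row i (qstar (s t)))} &
  forall t i, 0 < t -> exists2 w, is_derive t 1 (fun t => row i (qstar (s t))) w &
     `|w| <= C * expR (- a * t)].
Proof.
have [a [C [a0 C0 HC]]] := vel_exp ann rho_min_gt0 rho_bounds rho_meas hN kappa_gt0 s_cont s_part s_ode.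
have [m [M [m0 Hm]]] := speed_bounds scin.
have [theta0 s0 o0] := partition_ordered (s_part (lexx 0)).
have [B HB] := lift_bounded o0 s0.
have cK := @rV_compact R N (fun i => `[theta0 0 i - B, theta0 0 i + B]%classic)
  (fun i => @segment_compact R _ _).
have [L [c [L0 c0 HL]]] := qstar_uniform cK.
have cl t : 0 <= t -> closure (s @` `[0, +oo[) (s t).
  by move=> t0; apply: subset_closure; exists t => //=; rewrite in_itv/= t0.
exists a, (N%:R * (C / m * L)), c; split; [split; first exact: a0|exact: c0| | |].
- by apply: mulr_ge0 => //; apply: mulr_ge0 => //; apply: divr_ge0 => //; exact: ltW.
- move=> t i t0; have [Th [cT ThE dT BT]] := HB t t0.
  have tt : 0 <= t <= t by rewrite t0 lexx.
  have Kt : [set v : 'rV[R]_N | forall i, `[theta0 0 i - B, theta0 0 i + B]%classic (v ord0 i)] (Th t).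
    by move=> k /=; rewrite in_itv/=; exact: BT.
  have clt := cl t t0; rewrite (ThE _ tt) in clt *.
  by have [_ _] := HL _ Kt clt; exact.
- move=> i; apply/subspace_continuousP => t /=; rewrite in_itv/= andbT => t0.
  have T0 : 0 <= t + 1 by rewrite addr_ge0.
  have [Th [cT ThE dT BT]] := HB (t + 1) T0.
  have tT : 0 <= t <= t + 1 by rewrite t0 lerDl ler01.
  have Kt : [set v : 'rV[R]_N | forall i, `[theta0 0 i - B, theta0 0 i + B]%classic (v ord0 i)] (Th t).
    by move=> k /=; rewrite in_itv/=; exact: BT.
  have clt := cl t t0; rewrite (ThE _ tT) in clt.
  have [dF _ _] := HL _ Kt clt.
  have cFT : row i (F (Th t')) @[t' --> t] --> row i (F (Th t)).
    apply: (@row_cvg _ _ _ _ (nbhs t)).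
    by apply: (@continuous_cvg _ _ _ (nbhs t) _ Th F); [exact: differentiable_continuous|exact: cT].
  rewrite /from_subspace /= (ThE t tT).
  have h1 : \forall t' \near t, t' < t + 1 by apply: lt_nbhsl; rewrite ltrDl.
  move=> A HA.
  have H : \forall t' \near t, `[0, +oo[%classic t' -> A (row i (qstar (s t'))).
    have h2 : \forall t' \near t, A (row i (F (Th t'))) := cFT A HA.
    near=> t' => /=; rewrite in_itv/= andbT => h0.
    have ht' : t' < t + 1 by near: t'.
    by rewrite (ThE t') ?h0 ?ltW//; near: t'.
  exact: H.
move=> t i t0.
have T0 : 0 <= t + 1 by rewrite addr_ge0// ltW.
have [Th [cT ThE dT BT]] := HB (t + 1) T0.
have tT : 0 < t < t + 1 by rewrite t0 ltrDl ltr01.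
have tT' : 0 <= t <= t + 1 by case/andP: tT => /ltW -> /ltW ->.
have Kt : [set v : 'rV[R]_N | forall i, `[theta0 0 i - B, theta0 0 i + B]%classic (v ord0 i)] (Th t).
  by move=> k /=; rewrite in_itv/=; exact: BT.
have clt := cl t (ltW t0); rewrite (ThE _ tT') in clt.
have [dF DF _] := HL _ Kt clt.
pose w : 'rV[R]_N := \row_j (vel cin Omega rho kappa s t j / enorm (derive1 cin (Th t 0 j))).
have dTh : is_derive t 1 Th w.
  by apply/is_derive_mxP => k j; rewrite ord1 mxE; exact: dT.
have dFT := is_derive_comp_rV dF dTh.
set W := \sum_j _ in dFT.
exists (row i W).
  apply: (@near_eq_is_derive _ _ _ (fun t => row i (F (Th t)))).
    have : \forall t' \near t, t' \in `]0, (t + 1)[ by apply: near_in_itvoo; rewrite in_itv/=.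
    apply: filterS => t'; rewrite in_itv/= => /andP[h0 h1].
    by rewrite (ThE t')// !ltW.
  apply/is_derive_mxP => k j; rewrite mxE.
  rewrite (_ : (fun s => _) = fun s => F (Th s) i j); last by apply/funext => r; rewrite mxE.
  by move/is_derive_mxP: dFT; exact.
apply: le_trans (row_norm_le _ _) _; apply: le_trans (ler_norm_sum _ _ _) _.
apply: (@le_trans _ _ (\sum_(j < N) C / m * L * expR (- a * t))); last first.
  by rewrite sumr_const card_ord -[leLHS]mulr_natl mulrA.
apply: ler_sum => j _; rewrite normrZ mxE.
have /andP[h1 _] := Hm (Th t 0 j).
have H1 : `|vel cin Omega rho kappa s t j / enorm (derive1 cin (Th t 0 j))| <= C / m * expR (- a * t).
  rewrite normrM normfV (ger0_norm (enorm_ge0 _)) mulrAC.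
  apply: ler_pM; rewrite ?invr_ge0 ?enorm_ge0//; first exact: HC.
  by rewrite lef_pV2 ?posrE// (lt_le_trans m0).
rewrite [leRHS]mulrAC; apply: ler_pM => //; exact: DF.
Unshelve. all: by end_near.
Qed.

End OptimalPath.

(** * Convergence of the agents *)

Section ProductDerivative.
Variables (R : realType) (G : 'rV[R]_2 * 'rV[R]_2 -> R) (x q : 'rV[R]_2).
Hypothesis dG : differentiable G (x, q).

Lemma differentiable_fst_slot : differentiable (fun x' => G (x', q)) x.
Proof.
apply: (@differentiable_comp _ _ _ _ (fun x' : 'rV[R]_2 => (x', q)) G); [exact: differentiable_pair|exact: dG].
Qed.

Lemma differentiable_snd_slot : differentiable (fun q' => G (x, q')) q.
Proof.
apply: (@differentiable_comp _ _ _ _ (fun q' : 'rV[R]_2 => (x, q')) G); [exact: differentiable_pair|exact: dG].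
Qed.

Lemma diff_pair_grad v w : 'd G (x, q) (v, w) =
  dot (grad (fun x' => G (x', q)) x) v + dot (grad (fun q' => G (x, q')) q) w.
Proof.
have -> : (v, w) = (v, 0) + (0, w) :> 'rV[R]_2 * 'rV[R]_2.
  by congr pair; rewrite /= ?addr0 ?add0r.
have d1 := differentiable_fst_slot; have d2 := differentiable_snd_slot.
have e1 : 'd G (x, q) (v, 0) = dot (grad (fun x' => G (x', q)) x) v.
  apply: etrans (esym (deriveE (v, 0) dG)) _; apply: etrans _ (diff_gradE v d1).
  apply: etrans _ (deriveE v d1); rewrite /derive.
  rewrite (_ : (fun r : R => r^-1 *: ((G \o shift (x, q)) (r *: (v, 0)) - G (x, q))) =
    fun r => r^-1 *: (((fun x' => G (x', q)) \o shift x) (r *: v) - G (x, q))) //.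
  by apply/funext => r; rewrite -[LHS]/(r^-1 *: (G (r *: v + x, r *: 0 + q) - G (x, q))) scaler0 add0r.
have e2 : 'd G (x, q) (0, w) = dot (grad (fun q' => G (x, q')) q) w.
  apply: etrans (esym (deriveE (0, w) dG)) _; apply: etrans _ (diff_gradE w d2).
  apply: etrans _ (deriveE w d2); rewrite /derive.
  rewrite (_ : (fun r : R => r^-1 *: ((G \o shift (x, q)) (r *: (0, w)) - G (x, q))) =
    fun r => r^-1 *: (((fun q' => G (x, q')) \o shift q) (r *: w) - G (x, q))) //.
  by apply/funext => r; rewrite -[LHS]/(r^-1 *: (G (r *: 0 + x, r *: w + q) - G (x, q))) scaler0 add0r.
by rewrite linearD e1 e2.
Qed.

Lemma is_derive_pair_comp (c d : R -> 'rV[R]_2) (t : R) v w : (x, q) = (c t, d t) ->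
  is_derive t 1 c v -> is_derive t 1 d w ->
  is_derive t 1 (fun s => G (c s, d s))
    (dot (grad (fun x' => G (x', q)) x) v + dot (grad (fun q' => G (x, q')) q) w).
Proof.
move=> E [dc cv] [dd dv]; rewrite -diff_pair_grad.
have dc' : differentiable c t by apply/derivable1_diffP; exact: dc.
have dd' : differentiable d t by apply/derivable1_diffP; exact: dd.
have dp : differentiable (fun s => (c s, d s)) t by exact: differentiable_pair.
have dG' : differentiable G (c t, d t) by rewrite -E; exact: dG.
have dGp : differentiable (G \o (fun s => (c s, d s))) t by exact: (differentiable_comp dp dG').
apply: DeriveDef; first by apply/derivable1_diffP; exact: dGp.
apply: (etrans (@deriveE R R R (G \o (fun s => (c s, d s))) t (1 : R) dGp)).
rewrite (diff_comp dp dG') /= (diff_pair dc' dd') /= -cv -dv.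
by rewrite (deriveE (1 : R) dc') (deriveE (1 : R) dd') E.
Qed.

End ProductDerivative.

Section EnergyTarget.
Variables (R : realType) (Omega : set 'rV[R]_2) (h : 'rV[R]_2 -> R).

(** Moving the target by t w lengthens the distance by at most t |w| / m along the segment. Dividing
    the increment of D^2 / 2 by t = 1 / (n + 1) leaves D |w| / m in the limit. *)
Lemma energy_target_derive (x q w : 'rV[R]_2) (m : R) : 0 < m ->
  (\forall q' \near q, Omega q' /\ m <= h q') -> (dist_g Omega h x q < +oo)%E ->
  differentiable (energy Omega h x) q ->
  dot (grad (energy Omega h x) q) w <= fine (dist_g Omega h x q) * (enorm w / m).
Proof.
move=> m0 /nbhs_norm_ex[r r0 Hr] fin dE.
set D := fine (dist_g Omega h x q).
have fd : dist_g Omega h x q \is a fin_num by rewrite ge0_fin_numE// dist_g_ge0.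
have D0 : 0 <= D by rewrite fine_ge0// dist_g_ge0.
have l0 : is_derive (0 : R) 1 (fun s : R => q + (1 * s + 0) *: w) (1 *: w) := is_derive_line 1 0 q w 0.
have E0 : q + (1 * 0 + 0) *: w = q by rewrite mulr0 addr0 scale0r addr0.
have dl : is_derive (0 : R) 1 (fun s : R => energy Omega h x (q + (1 * s + 0) *: w))
    (dot (grad (energy Omega h x) q) w).
  have H : differentiable (energy Omega h x) ((fun s : R => q + (1 * s + 0) *: w) 0) by rewrite /= E0.
  have := is_derive_comp_grad H l0; by rewrite /= E0 scale1r.
have L1 := diffquot_cvg dl.
set e := enorm w / m.
have e0 : 0 <= e by rewrite divr_ge0 ?enorm_ge0// ltW.
have L2 : (fun n : nat => D * e + e ^+ 2 / 2 * n.+1%:R^-1) @ \oo --> D * e + e ^+ 2 / 2 * 0.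
  apply: cvgD; first exact: cvg_cst.
  by apply: cvgM; [exact: cvg_cst|exact: cvg_harmonic].
rewrite mulr0 addr0 in L2.
apply: (ler_cvg_to L1 L2).
have : \forall n \near \oo, n.+1%:R^-1 * `|w| < r.
  have L : (fun n : nat => n.+1%:R^-1 * `|w|) @ \oo --> 0 * `|w|.
    by apply: cvgM; [exact: cvg_harmonic|exact: cvg_cst].
  by rewrite mul0r in L; exact: (cvgr_lt _ L).
apply: filterS => n nr.
set t := n.+1%:R^-1 in nr *.
have t0 : 0 < t by rewrite invr_gt0 ltr0n.
have nt : n.+1%:R * t = 1 by rewrite divff// pnatr_eq0.
rewrite add0r !mul1r !addr0 scale0r addr0.
have seg u : 0 <= u <= 1 -> Omega (q + u *: ((q + t *: w) - q)) /\ m <= h (q + u *: ((q + t *: w) - q)).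
  move=> /andP[u0 u1]; apply: Hr.
  rewrite opprD addNKr normrN addrAC subrr add0r !normrZ.
  rewrite ger0_norm// (ger0_norm (ltW t0)); apply: le_lt_trans nr.
  by rewrite ler_piMl// mulr_ge0// ltW.
have T := dist_g_triangle_seg x m0 seg.
have en : enorm (q + t *: w - q) / m = t * e.
  by rewrite addrAC subrr add0r enormZ ger0_norm ?ltW// /e mulrA.
rewrite en -(fineK fd) -EFinD in T.
have fd' : dist_g Omega h x (q + t *: w) \is a fin_num.
  by rewrite ge0_fin_numE ?dist_g_ge0// (le_lt_trans T)// ltry.
rewrite -(fineK fd') lee_fin -/D in T.
have D'0 : 0 <= fine (dist_g Omega h x (q + t *: w)) by rewrite fine_ge0// dist_g_ge0.
rewrite /energy -/D.
set D' := fine _ in T D'0 *.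
have te : 0 <= t * e by rewrite mulr_ge0// ltW.
have DD : D' ^+ 2 <= (D + t * e) ^+ 2 by rewrite ler_sqr ?nnegrE// addr_ge0.
have n0 : 0 <= n.+1%:R :> R by [].
have := ler_wpM2r n0 (ler_wpM2r (_ : 0 <= 2^-1 :> R) (lerB DD (lexx (D ^+ 2)))).
rewrite invr_ge0 ler0n => /(_ isT) H.
rewrite -mulrBl; apply: le_trans H _.
have -> : ((D + t * e) ^+ 2 - D ^+ 2) / 2 * n.+1%:R = D * e * (n.+1%:R * t) + e ^+ 2 / 2 * t * (n.+1%:R * t).
  by field.
by rewrite nt !mulr1.
Qed.

End EnergyTarget.

Lemma grad_gE (R : realType) (h F : 'rV[R]_2 -> R) x : h x != 0 ->
  grad_g h F x = h x ^+ 2 *: grad F x.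
Proof.
move=> hx; have h2 : h x ^+ 2 != 0 by rewrite expf_neq0.
have E : metric h x = ((h x ^+ 2)^-1)%:M.
  apply/matrixP => j k; rewrite !mxE; by case: eqP => _; rewrite ?mul1r ?mul0r.
have : grad F x = (h x ^+ 2)^-1 *: grad_g h F x.
  have u : metric h x \in unitmx by rewrite E unitmxE det_scalar unitrX// unitfE invr_eq0.
  by rewrite -mul_mx_scalar -E /grad_g mulmxKV.
by move=> ->; rewrite scalerA divff// scale1r.
Qed.

(** * Bounds on h and finiteness of the distance *)

Section Field.
Variables (R : realType) (cin cout : R -> 'rV[R]_2) (Din Dout Omega : set 'rV[R]_2).
Hypothesis ann : annulus cin cout Din Dout Omega.
Variable h : 'rV[R]_2 -> R.
Hypothesis hC1 : forall q : 'rV[R]_2, Ck_at 1 h q.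
Hypothesis h_ge0 : Omega = [set q | 0 <= h q].
Hypothesis h_eq0 : forall q, h q = 0 <-> boundary Omega q.

Lemma h_diff u : differentiable h u.
Proof. by have [/nbhs_singleton] := hC1 u. Qed.

Lemma h_continuous : continuous h.
Proof. by move=> u; apply: differentiable_continuous; exact: h_diff. Qed.

Lemma grad_h_continuous : continuous (grad h).
Proof.
move=> u; apply: (@rV_cvg _ _ _ (nbhs u)) => j; rewrite mxE; under eq_fun do rewrite mxE.
by have [_ /(_ (delta_mx 0 j)) /nbhs_singleton] := hC1 u.
Qed.

Lemma interior_h_gt0 u : Omega° u <-> 0 < h u.
Proof.
split => [Ou|hu].
  have : Omega u := interior_subset Ou.
  rewrite {1}h_ge0 /= le_eqVlt => /predU1P[/esym /h_eq0[_ nO]|//].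
  by case: nO.
apply: contrapT => nO.
have : boundary Omega u.
  by split => //; apply: subset_closure; rewrite h_ge0 /= ltW.
by move=> /h_eq0 E; rewrite E ltxx in hu.
Qed.

(** [Omega] is not convex, so the Lipschitz bound comes from the mean value theorem in a cube [K]
    containing it, and the gradient is bounded on the whole cube. The factor 2 in G * 2 compares the
    Euclidean and sup norms. *)
Lemma h_bounds : exists H G : R, [/\ 0 < H, 0 < G,
  forall u, Omega u -> 0 <= h u <= H,
  forall u, Omega u -> differentiable h u /\ enorm (grad h u) <= G &
  exists2 L, 0 < L & forall u v, Omega u -> Omega v -> `|h u - h v| <= L * `|u - v|].
Proof.
have [B0 [_ HB0]] := compact_bounded (Omega_compact ann).
pose B := `|B0| + 1.
have B0' : 0 <= B by rewrite addr_ge0.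
have HB u : Omega u -> forall j, `[- B, B]%classic (u ord0 j).
  move=> Ou j; rewrite /= in_itv/= -ler_norml; apply: le_trans (coord_le_norm u j) _.
  by apply: (HB0 B) => //; rewrite /B; have := ler_norm B0; lra.
pose K : set 'rV[R]_2 := [set v | forall j, `[- B, B]%classic (v ord0 j)].
have cK : compact K := @rV_compact R 2 (fun=> `[- B, B]%classic) (fun=> @segment_compact R _ _).
have K0 : K !=set0 by exists 0 => j; rewrite /= in_itv/= mxE; lra.
have cg : continuous (fun u => enorm (grad h u)).
  by move=> u; apply: (@enorm_cvg _ _ (nbhs u)); exact: grad_h_continuous.
have [a _ Ha] := EVT_max_rV K0 cK (continuous_subspaceT h_continuous).
have [b _ Hb] := EVT_max_rV K0 cK (continuous_subspaceT cg).
pose G := enorm (grad h b) + 1.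
have G0 : 0 < G by rewrite ltr_wpDl ?enorm_ge0.
have HG u : K u -> enorm (grad h u) <= G.
  by move=> Ku; have := Hb u (mem_set Ku); rewrite /G; lra.
exists (`|h a| + 1), G; split => //.
- move=> u Ou; have := Ou; rewrite {1}h_ge0 /= => ->.
  have := Ha u (mem_set (HB u Ou)); have := ler_norm (h a); rewrite /=; lra.
- by move=> u Ou; split; [exact: h_diff|apply: HG; exact: HB].
exists (G * 2); first by rewrite mulr_gt0.
move=> u v Ou Ov.
have Ks t : 0 <= t <= 1 -> K (v + t *: (u - v)).
  move=> /andP[t0 t1] j; have := HB u Ou j; have := HB v Ov j.
  rewrite /= !in_itv/= !mxE => /andP[? ?] /andP[? ?]; apply/andP; split; nra.
pose f (t : R) := h (v + (1 * t + 0) *: (u - v)).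
have df (t : R) : is_derive t (1 : R) f (dot (grad h (v + (1 * t + 0) *: (u - v))) (u - v)).
  have [d e] := is_derive_comp_grad (h_diff (v + (1 * t + 0) *: (u - v))) (is_derive_line 1 0 v (u - v) t).
  by apply: DeriveDef; [exact: d|rewrite e scale1r].
have cf : {within `[0, 1], continuous f}.
  apply: derivable_within_continuous => t _; by have [] := df t.
have [t] := MVT ltr01 (fun t _ => df t) cf.
rewrite in_itv/= => /andP[t0 t1]; rewrite subr0 mulr1 /f mul1r mulr0 !addr0 scale1r scale0r addr0 subrKC => ->.
apply: le_trans (norm_dot_le _ _) _; rewrite -mulrA; apply: ler_pM; rewrite ?enorm_ge0//.
  by apply: HG; rewrite ?mul1r ?addr0; apply: Ks; rewrite !ltW.
exact: enorm_le_norm.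
Qed.

Lemma dist_finite u v : Omega° u -> Omega° v -> (dist_g Omega h u v < +oo)%E.
Proof.
apply: dist_g_lt_pinfty.
- exact: open_interior.
- exact: Omega_int_connected ann.
- exact: interior_subset.
- by move=> w /interior_h_gt0.
- by move=> w _; exact: h_continuous.
Qed.

End Field.

Lemma expR_decay (R : realType) (a : R) : 0 < a -> expR (- a * t) @[t --> +oo] --> (0 : R).
Proof.
move=> a0; apply/cvgrPdist_lt => e e0.
near=> t; rewrite sub0r normrN ger0_norm ?expR_ge0//.
have : - ln e / a < t by near: t; apply: nbhs_pinfty_gt; exact: num_real.
rewrite ltr_pdivrMr// => H.
by rewrite -ltr_ln ?posrE ?expR_gt0// expRK; lra.
Unshelve. all: by end_near.
Qed.

Lemma exp_increment_cvg (R : realType) (f : R -> R) (a K : R) : 0 < a ->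
  (forall x y, 0 <= x -> x <= y -> `|f y - f x| <= K * expR (- a * x)) ->
  cvg (f t @[t --> +oo]).
Proof.
move=> a0 H; apply/cauchy_cvgP; apply: cauchy_exP => e e0.
have L : K * expR (- a * t) @[t --> +oo] --> K * 0.
  by apply: cvgM; [exact: cvg_cst|exact: expR_decay].
rewrite mulr0 in L.
have : \forall t \near +oo, 0 <= t /\ K * expR (- a * t) < e.
  near=> t; split; first by near: t; exact: nbhs_pinfty_ge.
  by near: t; exact: (cvgr_lt _ L).
move=> /filter_ex[x [x0 xe]]; exists (f x).
have : \forall y \near +oo, x <= y by apply: nbhs_pinfty_ge; exact: num_real.
apply: filterS => y xy; rewrite /= /ball/= distrC.
exact: le_lt_trans (H x y x0 xy) xe.
Unshelve. all: by end_near.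
Qed.

Lemma Ck1_differentiable (R : realType) (V W : normedModType R) (f : V -> W) x :
  smooth_at f x -> differentiable f x.
Proof. by move=> /(_ 1%N)[/nbhs_singleton]. Qed.

Lemma cvg_pair_at (T : Type) (U V : topologicalType) (F : set_system T) (FF : Filter F)
    (f : T -> U) (g : T -> V) (l : U) (m : V) :
  f z @[z --> F] --> l -> g z @[z --> F] --> m -> (f z, g z) @[z --> F] --> (l, m).
Proof.
move=> fl gm A [[P Q] [/= Pl Qm] PQ].
have FP : F (f @^-1` P) := fl P Pl; have FQ : F (g @^-1` Q) := gm Q Qm.
have : F (fun z => A (f z, g z)).
  by apply: filterS (filterI FP FQ) => z [Pz Qz]; exact: (PQ (f z, g z) (conj Pz Qz)).
by [].
Qed.

(** * One agent pursuing a moving target *)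

Section Agent.
Variables (R : realType) (cin cout : R -> 'rV[R]_2) (Din Dout Omega : set 'rV[R]_2).
Hypothesis ann : annulus cin cout Din Dout Omega.
Variable h : 'rV[R]_2 -> R.
Hypothesis hC1 : forall q : 'rV[R]_2, Ck_at 1 h q.
Hypothesis h_ge0 : Omega = [set q | 0 <= h q].
Hypothesis h_eq0 : forall q, h q = 0 <-> boundary Omega q.
Variables (x q w : R -> 'rV[R]_2) (kappa a C c : R).
Hypothesis kappa_gt0 : 0 < kappa.
Hypothesis a_gt0 : 0 < a.
Hypothesis C_ge0 : 0 <= C.
Hypothesis c_gt0 : 0 < c.
Hypothesis x_cont : {within `[0, +oo[, continuous x}.
Hypothesis q_cont : {within `[0, +oo[, continuous q}.
Hypothesis x_init : Omega° (x 0).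
Hypothesis q_in : forall t : R, 0 <= t -> c <= h (q t).
Hypothesis q_der : forall t : R, 0 < t -> is_derive t 1 q (w t).
Hypothesis w_le : forall t : R, 0 < t -> `|w t| <= C * expR (- a * t).
Hypothesis E_diff : forall t : R, 0 <= t -> Omega° (x t) ->
  differentiable (fun z : 'rV[R]_2 * 'rV[R]_2 => energy Omega h z.1 z.2) (x t, q t).
Hypothesis x_ode : forall t : R, 0 < t -> Omega° (x t) ->
  is_derive t 1 x (- kappa *: grad_g h (fun y => energy Omega h y (q t)) (x t)).

Let intP := interior_h_gt0 h_ge0 h_eq0.
Let hc := h_continuous hC1.

Let Phi t := energy Omega h (x t) (q t).

Lemma q_int t : 0 <= t -> Omega° (q t).
Proof. by move=> t0; apply/intP; exact: lt_le_trans c_gt0 (q_in t0). Qed.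

(** Size of the forcing due to the motion of the target, whose Euclidean speed is at most 2C e^(-at)
    and near which h >= c / 2. *)
Definition energy_rate := 16 * C ^+ 2 / (c ^+ 2 * kappa).
Local Notation K := energy_rate.

Let K_ge0 : 0 <= K.
Proof. by rewrite /K divr_ge0 ?mulr_ge0 ?sqr_ge0// ltW. Qed.

(** The eikonal inequality yields the dissipation 2 kappa Phi. Half of it absorbs, by the
    arithmetic-geometric inequality, the cross term between distance and target speed, so the
    resulting bound is linear in [Phi]. *)
Lemma Phi_derive t : 0 < t -> Omega° (x t) -> exists2 d, is_derive t 1 Phi d &
  d <= - kappa * Phi t + K * expR (- (2 * a) * t).
Proof.
move=> t0 Ox; have t0' := ltW t0.
have Oq := q_int t0'.
have fin := dist_finite ann hC1 h_ge0 h_eq0 Ox Oq.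
have hx : 0 < h (x t) by apply/intP.
have dG := E_diff t0' Ox.
have dPhi := is_derive_pair_comp dG erefl (x_ode t0 Ox) (q_der t0).
set d1 := dot _ _ in dPhi; set d2 := dot _ _ in dPhi.
exists (d1 + d2); first exact: dPhi.
have dE1 := differentiable_fst_slot dG; have dE2 := differentiable_snd_slot dG.
have eik : 2 * Phi t <= h (x t) ^+ 2 * enorm (grad (fun y => energy Omega h y (q t)) (x t)) ^+ 2.
  apply: (eikonal_energy (interior_subset Ox) hx (@hc _) _ fin dE1).
  have : \forall u \near x t, Omega° u by apply: open_nbhs_nbhs; split; [exact: open_interior|].
  by apply: filterS => u /intP.
have H1 : d1 <= - kappa * (2 * Phi t).
  rewrite /d1 grad_gE ?gt_eqF// !dotZr -sqr_enorm mulNr [leRHS]mulNr lerN2.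
  by rewrite ler_pM2l//.
have c2 : 0 < c / 2 by rewrite divr_gt0.
have near_q : \forall q' \near q t, Omega q' /\ c / 2 <= h q'.
  have : \forall u \near q t, Omega° u by apply: open_nbhs_nbhs; split; [exact: open_interior|].
  have : \forall u \near q t, c / 2 <= h u.
    have cc : c / 2 < h (q t) by apply: lt_le_trans (q_in t0'); lra.
    by have := @hc (q t); move=> /cvgr_ge; apply.
  by apply: filterS2 => u hu Ou; split => //; exact: interior_subset.
have H2 := energy_target_derive (w t) c2 near_q fin dE2.
rewrite -/d2 in H2.
set D := fine _ in H2.
have D0 : 0 <= D by rewrite fine_ge0// dist_g_ge0.
have PD : Phi t = D ^+ 2 / 2 by [].
have ew : enorm (w t) <= 2 * C * expR (- a * t).
  by apply: le_trans (enorm_le_norm _) _; rewrite -mulrA ler_pM2l//; exact: w_le.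
set r := enorm (w t) in H2 ew.
have r0 : 0 <= r by exact: enorm_ge0.
have r2 : r ^+ 2 <= 4 * C ^+ 2 * expR (- (2 * a) * t).
  have e2 : expR (- (2 * a) * t) = expR (- a * t) ^+ 2.
    by rewrite expr2 -expRD; congr expR; ring.
  rewrite e2; apply: le_trans (_ : _ <= (2 * C * expR (- a * t)) ^+ 2) _.
    by rewrite ler_sqr ?nnegrE// mulr_ge0 ?expR_ge0// mulr_ge0.
  by rewrite !exprMn; lra.
have am : D * (r / (c / 2)) <= kappa * (D ^+ 2 / 2) + 4 / (c ^+ 2 * kappa) * r ^+ 2 / 2.
  (* AM-GM *)
  have E : kappa * (D ^+ 2 / 2) + 4 / (c ^+ 2 * kappa) * r ^+ 2 / 2 - D * (r / (c / 2)) =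
      (kappa * D - 2 * r / c) ^+ 2 / (2 * kappa) by field; rewrite !gt_eqF.
  by rewrite -subr_ge0 E divr_ge0 ?sqr_ge0// mulr_ge0// ltW.
have K2 : 4 / (c ^+ 2 * kappa) * r ^+ 2 / 2 <= K * expR (- (2 * a) * t).
  have k0 : 0 < c ^+ 2 * kappa by rewrite mulr_gt0// exprn_gt0.
  have : (4 / (c ^+ 2 * kappa) / 2) * r ^+ 2 <= (4 / (c ^+ 2 * kappa) / 2) * (4 * C ^+ 2 * expR (- (2 * a) * t)).
    by apply: ler_wpM2l => //; rewrite !divr_ge0// ltW.
  have -> : (4 / (c ^+ 2 * kappa) / 2) * (4 * C ^+ 2 * expR (- (2 * a) * t)) = K / 2 * expR (- (2 * a) * t).
    by rewrite /K; field; rewrite !gt_eqF.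
  have : 0 <= K * expR (- (2 * a) * t).
    exact: mulr_ge0 K_ge0 (expR_ge0 _).
  lra.
rewrite -PD in am; lra.
Qed.

(** This rate is at most the dissipation [kappa] and strictly below the rate 2a of the forcing, as
    [gronwall_exp] requires. *)
Let k := Num.min kappa a.
Let k_gt0 : 0 < k. Proof. by rewrite lt_min kappa_gt0. Qed.
Let k_lt : k < 2 * a.
Proof. by apply: le_lt_trans (_ : k <= a) _; rewrite ?ge_min ?lexx ?orbT// ltr_pMl// ltr1n. Qed.

Let Phi0 := Phi 0 + K / (2 * a - k).

Let Phi0_ge0 : 0 <= Phi0.
Proof. by rewrite addr_ge0 ?energy_ge0// divr_ge0// subr_ge0 ltW. Qed.

Lemma Phi_decay T : 0 <= T -> (forall t, 0 <= t <= T -> Omega° (x t)) ->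
  Phi T <= Phi0 * expR (- k * T).
Proof.
move=> T0 Ox.
have K0 : 0 <= K.
  exact: K_ge0.
have cP : {within `[0, T], continuous Phi}.
  have sub : `[0, T]%classic `<=` `[0, +oo[%classic.
    by move=> r /=; rewrite !in_itv/= andbT => /andP[].
  have /subspace_continuousP xc := continuous_subspaceW sub x_cont.
  have /subspace_continuousP qc := continuous_subspaceW sub q_cont.
  apply/subspace_continuousP => t tT.
  have tT' : 0 <= t <= T by move: tT; rewrite /= in_itv/=.
  have t0 : 0 <= t by case/andP: tT'.
  have H2 := differentiable_continuous (E_diff t0 (Ox t tT')).
  have xc' : x t' @[t' --> within `[0, T]%classic (nbhs t)] --> x t := xc t tT.
  have qc' : q t' @[t' --> within `[0, T]%classic (nbhs t)] --> q t := qc t tT.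
  have H1 : (x t', q t') @[t' --> within `[0, T]%classic (nbhs t)] --> (x t, q t) by exact: cvg_pair_at.
  move=> A HA; have HB := H2 A HA; exact: (H1 _ HB).
have /choice[d Hd] : forall t : R, exists d, 0 < t < T -> is_derive t 1 Phi d /\
    d <= - k * Phi t + K * expR (- (2 * a) * t).
  move=> t; have [tT|ntT] := boolP (0 < t < T); last by exists 0.
  have /andP[t0 tT'] := tT; have tt : 0 <= t <= T by rewrite !ltW.
  have [d dd dle] := Phi_derive t0 (Ox t tt); exists d => _; split; first exact: dd.
  apply: le_trans dle _; rewrite lerD2r.
  by rewrite ler_wpM2r ?energy_ge0// lerN2 ge_min lexx.
have := gronwall_exp T0 cP (fun t tT => (Hd t tT).1) (fun t tT => (Hd t tT).2) K0 k_lt.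
rewrite !mulr0 expR0 !mulr1 -/Phi0 => H.
rewrite mulNr expRN ler_pdivlMr ?expR_gt0//; exact: H.
Qed.

(** [Phi] never exceeds [Phi0], so the distance to the target is at most [D], and the logarithmic
    bound gives h(x) >= h(q) e^(-GD). The depth does not depend on the time [r], which makes the
    continuation possible. *)
Lemma agent_depth : exists2 del, 0 < del & forall r : R, 0 <= r ->
  (forall t, 0 <= t <= r -> Omega° (x t)) -> del <= h (x r).
Proof.
have [H [G [H0 G0 hH hG hL]]] := h_bounds ann hC1 h_ge0.
pose D := Num.sqrt (2 * Phi0).
exists (c * expR (- (G * D))); first by rewrite mulr_gt0// expR_gt0.
move=> r r0 Ob.
have Or : Omega° (x r) by apply: Ob; rewrite r0 lexx.
have P2 : Phi r <= Phi0.
  apply: le_trans (Phi_decay r0 Ob) _; rewrite ler_piMr ?Phi0_ge0// -expR0 ler_expR mulNr oppr_le0.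
  by rewrite mulr_ge0// ltW.
have Oq := q_int r0.
have hx : 0 < h (x r) by apply/intP.
have hq : 0 < h (q r) by apply/intP.
have fin := dist_finite ann hC1 h_ge0 h_eq0 Or Oq.
have ln_le := dist_g_ge_ln G0 hx hq hL hG.
have fd : dist_g Omega h (x r) (q r) \is a fin_num by rewrite ge0_fin_numE// dist_g_ge0.
rewrite -(fineK fd) -EFinM lee_fin in ln_le.
have dD : fine (dist_g Omega h (x r) (q r)) <= D.
  rewrite -ler_sqr ?nnegrE ?sqrtr_ge0 ?fine_ge0 ?dist_g_ge0//.
  rewrite sqr_sqrtr ?mulr_ge0 ?Phi0_ge0//.
  have : Phi r = fine (dist_g Omega h (x r) (q r)) ^+ 2 / 2 by [].
  lra.
have := ler_wpM2l (ltW G0) dD.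
have : ln c <= ln (h (q r)) by rewrite ler_ln ?posrE//; exact: q_in.
move=> l1 l2; rewrite -ler_ln ?posrE ?mulr_gt0 ?expR_gt0// lnM ?posrE ?expR_gt0// expRK; lra.
Qed.

(** At a first exit time [tau] the depth bound holds at all earlier times, hence by continuity at
    [tau] too, where [h] would be positive and the point interior. *)
Lemma agent_interior t : 0 <= t -> Omega° (x t).
Proof.
move=> t0; apply: contrapT => nOt.
have [del del0 hdel] := agent_depth.
have cx : continuous (fun t : R => x (Num.max 0 t)) by exact: continuous_extend_left.
have cS : closed (~` Omega°) by apply: open_closedC; exact: open_interior.
have tt : exists2 r, 0 <= r <= t & (~` Omega°) (x (Num.max 0 r)).
  by exists t; [rewrite t0 lexx|rewrite (max_r t0); exact: nOt].
have [tau [/andP[tau0 _] nOtau before]] := first_hit cx cS t0 tt.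
have tau_gt0 : 0 < tau.
  rewrite lt_neqAle tau0 andbT eq_sym; apply/eqP => E; apply: nOtau.
  rewrite E maxxx; exact: x_init.
have Ob r : 0 <= r < tau -> Omega° (x r).
  move=> rr; have /andP[r0 _] := rr; apply: contrapT => nO.
  by have := before r rr; rewrite (max_r r0); apply; exact: nO.
have oG : open (h @^-1` [set y | y < del]).
  by apply: open_comp; [move=> u _; exact: hc|exact: open_lt].
have bG r : 0 <= r < tau -> ~ (h @^-1` [set y | y < del]) (x (Num.max 0 r)).
  move=> /andP[r0 rt]; rewrite (max_r r0) /= => hd.
  have : del <= h (x r).
    apply: (hdel r r0) => s /andP[s0 sr]; apply: Ob; rewrite s0; exact: le_lt_trans sr rt.
  by rewrite leNgt hd.
apply: (first_hit_notin cx oG (fun u Gu => Gu) tau_gt0 bG).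
rewrite /= ltNge; apply/negP => hd; apply: nOtau; apply/intP; exact: lt_le_trans del0 hd.
Qed.

Lemma agent_converges : cvg (q t @[t --> +oo]) /\ x t @[t --> +oo] --> lim (q t @[t --> +oo]).
Proof.
have [H [G [H0 G0 hH hG hL]]] := h_bounds ann hC1 h_ge0.
have qj (j : 'I_2) : cvg (q t 0 j @[t --> +oo]).
  apply: (@exp_increment_cvg _ _ a (C / a)) => // u v u0 uv.
  apply: (@exp_increment _ (fun t => q t 0 j) (fun t => w t 0 j)) => //.
  - have sub : `[u, v]%classic `<=` `[0, +oo[%classic.
      by move=> r /=; rewrite !in_itv/= andbT => /andP[ur _]; exact: le_trans ur.
    by move=> t; apply: coord_cvg; exact: (continuous_subspaceW sub q_cont).
  - move=> t /andP[t0 _]; have t0' := le_lt_trans u0 t0.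
    by have /is_derive_coordP := q_der t0'; exact.
  - move=> t /andP[t0 _]; have t0' := le_lt_trans u0 t0.
    by apply: le_trans (coord_le_norm _ j) _; exact: w_le.
have cq : q t @[t --> +oo] --> (\row_j lim (q t 0 j @[t --> +oo]) : 'rV[R]_2).
  by apply: rV_cvg => j; rewrite mxE; exact: qj.
split; first by apply/cvg_ex; eexists; exact: cq.
rewrite (cvg_lim (@norm_hausdorff _ _) cq).
have xq : x t - q t @[t --> +oo] --> (0 : 'rV[R]_2).
  apply/cvgrPdist_lt => e e0.
  have L : 2 * H ^+ 2 * Phi0 * expR (- k * t) @[t --> +oo] --> 2 * H ^+ 2 * Phi0 * 0.
    by apply: cvgM; [exact: cvg_cst|exact: expR_decay].
  rewrite mulr0 in L.
  near=> t; have t0 : 0 <= t by near: t; apply: nbhs_pinfty_ge; exact: num_real.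
  have Le : 2 * H ^+ 2 * Phi0 * expR (- k * t) < e ^+ 2.
    by near: t; apply: (cvgr_lt _ L); exact: exprn_gt0.
  have P1 : Phi t <= Phi0 * expR (- k * t).
    by apply: (Phi_decay t0) => r /andP[r0 _]; exact: agent_interior.
  have Ox := agent_interior t0.
  have fin := dist_finite ann hC1 h_ge0 h_eq0 Ox (q_int t0).
  have := enorm_le_dist_g (x t) (q t) H0 hH.
  have fd : dist_g Omega h (x t) (q t) \is a fin_num by rewrite ge0_fin_numE// dist_g_ge0.
  rewrite -(fineK fd) -EFinM lee_fin.
  set D := fine _ => HD.
  have PD : Phi t = D ^+ 2 / 2 by [].
  rewrite sub0r opprB; apply: le_lt_trans (norm_le_enorm _) _.
  rewrite -ltr_sqr ?nnegrE ?enorm_ge0 ?ltW//; apply: le_lt_trans Le.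
  apply: (@le_trans _ _ ((H * D) ^+ 2)).
    by rewrite ler_sqr ?nnegrE ?enorm_ge0// (le_trans (enorm_ge0 _) HD).
  (* The Euclidean distance is at most [H] times the conformal one, so its square is at most 2 H^2
     Phi and decays exponentially. *)
  rewrite exprMn (_ : H ^+ 2 * D ^+ 2 = 2 * H ^+ 2 * Phi t); last by rewrite PD; field.
  rewrite -[leRHS]mulrA; apply: ler_wpM2l => //; by rewrite mulr_ge0// sqr_ge0.
have -> : (fun t => x t) = (fun t => (x t - q t) + q t).
  by apply/funext => t; rewrite subrK.
rewrite -[X in _ --> X]add0r.
exact: (cvgD xq cq).
Unshelve. all: by end_near.
Qed.

End Agent.

Theorem theorem1 (R : realType) (N : nat) (hN : (0 < N)%N)
  (* coverage region *)
  (cin cout : R -> 'rV[R]_2) (Omega : set 'rV[R]_2) (h : 'rV[R]_2 -> R)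
  (hcin : smooth_closed_curve cin) (hcout : smooth_closed_curve cout)
  (hOmega : annular_region cin cout Omega)
  (hC1 : forall q : 'rV[R]_2, Ck_at 1 h q)
  (h_ge0 : Omega = [set q | 0 <= h q])
  (h_eq0 : forall q, h q = 0 <-> boundary Omega q)
  (* density *)
  (rho : 'rV[R]_2 -> R) (rho_min rho_max : R)
  (rho_min_gt0 : 0 < rho_min)
  (rho_bounds : forall q, Omega q -> rho_min <= rho q <= rho_max)
  (rho_meas : measurable_fun (@point R @^-1` Omega) (rho \o @point R))
  (* coverage cost *)
  (f : 'rV[R]_2 -> 'rV[R]_2 -> R)
  (f_int : forall x, Omega x ->
     plane_integrable Omega (fun q => f x q * rho q))
  (J_smooth : forall (p : 'M[R]_(N, 2)) (theta : 'rV[R]_N),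
     (forall i, Omega (row i p)) ->
     partition_config cin Omega (on_curve cin theta) ->
     smooth_at (fun z : 'M[R]_(N, 2) * 'rV[R]_N =>
       cost cin Omega rho f z.1 (on_curve cin z.2)) (p, theta))
  (* gains and trajectories *)
  (kappa_s kappa_p : R) (kappa_s_gt0 : 0 < kappa_s) (kappa_p_gt0 : 0 < kappa_p)
  (p s : R -> 'M[R]_(N, 2))
  (p_cont : {within `[0, +oo[, continuous p})
  (s_cont : {within `[0, +oo[, continuous s})
  (p_init : forall i, Omega (row i (p 0)) /\ ~ boundary Omega (row i (p 0)))
  (s_part : forall t : R, 0 <= t -> partition_config cin Omega (s t))
  (s_ode : forall (t : R) (i : 'I_N), 0 < t ->
     is_derive t 1 (fun t' => row i (s t'))
       (- (kappa_s * (workload cin Omega rho (s t) i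
                      - workload cin Omega rho (s t) (ord_pred i)))
          *: nu cin (row i (s t))))
  (* optimal positions, as functions of the partition *)
  (qstar : 'M[R]_(N, 2) -> 'M[R]_(N, 2))
  (qstar_opt : forall s', closure (s @` `[0, +oo[) s' -> forall i,
     optimal_position cin Omega rho f s' i (row i (qstar s')))
  (qstar_smooth : forall theta : 'rV[R]_N,
     closure (s @` `[0, +oo[) (on_curve cin theta) ->
     smooth_at (fun theta' => qstar (on_curve cin theta')) theta)
  (* control law, where the metric is defined *)
  (E_smooth : forall (t : R) (i : 'I_N), 0 <= t -> Omega° (row i (p t)) ->
     smooth_at (fun z : 'rV[R]_2 * 'rV[R]_2 => energy Omega h z.1 z.2)
       (row i (p t), row i (qstar (s t))))
  (p_ode : forall (t : R) (i : 'I_N), 0 < t -> Omega° (row i (p t)) ->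
     is_derive t 1 (fun t' => row i (p t'))
       (- kappa_p *: grad_g h (fun x => energy Omega h x (row i (qstar (s t))))
                       (row i (p t)))) :
  forall i : 'I_N,
    [/\ cvg (row i (qstar (s t)) @[t --> +oo]),
        row i (p t) @[t --> +oo] --> lim (row i (qstar (s t)) @[t --> +oo])
      & forall t : R, 0 <= t -> ~ boundary Omega (row i (p t))].
Proof.
move=> i.
have [Din [Dout [ein eout inout OE]]] := hOmega.
have ann : annulus cin cout Din Dout Omega by split.
(* A subregion is contained in the closed set [Omega], so an interior point of it is interior to
   [Omega], where [h] is positive. *)
have q_pos s' : closure (s @` `[0, +oo[) s' -> forall i, 0 < h (row i (qstar s')).
  move=> cs' k; have [Is _ _] := qstar_opt s' cs' k.
  apply/(interior_h_gt0 h_ge0 h_eq0); apply: interiorS Is.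
  have sub : cell cin Omega s' k `<=` Omega.
    by move=> y [z _ /connected_component_sub[]].
  have := closureS sub; rewrite -(closure_id Omega).1//; exact: Omega_closed ann.
have qC1 theta : closure (s @` `[0, +oo[) (on_curve cin theta) ->
    Ck_at 1 (fun theta' => qstar (on_curve cin theta')) theta.
  by move=> /qstar_smooth /(_ 1%N).
have [a [C [c [ac c0 qc qcont qder]]]] := q_path ann rho_min_gt0 rho_bounds rho_meas hN
  kappa_s_gt0 s_cont s_part s_ode (h_continuous hC1) q_pos qC1.
have [a0 C0] := ac.
have /choice[w Hw] : forall t : R, exists w : 'rV[R]_2, 0 < t ->
    is_derive t 1 (fun t => row i (qstar (s t))) w /\ `|w| <= C * expR (- a * t).
  move=> t; have [t0|t0] := ltP 0 t; last by exists 0.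
  by have [w w1 w2] := qder t i t0; exists w.
have x_cont : {within `[0, +oo[, continuous (fun t => row i (p t))}.
  by move=> t; apply: row_cvg; exact: p_cont.
have x_init : Omega° (row i (p 0)).
  have [Op nb] := p_init i; apply/(interior_h_gt0 h_ge0 h_eq0).
  have : 0 <= h (row i (p 0)) by move: Op; rewrite h_ge0.
  by rewrite le_eqVlt => /predU1P[/esym /h_eq0|].
have qin (t : R) (t0 : 0 <= t) := qc t i t0.
have qd (t : R) (t0 : 0 < t) := (Hw t t0).1.
have wle (t : R) (t0 : 0 < t) := (Hw t t0).2.
have Ed (t : R) (t0 : 0 <= t) (Ox : Omega° (row i (p t))) := Ck1_differentiable (E_smooth t i t0 Ox).
have xo (t : R) (t0 : 0 < t) (Ox : Omega° (row i (p t))) := p_ode t i t0 Ox.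
have [cq xq] := agent_converges ann hC1 h_ge0 h_eq0 kappa_p_gt0 a0 C0 c0 x_cont (qcont i) x_init qin qd wle Ed xo.
split; [exact: cq|exact: xq|move=> t t0 [_ nO]].
apply: nO.
exact: (agent_interior ann hC1 h_ge0 h_eq0 kappa_p_gt0 a0 C0 c0 x_cont (qcont i) x_init qin qd wle Ed xo t0).
Qed.
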